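(* Let $k\ge 2$ and $b\ge 2$ be integers and let $\mathcal T_{k,b}$ be the class of trees with exactly $k$ interior vertices and exactly $b$ leaves. Then the minimum of the second Dirichlet eigenvalue $\lambda_2(T)$ among $T\in\mathcal T_{k,b}$ is attained as follows. (1) If $k=2t+1$, then $T\in\mathcal T_{k,b}$ attains the minimum if and only if $T$ is obtained from a path $P_{2t+3}=v_1\sim v_2\sim\cdots\sim v_{2t+3}$ by attaching the remaining $b-2$ leaves to the vertex $v_{t+2}$. (2) If $k=2t$ and $b=2r$, then $T\in\mathcal T_{k,b}$ attains the minimum if and only if $T$ is obtained from two disjoint copies of $C_{t,r}$ by joining by an edge the vertex $v_1$ of one copy and the corresponding vertex $v_1'$ of the other copy. (3) If $k=2t$ and $b=2r+1$, then $T\in\mathcal T_{k,b}$ attains the minimum if and only if $T$ is obtained from one copy of $C_{t,r}$ and one disjoint copy of $C_{t,r+1}$ by joining by an edge the vertex $v_1$ of $C_{t,r}$ and the vertex $v_1'$ of $C_{t,r+1}$ (the vertex playing the role of $v_1$ in $C_{t,r+1}$).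
   Context: All graphs are finite, simple and undirected. For a tree $T$, the boundary $B$ is the set of all leaves and the interior is $\Omega=V(T)\setminus B$ (the interior vertices are the non-leaves). All edge weights and vertex measures are $1$. The Dirichlet eigenvalue problem is $-\Delta f(x)=\lambda f(x)$ for $x\in\Omega$ and $f(x)=0$ for $x\in B$, where $\Delta f(x)=\sum_{y\sim x}(f(y)-f(x))$. Equivalently, the Dirichlet eigenvalues $0<\lambda_1(T)\le\lambda_2(T)\le\cdots\le\lambda_{|\Omega|}(T)$ are the eigenvalues of the principal submatrix, indexed by $\Omega$, of the Laplacian matrix (degree matrix minus adjacency matrix) of $T$. For integers $s\ge1$ and $q\ge1$, $C_{s,q}$ is the tree constructed as follows: start with a path $v_1v_2\cdots v_s$; attach $q-1$ leaves (pendant vertices) to $v_1$ and one leaf to $v_s$ (when $s=1$, all $q$ leaves are attached to $v_1=v_s$). *)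

(* Defs.v *)
From mathcomp Require Import all_boot all_order all_algebra.
From mathcomp Require Import reals polyorder polyrcf.

Set Implicit Arguments.
Unset Strict Implicit.
Unset Printing Implicit Defensive.

Import Order.TTheory GRing.Theory Num.Theory.
Local Open Scope ring_scope.

Record sgraph := SGraph {
  vertex :> finType;
  edge : rel vertex;
  edge_sym : symmetric edge;
  edge_irrefl : irreflexive edge
}.

Definition isomorphic (G H : sgraph) : Prop :=
  exists2 f : G -> H, bijective f & forall x y, edge (f x) (f y) = edge x y.

Definition connected (G : sgraph) : Prop :=
  forall x y : G, connect (@edge G) x y.

(* [ucycle] alone also accepts the degenerate 2-cycles x, y, x *)
Definition acyclic (G : sgraph) : Prop :=
  forall c : seq G, (2 < size c)%N -> ~ ucycle (@edge G) c.

Definition is_tree (G : sgraph) : Prop :=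
  [/\ (0 < #|G|)%N, connected G & acyclic G].

Definition degree (G : sgraph) (x : G) : nat := #|[set y | edge x y]|.

Definition leaves (G : sgraph) : {set G} := [set x | degree x == 1%N].

Definition interior (G : sgraph) : {set G} := ~: leaves G.

Definition tree_class (k b : nat) (G : sgraph) : Prop :=
  [/\ is_tree G, #|interior G| = k & #|leaves G| = b].

Definition laplacian (R : realType) (G : sgraph) (x y : G) : R :=
  (degree x)%:R *+ (x == y) - (edge x y)%:R.

Definition dirichlet_mx (R : realType) (G : sgraph) : 'M[R]_#|interior G| :=
  \matrix_(i, j) laplacian R (enum_val i) (enum_val j).

(* The real eigenvalues of a matrix in nondecreasing order ([rootsR] is sorted),
   each repeated according to its multiplicity; for a symmetric matrix these are
   all the eigenvalues. *)
Definition spectrum (R : realType) (n : nat) (A : 'M[R]_n) : seq R :=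
  let p := char_poly A in flatten [seq nseq (\mu_x p) x | x <- rootsR p].

(* [dirichlet_eigenvalue R G i] is $\lambda_i(G)$, for 1 <= i <= #|interior G| *)
Definition dirichlet_eigenvalue (R : realType) (G : sgraph) (i : nat) : R :=
  nth 0 (spectrum (dirichlet_mx R G)) i.-1.

Definition attains_min_lambda2 (R : realType) (k b : nat) (G : sgraph) : Prop :=
  tree_class k b G /\
  forall H : sgraph, tree_class k b H ->
    dirichlet_eigenvalue R G 2%N <= dirichlet_eigenvalue R H 2%N.

Section PathGraph.
Variable n : nat.

Definition path_rel : rel 'I_n :=
  fun i j => (i.+1 == j :> nat) || (j.+1 == i :> nat).

Lemma path_rel_sym : symmetric path_rel.
Proof. by move=> i j; rewrite /path_rel orbC. Qed.

Lemma path_rel_irrefl : irreflexive path_rel.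
Proof. by move=> i; rewrite /path_rel orbb eqn_leq ltnn. Qed.

Definition path_graph : sgraph := SGraph path_rel_sym path_rel_irrefl.
End PathGraph.

Section AttachLeaves.
Variables (G : sgraph) (v : G) (m : nat).

Definition attach_rel : rel (G + 'I_m)%type := fun a b =>
  match a, b with
  | inl x, inl y => edge x y
  | inl x, inr _ => x == v
  | inr _, inl y => y == v
  | inr _, inr _ => false
  end.

Lemma attach_rel_sym : symmetric attach_rel.
Proof. by move=> [x|i] [y|j] //=; apply: edge_sym. Qed.

Lemma attach_rel_irrefl : irreflexive attach_rel.
Proof. by move=> [x|i] //=; apply: edge_irrefl. Qed.

Definition attach_leaves : sgraph := SGraph attach_rel_sym attach_rel_irrefl.
End AttachLeaves.

Section JoinByEdge.
Variables (G : sgraph) (u : G) (H : sgraph) (v : H).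

Definition join_rel : rel (G + H)%type := fun a b =>
  match a, b with
  | inl x, inl y => edge x y
  | inl x, inr y => (x == u) && (y == v)
  | inr y, inl x => (x == u) && (y == v)
  | inr x, inr y => edge x y
  end.

Lemma join_rel_sym : symmetric join_rel.
Proof. by move=> [x|x] [y|y] //=; apply: edge_sym. Qed.

Lemma join_rel_irrefl : irreflexive join_rel.
Proof. by move=> [x|x] //=; apply: edge_irrefl. Qed.

Definition join_by_edge : sgraph := SGraph join_rel_sym join_rel_irrefl.
End JoinByEdge.

(* $C_{s,q}$ for s, q >= 1; the path vertices v_1, ..., v_s are numbered from 0,
   and the type 'I_s.-1.+1 makes both path ends available as [ord0], [ord_max]. *)
Definition C_path (s : nat) : sgraph := path_graph s.-1.+1.

Definition C_first (s : nat) : C_path s := ord0.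
Definition C_last (s : nat) : C_path s := ord_max.

Definition C_graph (s q : nat) : sgraph :=
  @attach_leaves (attach_leaves (C_first s) q.-1) (inl (C_last s)) 1%N.

Definition C_v1 (s q : nat) : C_graph s q := inl (inl (C_first s)).

Definition join_C (s q s' q' : nat) : sgraph :=
  join_by_edge (C_v1 s q) (C_v1 s' q').

(* $v_{t+2}$ has index t + 1 in the numbering from 0 *)
Definition path_center (t : nat) : path_graph (2 * t + 2).+1%N := inord t.+1.

Definition path_with_center_leaves (t m : nat) : sgraph :=
  attach_leaves (path_center t) m.

(* Main.v *)
Require Import Defs.
From mathcomp Require Import all_boot all_order all_algebra.
From mathcomp Require Import reals.
From mathcomp Require Import complex spectral polyorder polyrcf.
From mathcomp Require Import ring lra zify.

(* Write E(f) for the sum of (f x - f y)^2 over the edges, f vanishing on the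
   leaves, and B(u;v) for the component of u in T - v when u ~ v.

   A branch B(u;v) with at most t interior vertices and p leaves, in which u has
   an extra potential alpha >= 1, is compared with a path of t vertices carrying
   the potential p + alpha - 1 at one end and 1 at the other. Given f >= 0, choose
   a path from the minimum z of f through its maximum up to a leaf or up to v, and
   insert the remaining vertices between consecutive values that separate them:
   the energy of the edges does not increase, and all the potentials but one are
   at least what they would be at z. Hence the Rayleigh quotient on the branch is
   at least the ground energy of the path, and equality forces the shape C_{t,p}.

   For odd k remove a centroid v (the condition f(v) = 0 costs one dimension,
   alpha = 1 on every branch). For even k, either all branches at the centroid are
   so small that the bound is strict, or an edge uv splits the interior in halves;
   the condition a f(u) + f(v) = 0 then decouples the two sides with alpha = 1 + a
   and alpha = 1 + 1/a, where a makes both sides see the same end potential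
   (b + 2 + sqrt((q - p)^2 + 4)) / 2, which is smallest for balanced leaf numbers. *)

(** The second eigenvalue enters through a hyperplane: the span of the two lowest eigenvectors
    contains a nonzero [f] obeying any one linear equation, with Rayleigh quotient at most lambda_2.
    The equation is chosen so that the energy splits without loss. If f(v) = -a f(u), then (f(u) -
    f(v))^2 = (1 + a) f(u)^2 + (1 + 1/a) f(v)^2, and equal end potentials on both sides mean a - 1/a
    = q - p, which determines a. Inserting a vertex is free because it splits a difference into
    parts d, d' of one sign, and d^2 + d'^2 <= (d + d')^2. The price is that the places of the
    potentials are lost, whence the estimate by the value at z; only the potential met where the
    path leaves the branch interior keeps its place. The obstacle is equality. An end potential
    above 2 puts the minimum of the path minimizer at the heavy end alone, which forces z = u. For
    odd k both end potentials agree and this fails, but then 2 = 1 + p leaves a single leaf, and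
    such a branch is a path anyway. The bounds are sharp because multiples of the path minimizer,
    one for each side, span a plane of test functions with no larger quotient. *)

Set Implicit Arguments.
Unset Strict Implicit.
Unset Printing Implicit Defensive.

Import Order.TTheory GRing.Theory Num.Theory.


(** * Branches of a tree *)

Section TreeBranches.
Variable G : sgraph.
Implicit Types (x y u v n : G) (p : seq G).
Notation e := (@edge G).

Lemma edge_neq x y : e x y -> x != y.
Proof. by apply: contraTneq => ->; rewrite edge_irrefl. Qed.

Lemma leaf_neighbor_unique x y z : x \in leaves G -> e x y -> e x z -> y = z.
Proof.
rewrite inE => /cards1P[w /setP ew] xy xz.
by have := ew y; have := ew z; rewrite !inE xy xz => /esym/eqP-> /esym/eqP->.
Qed.

Lemma leaf_neighbor_exists x : x \in leaves G -> exists y, e x y.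
Proof.
rewrite inE => /cards1P[w /setP ew]; exists w.
by have := ew w; rewrite !inE eqxx.
Qed.

Lemma interior_two_neighbors x y z : e x y -> e x z -> y != z -> x \in interior G.
Proof.
move=> xy xz; rewrite inE; apply: contraNN => /leaf_neighbor_unique h.
by rewrite (h y z).
Qed.

Lemma interior_other_neighbor x y n : x \in interior G -> e x y ->
  exists2 z, e x z & z != n.
Proof.
move=> xI xy; have [yn|] := eqVneq y n; last by exists y.
subst n; have [/existsP[z /andP[]]|/existsPn h] := boolP [exists z, e x z && (z != y)].
  by exists z.
have : x \in leaves G; last by move: xI; rewrite inE => /negbTE ->.
rewrite inE; apply/cards1P; exists y; apply/setP => z; rewrite !inE.
apply/idP/eqP => [xz|->//]; apply/eqP; have := h z.
by rewrite xz /= negbK.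
Qed.

Lemma acyclic_no_chord x p : acyclic G -> path e x p -> uniq (x :: p) ->
  e (last x p) x -> (1 < size p)%N -> False.
Proof.
move=> ac xp ux lx sp; apply: (ac (x :: p)) => //.
by rewrite /ucycle /= rcons_path xp lx.
Qed.

(** If [z] were on the path, the stretch from [z] to [a] and the edge back would form a cycle; it
    has at least three vertices because [z] is not the predecessor of [a]. *)
Lemma path_extension_fresh x p a z : acyclic G -> path e x (rcons p a) ->
  uniq (x :: rcons p a) -> e a z -> z != last x p -> z \notin x :: rcons p a.
Proof.
move=> ac xp ux az zl; apply/negP => zx.
have za : z != a by rewrite eq_sym edge_neq.
have {}zx : z \in x :: p by move: zx; rewrite inE mem_rcons inE (negbTE za) inE.
case/splitPl: p / zx xp ux zl => p1 p2 lz.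
rewrite rcons_cat cat_path lz -cat_cons lastI lz cat_rcons cat_uniq last_cat lz.
move=> /andP[_ zp] /and3P[_ _ uz] zl.
apply: (@acyclic_no_chord z (rcons p2 a)) => //; first by rewrite last_rcons.
by rewrite size_rcons; case: p2 zl {zp uz} => //=; rewrite eqxx.
Qed.

(** Deleting [v] is expressed by a relation on [G] itself, so that branches are plain subsets of
    [G]. *)
Definition avoid v : rel G := fun x y => [&& e x y, x != v & y != v].

Definition branch u v : {set G} := [set x | connect (avoid v) u x].

Lemma avoid_sym v : symmetric (avoid v).
Proof. by move=> x y; rewrite /avoid edge_sym [(x != v) && _]andbC. Qed.

Lemma branch_refl u v : u \in branch u v.
Proof. by rewrite inE connect0. Qed.

Lemma avoid_path v x p : path (avoid v) x p -> path e x p /\ all (fun y => y != v) p.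
Proof.
elim: p x => //= y p IH x /andP[/and3P[xy _ yv] /IH[yp ->]].
by rewrite xy yv yp.
Qed.

Lemma path_avoid v x p : path e x p -> v \notin x :: p -> path (avoid v) x p.
Proof.
elim: p x => //= y p IH x /andP[xy yp]; rewrite !inE !negb_or => /and3P[xv yv vp].
by rewrite /avoid xy eq_sym xv eq_sym yv IH // inE negb_or yv.
Qed.

Lemma branch_neq u v x : u != v -> x \in branch u v -> x != v.
Proof.
move=> uv; rewrite inE => /connectP[p /avoid_path[_ av] ->].
by case/lastP: p av => //= p y; rewrite all_rcons last_rcons => /andP[].
Qed.

Lemma branch_closed u v x y : u != v -> x \in branch u v -> e x y -> y != v ->
  y \in branch u v.
Proof.
move=> uv xB xy yv; have xv := branch_neq uv xB.
move: xB; rewrite !inE => xB; apply: (connect_trans xB); apply: connect1.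
by rewrite /avoid xy xv.
Qed.

Lemma branch_path u v x p : u != v -> x \in branch u v -> path e x p -> v \notin p ->
  {subset x :: p <= branch u v}.
Proof.
move=> uv; elim: p x => [|y p IH] x xB.
  by move=> _ _ z; rewrite inE => /eqP->.
move=> /= /andP[xy yp]; rewrite inE negb_or eq_sym => /andP[yv vp] z.
rewrite inE => /orP[/eqP->//|]; apply: IH => //; exact: branch_closed xy yv.
Qed.

Lemma branch_connected u v x y : u != v -> x \in branch u v -> y \in branch u v ->
  exists p, [/\ path e x p, uniq (x :: p), last x p = y & {subset x :: p <= branch u v}].
Proof.
move=> uv xB yB; have : connect (avoid v) x y.
  rewrite !inE in xB yB; rewrite (sym_connect_sym (@avoid_sym v)) in xB.
  exact: connect_trans xB yB.
case/connectP=> p xp ->; case/shortenP: xp => q xq uq _.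
have [xq' av] := avoid_path xq.
exists q; split=> //; apply: branch_path => //.
by apply/negP => vq; have /allP/(_ _ vq) := av; rewrite eqxx.
Qed.

Hypothesis tG : is_tree G.

(** A second neighbour of [v] in the branch would close a cycle through [v], [u] and the path inside
    the branch. *)
Lemma branch_gate u v x : e u v -> x \in branch u v -> e x v -> x = u.
Proof.
case: tG => _ _ ac uv xB xv; apply/eqP/negPn/negP => xu.
have [p [up uniqp lp sub]] := branch_connected (edge_neq uv) (branch_refl u v) xB.
apply: (@acyclic_no_chord v (u :: p)) => //.
- by rewrite /= edge_sym uv.
- rewrite [uniq _]/= -/(uniq (u :: p)) uniqp andbT.
  by apply/negP => /sub /(branch_neq (edge_neq uv)); rewrite eqxx.
- by rewrite /= lp.
by case: p lp {up uniqp sub} => //= xu'; rewrite xu' eqxx in xu.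
Qed.

Lemma branch_edge_closed u v x y : e u v -> e x y ->
  x \in branch u v :|: branch v u -> y \in branch u v :|: branch v u.
Proof.
move=> uv xy; have vu : e v u by rewrite edge_sym.
rewrite !in_setU => /orP[] xB.
  have [->|yv] := eqVneq y v; first by rewrite branch_refl orbT.
  by rewrite (branch_closed (edge_neq uv) xB xy yv).
have [->|yu] := eqVneq y u; first by rewrite branch_refl.
by rewrite (branch_closed (edge_neq vu) xB xy yu) orbT.
Qed.

(** Disjointness comes from the gate, covering from connectedness: the union of the two branches is
    closed under edges. *)
Lemma branchC u v : e u v -> branch v u = ~: branch u v.
Proof.
move=> uv; have nuv := edge_neq uv.
apply/eqP; rewrite eqEsubset; apply/andP; split; apply/subsetP => x.
  (* The branch can be entered only from [v], and then at its gate [u], which the path avoids. *)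
  have stay p w : w \notin branch u v -> path (avoid u) w p -> last w p \notin branch u v.
    elim: p w => //= y p IH w wB /andP[/and3P[wy wu yu] yp]; apply: IH => //.
    apply: contra wB => yB; have [wv|wv] := eqVneq w v.
      by case/eqP: yu; apply: branch_gate uv yB _; rewrite edge_sym -wv.
    by apply: branch_closed yB _ wv; rewrite // edge_sym.
  rewrite [in X in X -> _]inE => /connectP[p vp ->] {x}; rewrite in_setC; apply: stay vp.
  by apply/negP => /(branch_neq nuv); rewrite eqxx.
case: tG => _ conn _; have /connectP[p vp ->] := conn v x.
rewrite in_setC => lB; suff : last v p \in branch u v :|: branch v u.
  by rewrite in_setU (negbTE lB).
have closed p' w : w \in branch u v :|: branch v u -> path e w p' ->
    last w p' \in branch u v :|: branch v u.
  elim: p' w => //= y q IH w wU /andP[wy yq]; apply: IH => //.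
  exact: branch_edge_closed wy wU.
by apply: closed vp; rewrite in_setU branch_refl orbT.
Qed.

Lemma tree_neighbor x y : x != y -> exists z, e x z.
Proof.
case: tG => _ conn _ xy; have /connectP[[|z p] /= xp ly] := conn x y.
  by rewrite ly eqxx in xy.
by exists z; case/andP: xp.
Qed.

Lemma branch_cover v x : x != v -> exists2 u, e u v & x \in branch u v.
Proof.
case: tG => _ conn _ xv; have /connectP[p vp lx] := conn v x.
move: lx; case/shortenP: vp => -[|u q] vq uq _ lx; first by rewrite lx eqxx in xv.
case/andP: vq => vu uq'; exists u; first by rewrite edge_sym.
rewrite inE lx; apply/connectP; exists q => //; apply: path_avoid => //.
by case/andP: uq.
Qed.

Lemma branch_disjoint u u' v x : e u v -> e u' v ->
  x \in branch u v -> x \in branch u' v -> u = u'.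
Proof.
move=> uv u'v; rewrite !inE => ux u'x; apply/esym/(branch_gate uv) => //.
by rewrite inE; apply: connect_trans ux _; rewrite (sym_connect_sym (@avoid_sym v)).
Qed.


(** A vertex outside [branch u v] lies in [branch v u], which is a branch at [u] other than that of
    [n]. The strict inclusion is what lets the search for a centroid descend. *)
Lemma branch_proper n u v : e n u -> e u v -> n != v ->
  branch n u \proper branch u v.
Proof.
move=> nu uv nv; have vu : e v u by rewrite edge_sym.
apply/properP; split; last first.
  exists u; first exact: branch_refl.
  by apply/negP => /(branch_neq (edge_neq nu)); rewrite eqxx.
apply/subsetP => x xn; have := branchC uv => /setP/(_ x).
rewrite in_setC; case: (x \in branch u v) => // xv.
by case/eqP: nv; apply: branch_disjoint nu vu xn xv.
Qed.

(** The predecessor and the successor of an inner vertex are two distinct neighbours. *)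
Lemma simple_path_interior x p : x \in interior G -> last x p \in interior G ->
  path e x p -> uniq (x :: p) -> {subset x :: p <= interior G}.
Proof.
move=> xI lI xp ux c; rewrite inE => /orP[/eqP->//|cp].
case/splitPr: p / cp xp ux lI => p1 [|d p2]; first by rewrite last_cat.
rewrite cat_path => xp ux _; case/andP: xp => _ /= /and3P[ac cd _].
have da : d != last x p1.
  move: ux; rewrite -cat_cons lastI cat_uniq => /and3P[_ /hasPn h _].
  have := h d; rewrite !inE eqxx orbT mem_rcons inE negb_or => /(_ isT) /andP[].
  by [].
by apply: interior_two_neighbors cd _ da; rewrite edge_sym.
Qed.

(** An interior end vertex has a neighbour besides its predecessor, fresh by acyclicity. So the path
    grows until that neighbour is [v] or a leaf, and it cannot grow beyond [#|G|] vertices. *)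
Lemma extend_to_end u v x p (I := branch u v :&: interior G) : e u v ->
  path e x p -> uniq (x :: p) -> {subset x :: p <= I} ->
  exists q w, [/\ path e x (p ++ q), uniq (x :: p ++ q), {subset x :: p ++ q <= I},
    e (last x (p ++ q)) w & w = v \/ w \in branch u v :&: leaves G].
Proof.
move=> uv; have [N sN] : exists N, forall p', uniq (x :: p') -> (size p' < N)%N.
  by exists #|G| => p' up'; rewrite -(card_uniqP up' : _ = (size p').+1) max_card.
have [k] := ubnP (N - size p); elim: k p => // k IH p hk xp ux sp.
have [z [az zx]] : exists z, e (last x p) z /\ z \notin x :: p.
  have aI : last x p \in I by apply: sp; apply: mem_last.
  move: aI; rewrite inE => /andP[aX aI].
  have [n an] := tree_neighbor (branch_neq (edge_neq uv) aX).
  case/lastP: p => [|p a] in hk xp ux sp aX aI an *.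
    by exists n; rewrite inE eq_sym edge_neq.
  rewrite last_rcons in an aI *.
  have [z az zl] := interior_other_neighbor (last x p) aI an.
  exists z; split=> //; apply: path_extension_fresh zl => //.
  by case: tG.
have [zv|zv] := eqVneq z v; first by exists [::], v; rewrite cats0 -{1}zv; split=> //; left.
have zX : z \in branch u v.
  have : last x p \in I by apply: sp; apply: mem_last.
  by rewrite inE => /andP[aX _]; apply: branch_closed az zv; rewrite ?edge_neq.
have [zL|zL] := boolP (z \in leaves G).
  by exists [::], z; rewrite cats0; split=> //; right; rewrite inE zX.
have up : uniq (x :: rcons p z) by rewrite -rcons_cons rcons_uniq zx.
have [||||q [w [h1 h2 h3 h4 h5]]] := IH (rcons p z) => //.
- by have := sN _ ux; rewrite size_rcons; lia.
- by rewrite rcons_path xp.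
- move=> y; rewrite -rcons_cons mem_rcons inE => /orP[/eqP->|/sp//].
  by rewrite inE zX inE.
by exists (z :: q), w; rewrite -cat_rcons.
Qed.

(* If a vertex [o] of the branch were off the path, a path leaving [s] towards [o]
   could only end at [w], and [w] would be in two branches at the point of departure. *)
Lemma path_covers_branch u v s w (I := branch u v :&: interior G) : e u v ->
  path e u s -> uniq (u :: s) -> {subset u :: s <= I} -> w \in branch u v :&: leaves G ->
  e (last u s) w ->
  (forall w', w' \in branch u v :&: leaves G -> w' != w -> e w' u) ->
  {subset I <= u :: s}.
Proof.
move=> uv us uus sI wX lw oth o oI; apply/negPn/negP => os.
have nuv := edge_neq uv.
have uI : u \in I by apply: sI; rewrite mem_head.
move: (uI) (oI); rewrite !in_setI => /andP[uX uint] /andP[oX oint].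
have [p [up uup lo pX]] := branch_connected nuv uX oX.
have pint := simple_path_interior uint (eq_ind_r (fun z => z \in interior G) oint lo) up uup.
have departs q y : y \in u :: s -> last y q = o -> path e y q -> {subset y :: q <= I} ->
    exists r o', [/\ r \in u :: s, o' \notin u :: s, e r o' & o' \in I].
  elim: q y => [|z q IH] y ys /= lq; first by rewrite -lq ys in os.
  move=> /andP[yz zq] sub; have [zs|zs] := boolP (z \in u :: s).
    by apply: (IH z) => // a aq; apply: sub; rewrite inE aq orbT.
  by exists y, z; split=> //; apply: sub; rewrite !inE eqxx orbT.
have [r [o' [rs o's ro o'I]]] : exists r o', [/\ r \in u :: s, o' \notin u :: s,
    e r o' & o' \in I].
  apply: departs lo up _; rewrite ?mem_head // => z zp.
  by rewrite inE pX // pint.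
have ro' := edge_neq ro.
clear departs; case/splitPl: s / rs us uus sI lw os o's => s1 s2 lr us uus sI lw os o's.
move: us; rewrite cat_path lr => /andP[us1 rs2].
have o's1 : o' \notin u :: s1.
  by apply: contra o's; rewrite !inE mem_cat => /orP[->//|->]; rewrite orbT.
have u1 : uniq (u :: s1) by move: uus; rewrite -cat_cons cat_uniq => /and3P[].
have [||| q [w' [h1 h2 h3 h4 h5]]] := @extend_to_end u v u (rcons s1 o') uv.
- by rewrite rcons_path us1 lr.
- by rewrite -rcons_cons rcons_uniq o's1.
- move=> z; rewrite -rcons_cons mem_rcons inE => /orP[/eqP->//|z1].
  by apply: sI; rewrite -cat_cons mem_cat z1.
set a := last u _ in h4.
have la : a = last o' q by rewrite /a last_cat last_rcons.
have au : a != u.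
  move: h2; rewrite cat_rcons /= mem_cat negb_or => /andP[/andP[_ u2] _].
  by apply: contra u2 => /eqP <-; rewrite la mem_last.
have aI : a \in I by apply: h3; apply: mem_last.
have aX : a \in branch u v by move: aI; rewrite inE => /andP[].
(* Ending at [v], or at a leaf other than [w], would give [a = u], yet the path has already left
   [u]. Hence it ends at [w]. *)
case: h5 => [wv|w'X].
  by case/eqP: au; apply: branch_gate uv aX _; rewrite -wv.
have [ww|ww] := eqVneq w' w; last first.
  have w'u := oth _ w'X ww; case/eqP: au.
  move: w'X; rewrite inE => /andP[_ w'L].
  by apply: leaf_neighbor_unique w'L _ w'u; rewrite edge_sym.
subst w'; have wL : w \in leaves G by move: wX; rewrite inE => /andP[].
have notint z : z \in I -> z != w.
  by apply: contraTneq => ->; rewrite in_setI /interior in_setC wL andbF.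
have rI : r \in I by apply: sI; rewrite -lr -cat_cons mem_cat mem_last.
have wo' : w \in branch o' r.
  rewrite inE; apply/connectP; exists (rcons q w); last by rewrite last_rcons.
  apply: path_avoid.
    move: h1; rewrite cat_rcons cat_path /= => /and3P[_ _ ho'].
    by rewrite rcons_path ho' -la.
  rewrite -rcons_cons mem_rcons inE negb_or notint //=.
  move: h2; rewrite cat_rcons -cat_cons cat_uniq => /and3P[_ /hasPn h _].
  by apply/negP => /h /=; rewrite -lr mem_last.
have lrw : e (last r s2) w by move: lw; rewrite last_cat lr.
have path2 : path e r (rcons s2 w) by rewrite rcons_path rs2.
have : r \notin rcons s2 w.
  rewrite mem_rcons inE negb_or notint //=.
  move: uus; rewrite -cat_cons cat_uniq => /and3P[_ /hasPn h _].
  by apply/negP => /h /=; rewrite -lr mem_last.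
case ds : (rcons s2 w) path2 => [|n s3]; first by case: (s2) ds.
move=> /= /andP[rn ns3] rns.
have wn : w \in branch n r.
  rewrite inE; apply/connectP; exists s3; first exact: path_avoid.
  by have := congr1 (last r) ds; rewrite last_rcons.
have o'n : o' = n by apply: branch_disjoint wo' wn; rewrite edge_sym.
have : n \in rcons s2 w by rewrite ds mem_head.
rewrite -o'n mem_rcons inE => /orP[/eqP ow|o's2].
  by have := notint _ o'I; rewrite ow eqxx.
by move: o's; rewrite inE mem_cat o's2 !orbT.
Qed.

End TreeBranches.

(** * Spectral theorem for real symmetric matrices *)

Local Open Scope ring_scope.

Section RealSpectral.
Variable R : rcfType.

(** The complexified matrix is Hermitian, so its spectral diagonal is real, and a real root of the
    complexified characteristic polynomial is a root of the original one. *)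
Lemma symmetric_real_eigenvalue n (A : 'M[R]_n.+1) :
  A^T = A -> exists a, eigenvalue A a.
Proof.
move=> symA; pose B : 'M[R[i]]_n.+1 := map_mx (real_complex R) A.
have realB : B \is a realmx.
  by apply/mxOverP => i j; rewrite !mxE complex_real.
have hermB : B \is hermsymmx.
  apply: realsym_hermsym => //; apply/is_hermitianmxP.
  by rewrite expr0 scale1r map_mx_id // map_trmx symA.
have /mxOverP/(_ 0 0) := hermitian_spectral_diag_real hermB.
have /orthomx_spectralP := hermitian_normalmx hermB.
set P := spectralmx B; set d := spectral_diag B => defB dreal.
have Pu : P \in unitmx by apply: spectral_unit.
have evB : eigenvalue B (d 0 0).
  apply/eigenvalueP; exists (row 0 P); last first.
    apply/negP => /eqP P0; have := Pu; rewrite -row_free_unit => /row_freeP[Q].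
    move/(congr1 (row 0)); rewrite row_mul P0 mul0mx => /rowP/(_ 0).
    by rewrite !mxE eqxx => /eqP; rewrite eq_sym oner_eq0.
  rewrite -row_mul {1}defB !mulmxA mulmxV // mul1mx row_mul row_diag_mx.
  by rewrite -scalemxAl -rowE.
have [a ea] : exists a, d 0 0 = real_complex R a.
  by case/complex_realP: dreal => a ->; exists a.
exists a; rewrite eigenvalue_root_char.
by move: evB; rewrite eigenvalue_root_char ea /B -map_char_poly fmorph_root.
Qed.



Lemma mulmx_trE n (x y : 'rV[R]_n) : (x *m y^T) 0 0 = \sum_i x 0 i * y 0 i.
Proof. by rewrite mxE; apply: eq_bigr => i _; rewrite mxE. Qed.

Lemma mulmx_tr_gt0 n (x : 'rV[R]_n) : x != 0 -> 0 < (x *m x^T) 0 0.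
Proof.
move=> x0; rewrite mulmx_trE lt_def sumr_ge0 ?andbT => [|i _]; last first.
  by rewrite -expr2 sqr_ge0.
apply: contra x0; rewrite psumr_eq0 => [/allP h|i _]; last first.
  by rewrite -expr2 sqr_ge0.
apply/eqP/rowP => i; have := h i (mem_index_enum _).
by rewrite mulf_eq0 orbb mxE => /eqP.
Qed.

(** [H] is the Householder reflection along [u = e - v], which exchanges the first basis vector [e]
    and [v]. *)
Lemma orthogonal_with_first_row n (v : 'rV[R]_n.+1) : v *m v^T = 1%:M ->
  exists2 H : 'M[R]_n.+1, H *m H^T = 1%:M & delta_mx 0 0 *m H = v.
Proof.
move=> v1; pose e : 'rV[R]_n.+1 := delta_mx 0 0; pose u := e - v.
have ee : e *m e^T = 1%:M.
  by rewrite trmx_delta mul_delta_mx; apply/matrixP=> i j; rewrite !ord1 !mxE.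
have ve : v *m e^T = e *m v^T.
  rewrite [LHS]mx11_scalar [RHS]mx11_scalar !mulmx_trE; congr (_%:M).
  by apply: eq_bigr => i _; rewrite mulrC.
have [u0|u0] := eqVneq u 0.
  by exists 1%:M; rewrite ?trmx1 ?mulmx1 //; apply/subr0_eq.
pose s := (u *m u^T) 0 0; have us : u *m u^T = s%:M by rewrite [LHS]mx11_scalar.
have s0 : s != 0 by rewrite gt_eqF ?mulmx_tr_gt0.
have [x ev] : exists x : R, e *m v^T = x%:M by eexists; apply: mx11_scalar.
have eu : e *m u^T = (1 - x)%:M by rewrite /u linearB /= mulmxBr ee ev -raddfB.
(* The squared length of [u] for unit vectors [e], [v] with inner product [x]; this normalization is
   what makes the reflection send [e] to [v]. *)
have sx : s = 2 * (1 - x).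
  rewrite /s {1}/u mulmxBl eu {1}/u linearB /= mulmxBr v1 ve ev -!raddfB.
  by rewrite mxE mulr1n; ring.
pose K : 'M[R]_n.+1 := u^T *m u.
have KK : K *m K = s *: K.
  by rewrite /K mulmxA -[_ *m u *m _]mulmxA us mul_mx_scalar scalemxAl.
pose H : 'M[R]_n.+1 := 1%:M - (2 / s) *: K.
have HT : H^T = H by rewrite /H linearB /= trmx1 linearZ /= trmx_mul trmxK.
exists H.
  rewrite HT /H mulmxBl !mulmxBr !mul1mx mulmx1 -scalemxAl -scalemxAr KK.
  apply/matrixP => i j; rewrite !mxE.
  by field.
rewrite mulmxBr mulmx1 -scalemxAr mulmxA -/e eu mul_scalar_mx scalerA.
suff -> : 2 / s * (1 - x) = 1 by rewrite scale1r /u subKr.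
by rewrite mulrAC -sx divff.
Qed.

(** Deflation: after an orthogonal change of basis whose first row is a unit eigenvector, symmetry
    makes the matrix block diagonal, and induction treats the smaller block. *)
Lemma real_spectral n (A : 'M[R]_n) : A^T = A ->
  exists (P : 'M[R]_n) (d : 'rV[R]_n), P *m P^T = 1%:M /\ A = P^T *m diag_mx d *m P.
Proof.
elim: n A => [|n IH] A symA.
  by exists 1%:M, 0; split; apply/matrixP => -[].
have [a /eigenvalueP[v vA v0]] := symmetric_real_eigenvalue symA.
wlog v1 : v vA v0 / v *m v^T = 1%:M.
  move=> th; pose s := (v *m v^T) 0 0.
  have s0 : 0 < s by apply: mulmx_tr_gt0.
  have q0 : Num.sqrt s != 0 by rewrite gt_eqF // sqrtr_gt0.
  apply: (th ((Num.sqrt s)^-1 *: v)).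
  - by rewrite -scalemxAl vA !scalerA mulrC.
  - by rewrite scaler_eq0 negb_or invr_eq0 q0.
  rewrite linearZ /= -scalemxAl -scalemxAr scalerA [v *m _]mx11_scalar -/s.
  rewrite scale_scalar_mx -invfM -expr2 sqr_sqrtr ?ltW // mulVf //.
  by rewrite gt_eqF.
have [H HH He] := orthogonal_with_first_row v1.
have HH' : H^T *m H = 1%:M by apply: mulmx1C.
have [B eB] : exists B : 'M_(1 + n), B = H *m A *m H^T by eexists.
have BT : B^T = B by rewrite eB !trmx_mul trmxK symA mulmxA.
have B0 : delta_mx 0 0 *m B = a *: (delta_mx 0 0 : 'rV_n.+1).
  by rewrite eB !mulmxA He vA -scalemxAl -He -mulmxA HH mulmx1.
have Bij j : B 0 j = a *+ (j == 0).
  by move/rowP/(_ j): B0; rewrite -rowE !mxE => ->; rewrite eqxx mulr_natr.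
have defB : B = block_mx a%:M 0 0 (drsubmx B).
  rewrite -[LHS]submxK; congr block_mx; apply/matrixP => i j; rewrite !mxE.
  - by rewrite !ord1 lshift0 Bij.
  - by rewrite !ord1 lshift0 Bij.
  by rewrite -BT mxE !ord1 lshift0 Bij.
have symB' : (drsubmx B)^T = drsubmx B.
  by apply/matrixP => i j; rewrite !mxE -{1}BT mxE.
have [P [d [PP defB']]] := IH _ symB'.
pose Q : 'M_(1 + n) := block_mx 1%:M 0 0 P.
have QT : Q^T = block_mx 1%:M 0 0 P^T by rewrite /Q tr_block_mx !trmx0 trmx1.
have QQ : Q *m Q^T = 1%:M.
  rewrite QT mulmx_block !mulmx0 !mul0mx !mul1mx !addr0 !add0r PP.
  by rewrite -scalar_mx_block.
have QdQ : B = Q^T *m diag_mx (row_mx a%:M d) *m Q.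
  rewrite QT diag_mx_row !mulmx_block defB {1}defB'.
  rewrite !(mulmx0, mul0mx, mul1mx, mulmx1, addr0, add0r).
  by congr block_mx; apply/matrixP => i j; rewrite !ord1 !mxE.
exists (Q *m H), (row_mx a%:M d : 'rV_(1 + n)); split.
  by rewrite trmx_mul mulmxA -[_ *m H *m _]mulmxA HH mulmx1 QQ.
have -> : A = H^T *m B *m H.
  by rewrite eB !mulmxA HH' mul1mx -mulmxA HH' mulmx1.
by rewrite trmx_mul !mulmxA QdQ !mulmxA.
Qed.

End RealSpectral.

(** * The list of eigenvalues read off a diagonalization *)

Section Spectrum.
Variable R : realType.

Lemma char_poly_diagonalization n (A P : 'M[R]_n) (d : 'rV[R]_n) :
  P *m P^T = 1%:M -> A = P^T *m diag_mx d *m P ->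
  char_poly A = \prod_i ('X - (d 0 i)%:P).
Proof.
move=> PP defA; have PP' : P^T *m P = 1%:M by apply: mulmx1C.
pose D := diag_mx d; pose C : 'M[R]_n -> 'M[{poly R}]_n := map_mx polyC.
have eqA : char_poly_mx A = C P^T *m char_poly_mx D *m C P.
  rewrite /char_poly_mx mulmxBr mulmxBl -/(C A) -/(C D) /C -!map_mxM -defA.
  by rewrite scalar_mxC -mulmxA -map_mxM PP' map_mx1 mulmx1.
rewrite /char_poly eqA !det_mulmx mulrAC -det_mulmx /C -map_mxM PP' map_mx1.
rewrite det1 mul1r -/(char_poly D) char_poly_trig ?diag_mx_is_trig //.
by apply: eq_bigr => i _; rewrite mxE eqxx.
Qed.

Lemma mu_prod_XsubC (s : seq R) y :
  \mu_y (\prod_(x <- s) ('X - x%:P)) = count_mem y s.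
Proof.
elim: s => [|x s IH]; first by rewrite big_nil muNroot // root1.
rewrite big_cons mu_mul ?mulf_neq0 ?polyXsubC_eq0 //; last first.
  by rewrite monic_neq0 // monic_prod_XsubC.
rewrite IH /=; congr (_ + _)%N; have [->|xy] := eqVneq x y.
  by rewrite mu_XsubC.
by rewrite muNroot // root_XsubC eq_sym.
Qed.

(** In both lists a number occurs as often as its multiplicity as a root of the product. *)
Lemma perm_roots_with_multiplicity (s : seq R) :
  perm_eq (flatten [seq nseq (\mu_x (\prod_(x <- s) ('X - x%:P))) x
                   | x <- rootsR (\prod_(x <- s) ('X - x%:P))]) s.
Proof.
set p := \prod_(x <- s) _; have p0 : p != 0 by rewrite monic_neq0 // monic_prod_XsubC.
apply/allP => y _ /=; apply/eqP; rewrite -[RHS]mu_prod_XsubC -/p.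
rewrite count_flatten -map_comp sumnE big_map.
under eq_bigr => x _ do rewrite /= count_nseq.
have ur : uniq (rootsR p) by apply: lt_sorted_uniq; apply: sorted_roots.
have mem_r : (y \in rootsR p) = root p y.
  by have := roots_on_rootsR p0 y; rewrite inE /= => <-.
case yr : (y \in rootsR p).
  rewrite (bigD1_seq y) //= eqxx mul1n big1 ?addn0 // => x.
  by move/negbTE=> ->.
rewrite muNroot -?mem_r ?yr // big_seq big1 // => x xr.
by have [xy|] := eqVneq x y; [move: xr; rewrite xy yr | rewrite /= => /negbTE ->].
Qed.

Lemma sorted_flatten_nseq (s : seq R) (m : R -> nat) :
  sorted <%R s -> sorted <=%R (flatten [seq nseq (m x) x | x <- s]).
Proof.
rewrite !(sorted_pairwise le_trans, sorted_pairwise lt_trans).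
elim: s => //= x s IH /andP[xs ps]; rewrite pairwise_cat IH // andbT.
apply/andP; split.
  apply/allrelP => a b; rewrite mem_nseq => /andP[_ /eqP->].
  case/flattenP => l /mapP[z zs ->]; rewrite mem_nseq => /andP[_ /eqP->].
  by apply: ltW; apply: (allP xs).
by elim: (m x) => //= k ->; rewrite andbT; apply/allP => a; rewrite mem_nseq => /andP[_ /eqP->].
Qed.

(** Two sorted permutations of each other coincide; this ties the definition by roots of the
    characteristic polynomial to orthogonal diagonalization. *)
Lemma spectrum_diagonalization n (A P : 'M[R]_n) (d : 'rV[R]_n) :
  P *m P^T = 1%:M -> A = P^T *m diag_mx d *m P ->
  spectrum A = sort <=%R [seq d 0 i | i <- enum 'I_n].
Proof.
move=> PP defA; apply: le_sorted_eq.
- by apply: sorted_flatten_nseq; apply: sorted_roots.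
- by apply: sort_le_sorted.
rewrite /spectrum (char_poly_diagonalization PP defA).
rewrite (_ : \prod_i _ = \prod_(x <- [seq d 0 i | i <- enum 'I_n]) ('X - x%:P)).
  by apply: perm_trans (perm_roots_with_multiplicity _) _; rewrite perm_sym perm_sort.
by rewrite big_map big_enum.
Qed.

Lemma spectral_two n (A : 'M[R]_n) : A^T = A -> (1 < n)%N ->
  exists (P : 'M[R]_n) (d : 'rV[R]_n) (i1 i2 : 'I_n),
  [/\ P *m P^T = 1%:M /\ A = P^T *m diag_mx d *m P, i1 != i2,
     d 0 i1 <= d 0 i2, (forall j, j != i1 -> d 0 i2 <= d 0 j) &
   (spectrum A)`_1 = d 0 i2].
Proof.
move=> symA n1; have [P [d [PP defA]]] := real_spectral symA.
exists P, d; pose e := sort (relpre (fun i => d 0 i) <=%R) (enum 'I_n).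
have sE : spectrum A = [seq d 0 i | i <- e].
  by rewrite (spectrum_diagonalization PP defA) sort_map.
have ue : uniq e by rewrite sort_uniq enum_uniq.
have me i : i \in e by rewrite mem_sort mem_enum.
have ne : size e = n by rewrite size_sort size_enum_ord.
have se : sorted <=%R [seq d 0 i | i <- e] by rewrite -sort_map sort_le_sorted.
case: e sE ue me ne se => [|i1 [|i2 e]] sE ue me ne se.
- by rewrite -ne in n1.
- by rewrite -ne in n1.
exists i1, i2; split => //.
- by case/andP: ue; rewrite inE negb_or => /andP[].
- by case/andP: se.
- move=> j ji; have := me j; rewrite !inE (negbTE ji) /= => /orP[/eqP->//|je].
  move: se; rewrite /= => /andP[_]; rewrite (path_sortedE le_trans) => /andP[/allP h _].
  by apply: h; apply: map_f.
by rewrite sE.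
Qed.

End Spectrum.

(** * Variational bounds for the second eigenvalue *)

Section Rayleigh.
Variable R : realType.

Section Diagonalized.
Variables (n : nat) (A P : 'M[R]_n) (d : 'rV[R]_n).
Hypotheses (PP : P *m P^T = 1%:M) (defA : A = P^T *m diag_mx d *m P).

Lemma norm_diagonalized (x : 'rV[R]_n) :
  (x *m x^T) 0 0 = \sum_i (x *m P^T) 0 i ^+ 2.
Proof.
have -> : x *m x^T = (x *m P^T) *m (x *m P^T)^T.
  by rewrite trmx_mul trmxK mulmxA -[_ *m _ *m P]mulmxA (mulmx1C PP) mulmx1.
by rewrite mulmx_trE; apply: eq_bigr => i _; rewrite expr2.
Qed.

Lemma form_diagonalized (x : 'rV[R]_n) :
  (x *m A *m x^T) 0 0 = \sum_i d 0 i * (x *m P^T) 0 i ^+ 2.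
Proof.
have -> : x *m A *m x^T = (x *m P^T *m diag_mx d) *m (x *m P^T)^T.
  by rewrite defA trmx_mul trmxK !mulmxA.
rewrite mulmx_trE; apply: eq_bigr => i _.
by rewrite mul_mx_diag mxE expr2 mulrAC mulrC.
Qed.

Lemma row_diagonalized i : row i P *m A = d 0 i *: row i P.
Proof.
rewrite -row_mul defA !mulmxA PP mul1mx row_mul row_diag_mx -scalemxAl.
by rewrite -rowE.
Qed.

Lemma mul_row_tr_diagonalized i j : row i P *m (row j P)^T = (i == j)%:R%:M.
Proof.
apply/matrixP => k l; rewrite !ord1; have /matrixP/(_ i j) := PP.
by rewrite mulmx_trE !mxE eqxx mulr1n => <-; apply: eq_bigr => m _; rewrite !mxE.
Qed.

End Diagonalized.

Lemma two_smallest_eigenvectors n (A : 'M[R]_n) (l2 := (spectrum A)`_1) :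
  A^T = A -> (1 < n)%N ->
  exists (v1 v2 : 'rV[R]_n) (l1 : R),
  [/\ [/\ v1 *m v1^T = 1%:M, v2 *m v2^T = 1%:M, v1 *m v2^T = 0 & v2 *m v1^T = 0],
      v1 *m A = l1 *: v1, v2 *m A = l2 *: v2, l1 <= l2 &
      forall x : 'rV[R]_n, x *m v1^T = 0 -> l2 * (x *m x^T) 0 0 <= (x *m A *m x^T) 0 0].
Proof.
move=> symA n1.
have [P [d [i1 [i2 [[PP defA] i12 d12 dmin l2E]]]]] := spectral_two symA n1.
rewrite /l2 l2E; exists (row i1 P), (row i2 P), (d 0 i1); split=> //.
- have i21 : (i2 == i1) = false by rewrite eq_sym (negbTE i12).
  rewrite !mul_row_tr_diagonalized // !eqxx (negbTE i12) i21.
  by split=> //; apply/matrixP => i j; rewrite !mxE mul0rn.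
- exact: row_diagonalized.
- exact: row_diagonalized.
move=> x xv1; rewrite (norm_diagonalized PP) (form_diagonalized defA) mulr_sumr.
apply: ler_sum => j _; have [->|ji] := eqVneq j i1.
  suff -> : (x *m P^T) 0 i1 = 0 by rewrite expr0n !mulr0.
  by have /matrixP/(_ 0 0) := xv1; rewrite mulmx_trE !mxE => {2}<-; apply: eq_bigr => k _; rewrite !mxE.
by rewrite ler_wpM2r ?sqr_ge0 // dmin.
Qed.

(** Courant-Fischer, upper half: the plane spanned by [f] and [g] contains a nonzero vector
    orthogonal to the first eigenvector. *)
Lemma second_eigenvalue_le n (A : 'M[R]_n) (f g : 'rV[R]_n) (c : R) :
  A^T = A -> (1 < n)%N ->
  (forall a b, a *: f + b *: g = 0 -> a = 0 /\ b = 0) ->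
  (forall a b (x := a *: f + b *: g),
     (x *m A *m x^T) 0 0 <= c * (x *m x^T) 0 0) ->
  (spectrum A)`_1 <= c.
Proof.
move=> symA n1 indep lec.
have [v1 [v2 [l1 [_ _ _ _ vmin]]]] := two_smallest_eigenvectors symA n1.
pose p := (f *m v1^T) 0 0; pose q := (g *m v1^T) 0 0.
have [a [b [ab0 abpq]]] : exists a b, (a != 0) || (b != 0) /\ a * p + b * q = 0.
  have [->|p0] := eqVneq p 0; first by exists 1, 0; rewrite oner_eq0 mulr0 mul0r addr0.
  by exists q, (- p); rewrite oppr_eq0 p0 orbT; split=> //; ring.
pose x := a *: f + b *: g.
have x0 : x != 0.
  by apply: contraTneq ab0 => /indep[-> ->]; rewrite eqxx.
have xv : x *m v1^T = 0.
  rewrite [LHS]mx11_scalar mulmxDl -!scalemxAl.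
  have -> : (a *: (f *m v1^T) + b *: (g *m v1^T)) 0 0 = a * p + b * q.
    by rewrite mxE [X in X + _]mxE [X in _ + X]mxE.
  by rewrite abpq raddf0.
by have := le_trans (vmin x xv) (lec a b); rewrite ler_pM2r // mulmx_tr_gt0.
Qed.

(** Courant-Fischer, lower half: the plane of the two lowest eigenvectors meets the hyperplane given
    by [w]. In case of equality the part along [v1] vanishes or [l1 = l2], so [x] is an
    eigenvector. *)
Lemma second_eigenvalue_ge n (A : 'M[R]_n) (w : 'cV[R]_n) (l2 := (spectrum A)`_1) :
  A^T = A -> (1 < n)%N ->
  exists x : 'rV[R]_n, [/\ x != 0, x *m w = 0,
    (x *m A *m x^T) 0 0 <= l2 * (x *m x^T) 0 0 &
    ((x *m A *m x^T) 0 0 = l2 * (x *m x^T) 0 0 -> x *m A = l2 *: x)].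
Proof.
move=> symA n1.
have [v1 [v2 [l1 []]]] := two_smallest_eigenvectors symA n1; rewrite -/l2.
move=> [v11 v22 v12 v21] Av1 Av2 l12 _.
pose p := (v1 *m w) 0 0; pose q := (v2 *m w) 0 0.
have [a [b [ab0 abpq]]] : exists a b, (a != 0) || (b != 0) /\ a * p + b * q = 0.
  have [->|p0] := eqVneq p 0; first by exists 1, 0; rewrite oner_eq0 mulr0 mul0r addr0.
  by exists q, (- p); rewrite oppr_eq0 p0 orbT; split=> //; ring.
pose x := a *: v1 + b *: v2; exists x.
have xw : x *m w = 0.
  rewrite [LHS]mx11_scalar mulmxDl -!scalemxAl.
  have -> : (a *: (v1 *m w) + b *: (v2 *m w)) 0 0 = a * p + b * q.
    by rewrite mxE [X in X + _]mxE [X in _ + X]mxE.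
  by rewrite abpq raddf0.
have comb r s : ((r *: v1 + s *: v2) *m x^T) 0 0 = r * a + s * b.
  rewrite /x linearD !linearZ /= mulmxDr !mulmxDl -!scalemxAr -!scalemxAl.
  by rewrite v11 v22 v12 v21 !scaler0 addr0 add0r !mxE mulr1n !mulr1 [a * r]mulrC [b * s]mulrC.
have xA : x *m A = (a * l1) *: v1 + (b * l2) *: v2.
  by rewrite mulmxDl -!scalemxAl Av1 Av2 !scalerA.
have xx : (x *m x^T) 0 0 = a * a + b * b by rewrite comb.
have xAx : (x *m A *m x^T) 0 0 = a * l1 * a + b * l2 * b by rewrite xA comb.
split=> //.
- apply: contraTneq ab0 => x0; move: xx; rewrite x0 mul0mx mxE => /esym/eqP.
  rewrite paddr_eq0 -?expr2 ?sqr_ge0 // !sqrf_eq0 => /andP[-> ->].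
  by [].
- rewrite xx xAx -subr_ge0.
  rewrite (_ : _ - _ = (l2 - l1) * a ^+ 2); last by ring.
  by rewrite mulr_ge0 ?sqr_ge0 // subr_ge0.
rewrite xx xAx => h.
(* The defect in the Rayleigh quotient is a^2 (l1 - l2); one more factor l1 - l2 turns it into a
   square, which treats both alternatives at once. *)
have : (a * l1 - a * l2) ^+ 2 = 0.
  rewrite (_ : _ ^+ 2 = (a * l1 * a + b * l2 * b - l2 * (a * a + b * b)) * (l1 - l2)); last by ring.
  by rewrite h subrr mul0r.
move/eqP; rewrite sqrf_eq0 subr_eq0 => /eqP e.
by rewrite xA e /x scalerDr !scalerA [l2 * a]mulrC [l2 * b]mulrC.
Qed.

Lemma smallest_eigenvalue n (A : 'M[R]_n.+1) : A^T = A ->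
  exists (mu : R) (x : 'rV[R]_n.+1),
  [/\ x != 0, (x *m A *m x^T) 0 0 = mu * (x *m x^T) 0 0 &
      forall y : 'rV[R]_n.+1, mu * (y *m y^T) 0 0 <= (y *m A *m y^T) 0 0].
Proof.
move=> symA; have [P [d [PP defA]]] := real_spectral symA.
have [i dmin] : exists i, forall j, d 0 i <= d 0 j.
  have [i _ dmin] := arg_minP (fun i => d 0 i) (isT : predT (0 : 'I_n.+1)).
  by exists i => j; apply: dmin.
exists (d 0 i), (row i P); split.
- apply/eqP => r0; have := mul_row_tr_diagonalized PP i i.
  by rewrite r0 mul0mx eqxx => /matrixP/(_ 0 0); rewrite !mxE => /eqP; rewrite eq_sym oner_eq0.
- by rewrite (row_diagonalized PP defA) -scalemxAl mxE.
move=> y; rewrite (norm_diagonalized PP) (form_diagonalized defA) mulr_sumr.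
by apply: ler_sum => j _; rewrite ler_wpM2r ?sqr_ge0.
Qed.

End Rayleigh.

(** * The quadratic form of a weighted path *)

Section PathForm.
Variable R : realType.
Implicit Types (F : nat -> R) (t : nat) (y mu : R).

Definition supported t F := forall i, (t <= i)%N -> F i = 0.

(** On supported [F] this is the form of a path matrix with diagonal y, 2, ..., 2: one unit of [y]
    comes from the edge to vertex 1, and the last summand, where [F t = 0], is the potential 1 at
    the far end. *)
Definition path_form t y F : R :=
  (y - 1) * F 0%N ^+ 2 + \sum_(i < t) (F i - F i.+1) ^+ 2.

Definition sqnorm t F : R := \sum_(i < t) F i ^+ 2.

Definition path_ground t y mu :=
  (forall F, supported t F -> mu * sqnorm t F <= path_form t y F) /\
  exists F, [/\ supported t F, exists i, F i != 0 &
                path_form t y F = mu * sqnorm t F].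

Lemma sum_delta_lt t (H : nat -> R) k : (k < t)%N ->
  \sum_(i < t) H i * (i == k :> nat)%:R = H k.
Proof.
move=> kt; rewrite (bigD1 (Ordinal kt)) //= eqxx mulr1 big1 ?addr0 // => i /eqP ik.
by case: eqP => [e|]; rewrite ?mulr0 //; case: ik; apply: val_inj.
Qed.

Lemma sum_delta t F k : supported t F ->
  \sum_(i < t) F i * (i == k :> nat)%:R = F k.
Proof.
move=> sF; have [kt|tk] := ltnP k t; first exact: sum_delta_lt.
rewrite sF // big1 // => i _; case: eqP => [e|]; last by rewrite mulr0.
by have := ltn_ord i; rewrite e ltnNge tk.
Qed.

(** Multiplication by [B] takes consecutive differences, so [B *m B^T] yields their sum of
    squares. *)
Definition path_mx n y : 'M[R]_n.+1 :=
  let B : 'M[R]_n.+1 := \matrix_(i, k) ((i == k :> nat)%:R - (i == k.+1 :> nat)%:R) in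
  B *m B^T + (y - 1) *: delta_mx 0 0.

Lemma path_mx_sym n y : (path_mx n y)^T = path_mx n y.
Proof. by rewrite /path_mx linearD linearZ /= trmx_mul trmxK trmx_delta. Qed.

Lemma path_mxE n y F (x := \row_(i < n.+1) F i) : supported n.+1 F ->
  (x *m path_mx n y *m x^T) 0 0 = path_form n.+1 y F.
Proof.
move=> sF; rewrite /path_mx; set B := (\matrix_(i, k) _).
rewrite mulmxDr mulmxDl mxE addrC; congr (_ + _).
  rewrite -scalemxAr -scalemxAl mxE -(mul_delta_mx (0 : 'I_1)) mulmxA -colE.
  by rewrite -mulmxA -rowE !mxE big_ord1 !mxE expr2.
have -> : x *m (B *m B^T) *m x^T = (x *m B) *m (x *m B)^T.
  by rewrite trmx_mul !mulmxA.
rewrite mulmx_trE; apply: eq_bigr => k _; rewrite -expr2; congr (_ ^+ 2).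
rewrite mxE -(sum_delta k sF) -(sum_delta k.+1 sF) -sumrB.
by apply: eq_bigr => i _; rewrite !mxE mulrBr.
Qed.

Lemma sqnormE n F (x := \row_(i < n.+1) F i) : (x *m x^T) 0 0 = sqnorm n.+1 F.
Proof. by rewrite mulmx_trE; apply: eq_bigr => i _; rewrite !mxE expr2. Qed.

Lemma path_ground_exists t y : (0 < t)%N -> exists mu, path_ground t y mu.
Proof.
case: t => // n _.
have [mu [x [x0 xE xmin]]] := smallest_eigenvalue (path_mx_sym n y).
exists mu; split=> [F sF|].
  by rewrite -(path_mxE _ sF) -sqnormE xmin.
pose F i := if insub i is Some j then x 0 j else 0 : R.
have Fx : \row_(i < n.+1) F i = x.
  by apply/rowP => i; rewrite mxE /F valK.
have sF : supported n.+1 F by move=> i ni; rewrite /F insubF // ltnNge ni.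
exists F; split=> //; last by rewrite -(path_mxE _ sF) -sqnormE Fx.
by have /rV0Pn[i xi] := x0; exists i; rewrite /F valK.
Qed.

Lemma sqnorm_gt0 t F : supported t F -> (exists i, F i != 0) -> 0 < sqnorm t F.
Proof.
move=> sF [i Fi]; have it : (i < t)%N by rewrite ltnNge; apply: contra Fi => /sF ->.
rewrite /sqnorm (bigD1 (Ordinal it)) //= ltr_wpDr ?exprn_even_gt0 //.
by rewrite sumr_ge0 // => j _; rewrite sqr_ge0.
Qed.


Lemma quadratic_nonneg_lin0 (b c : R) :
  (forall e, 0 <= e * b + e ^+ 2 * c) -> b = 0.
Proof.
move=> h; apply/eqP/negPn/negP => b0.
(* With [k > |c|] the step -b/k gives the value (b/k)^2 (c - k), which is negative unless
   [b = 0]. *)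
pose k := `|c| + 1; have k0 : 0 < k by rewrite ltr_wpDl.
have := h (- b / k).
have -> : - b / k * b + (- b / k) ^+ 2 * c = (b / k) ^+ 2 * (c - k).
  by field; rewrite gt_eqF.
have ck : c - k < 0 by rewrite /k; have := ler_norm c; lra.
by rewrite nmulr_lge0 // exprn_even_le0 //= mulf_eq0 invr_eq0 (negbTE b0) gt_eqF.
Qed.

Definition path_eq t y mu F := forall i, (i < t)%N ->
  (if i is j.+1 then 2 * F i - F j - F i.+1 else y * F 0%N - F 1%N) = mu * F i.

(** First variation of the form at a minimizer, in the direction of the unit vector at [k]. Moving
    by e/2 makes the linear coefficient exactly [b - mu * F k]. *)
Lemma path_ground_eq t y mu F : path_ground t y mu -> supported t F ->
  path_form t y F = mu * sqnorm t F -> path_eq t y mu F.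
Proof.
move=> [gr _] sF eqF k kt; pose H i : R := (i == k)%:R.
pose b := (y - 1) * (F 0%N * H 0%N) + \sum_(i < t) (F i - F i.+1) * (H i - H i.+1).
have hb : b - mu * F k = 0.
  apply: (@quadratic_nonneg_lin0 _ ((path_form t y H - mu * sqnorm t H) / 4)) => e.
  pose G i := F i + e / 2 * H i.
  have sG : supported t G.
    by move=> i ti; rewrite /G sF // /H gtn_eqF ?mulr0 ?addr0 // (leq_trans kt).
  have nG : sqnorm t G = sqnorm t F + e * F k + e ^+ 2 / 4 * sqnorm t H.
    rewrite -(sum_delta_lt F kt) /sqnorm !mulr_sumr -!big_split /=.
    by apply: eq_bigr => i _; rewrite /G /H; field.
  have fG : path_form t y G = path_form t y F + e * b + e ^+ 2 / 4 * path_form t y H.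
    have sE : \sum_(i < t) (G i - G i.+1) ^+ 2 = \sum_(i < t) (F i - F i.+1) ^+ 2
      + e * (\sum_(i < t) (F i - F i.+1) * (H i - H i.+1))
      + e ^+ 2 / 4 * \sum_(i < t) (H i - H i.+1) ^+ 2.
      rewrite !mulr_sumr -!big_split /=.
      by apply: eq_bigr => i _; rewrite /G; field.
    by rewrite /path_form sE /b /G; field.
  have := gr G sG; rewrite nG fG eqF -subr_ge0 => h.
  by apply: le_trans h _; rewrite le_eqVlt; apply/orP; left; apply/eqP; field.
move/subr0_eq: hb => <-; rewrite /b.
have dE : \sum_(i < t) (F i - F i.+1) * (H i - H i.+1) =
   (F k - F k.+1) - (if k is j.+1 then F j - F k else 0).
  under eq_bigr => i _ do rewrite mulrBr.
  rewrite sumrB (sum_delta_lt (fun i => F i - F i.+1) kt); congr (_ - _).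
  case: k kt @H @b => [|j] kt H b; first by rewrite big1 // => i _; rewrite mulr0.
  by rewrite -(sum_delta_lt (fun i => F i - F i.+1) (ltnW kt)).
rewrite dE /H; case: (k) => [|j] /=; rewrite ?mulr1 ?mulr0; ring.
Qed.

(** If the form vanishes, all consecutive values agree, down to [F t = 0]. *)
Lemma path_form_gt0 t y F : 1 <= y -> supported t F -> (exists i, F i != 0) ->
  0 < path_form t y F.
Proof.
move=> y1 sF [i Fi].
have nn j : 0 <= (F j - F j.+1) ^+ 2 by rewrite sqr_ge0.
have hd : 0 <= (y - 1) * F 0%N ^+ 2 by rewrite mulr_ge0 ?sqr_ge0 ?subr_ge0.
have tl : 0 <= \sum_(i < t) (F i - F i.+1) ^+ 2 by rewrite sumr_ge0.
rewrite lt_def [X in _ && X]addr_ge0 // andbT; apply: contra Fi => /eqP h.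
have s0 : \sum_(i < t) (F i - F i.+1) ^+ 2 = 0.
  by apply: le_anti; rewrite tl andbT; move: h hd; rewrite /path_form; lra.
have step j : (j < t)%N -> F j = F j.+1.
  move=> jt; move/eqP: s0; rewrite psumr_eq0 // => /allP/(_ (Ordinal jt)).
  by rewrite mem_index_enum sqrf_eq0 subr_eq0 => /(_ isT)/eqP.
have back k : F (t - k)%N = 0.
  elim: k => [|k IH]; first by rewrite subn0 sF.
  have [kt|tk] := ltnP k t; last by rewrite (_ : (t - k.+1 = t - k)%N) //; lia.
  by rewrite step; [rewrite (_ : (t - k.+1).+1 = t - k)%N //; lia | lia].
have [it|ti] := ltnP i t; last by rewrite sF.
by rewrite (_ : i = t - (t - i))%N ?back //; lia.
Qed.

Lemma path_ground_gt0 t y mu : (0 < t)%N -> 1 <= y -> path_ground t y mu -> 0 < mu.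
Proof.
move=> t0 y1 [_ [F [sF nF eF]]].
have := path_form_gt0 y1 sF nF; rewrite eF pmulr_lgt0 //.
exact: sqnorm_gt0.
Qed.

(** At a zero of a nonnegative solution the equation forces the neighbouring values to vanish, and
    the zero spreads in both directions. *)
Lemma path_eq_pos t y mu F : path_eq t y mu F -> supported t F ->
  (forall i, 0 <= F i) -> (exists i, F i != 0) -> forall i, (i < t)%N -> 0 < F i.
Proof.
move=> eqF sF F0 [k Fk] i it; rewrite lt_def F0 andbT; apply: contra Fk => /eqP Fi.
have up j : F (i + j)%N = 0.
  suff : F (i + j)%N = 0 /\ F (i + j).+1 = 0 by case.
  elim: j => [|j [IH1 IH2]].
    rewrite addn0; split=> //; apply: le_anti; rewrite F0 andbT.
    have := eqF _ it; rewrite Fi mulr0; case: (i) Fi => [|m] Fi; rewrite ?Fi; last first.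
      by have := F0 m; lra.
    by lra.
  rewrite addnS; split=> //; have [jt|tj] := ltnP (i + j).+1 t; last by rewrite sF // ltnW.
  by have := eqF _ jt; rewrite IH1 IH2; lra.
have down j : (j <= i)%N -> F (i - j)%N = 0.
  elim: j => [|j IH] ji; first by rewrite subn0.
  have := eqF (i - j)%N; rewrite (IH (ltnW ji)) => /(_ (leq_ltn_trans (leq_subr _ _) it)).
  rewrite (_ : (i - j = (i - j.+1).+1)%N); last by lia.
  by have := F0 (i - j.+1)%N; have := F0 (i - j.+1).+2; lra.
have [ki|ik] := leqP k i; first by rewrite (_ : k = i - (i - k))%N ?down ?leq_subr //; lia.
by rewrite (_ : k = i + (k - i))%N ?up //; lia.
Qed.

Lemma path_form_abs t y F : path_form t y (fun i => `|F i|) <= path_form t y F.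
Proof.
rewrite /path_form real_normK ?num_real // lerD2l; apply: ler_sum => i _.
rewrite -[leRHS]real_normK ?num_real // -[leLHS]real_normK ?num_real //.
by rewrite ler_pXn2r ?nnegrE // ler_dist_dist.
Qed.

Lemma path_ground_pos t y mu : path_ground t y mu ->
  exists F, [/\ supported t F, forall i, (i < t)%N -> 0 < F i, (forall i, 0 <= F i),
                path_eq t y mu F & path_form t y F = mu * sqnorm t F].
Proof.
move=> gr; have [lb [F [sF [i Fi] eF]]] := gr.
pose G i := `|F i|; have sG : supported t G by move=> j tj; rewrite /G sF ?normr0.
have nG : sqnorm t G = sqnorm t F.
  by rewrite /sqnorm; apply: eq_bigr => j _; rewrite /G real_normK ?num_real.
have eG : path_form t y G = mu * sqnorm t G.
  by apply: le_anti; rewrite lb // andbT nG -eF path_form_abs.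
have pG := path_ground_eq gr sG eG.
exists G; split=> // [|j]; last by rewrite /G.
by apply: (path_eq_pos pG sG) => [j|]; [rewrite /G | exists i; rewrite /G normr_eq0].
Qed.

(** The minimizer for [y'] is positive at vertex 0, so as a test function for [y] it has a strictly
    smaller form. *)
Lemma path_ground_mono t y y' mu mu' : (0 < t)%N -> path_ground t y mu ->
  path_ground t y' mu' -> y < y' -> mu < mu'.
Proof.
move=> t0 [lb _] /path_ground_pos[F [sF Fp _ _ eF]] yy.
have F0 := Fp _ t0.
have n0 : 0 < sqnorm t F by apply: sqnorm_gt0 => //; exists 0%N; rewrite gt_eqF.
rewrite -(ltr_pM2r n0) -eF; apply: le_lt_trans (lb F sF) _.
by rewrite ltrD2r ltr_pM2r ?exprn_gt0 // ltrD2r.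
Qed.

Lemma path_ground_unique t y mu mu' : (0 < t)%N -> path_ground t y mu ->
  path_ground t y mu' -> mu = mu'.
Proof.
move=> t0 h h'; wlog: mu mu' h h' / mu <= mu'.
  by move=> th; case: (leP mu mu') => [/th->//|/ltW/th->].
move=> le_mu; apply: le_anti; rewrite le_mu /=.
have [lb _] := h'; have [_ [F [sF nF eF]]] := h.
by rewrite -(ler_pM2r (sqnorm_gt0 sF nF)) -eF lb.
Qed.

Lemma sqnorm_widen t t' F : supported t F -> (t <= t')%N -> sqnorm t' F = sqnorm t F.
Proof.
move=> sF tt; rewrite /sqnorm [in RHS](big_ord_widen t' (fun i => F i ^+ 2)) //.
rewrite [RHS]big_mkcond; apply: eq_bigr => i _; case: ltnP => // ti.
by rewrite sF // expr0n.
Qed.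

Lemma path_form_widen t t' y F : supported t F -> (t <= t')%N ->
  path_form t' y F = path_form t y F.
Proof.
move=> sF tt; rewrite /path_form [in RHS](big_ord_widen t' (fun i => (F i - F i.+1) ^+ 2)) //.
congr (_ + _); rewrite [RHS]big_mkcond; apply: eq_bigr => i _; case: ltnP => // ti.
by rewrite !sF ?subrr ?expr0n // ltnW.
Qed.

(* Reversing [F] exchanges the end conditions y and 2, so a minimizer with
   equal end values would satisfy both. *)
Lemma path_ground_head_lt t y mu F : 2 < y -> path_ground t y mu -> supported t F ->
  path_form t y F = mu * sqnorm t F -> (forall i, 0 <= F i) -> (exists i, F i != 0) ->
  (forall i, (i < t)%N -> F 0%N <= F i) -> forall i, (0 < i < t)%N -> F 0%N < F i.
Proof.
move=> y2 gr sF eF F0 nF Fmin i /andP[i0 it].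
have eqF := path_ground_eq gr sF eF.
have Fp := path_eq_pos eqF sF F0 nF.
rewrite lt_def Fmin // andbT; apply/eqP => Fi.
have mu0 : 0 < mu.
  by apply: path_ground_gt0 gr; [apply: leq_ltn_trans it | lra].
(* At an inner vertex attaining the minimum the equation would give [mu * F i <= 0]; only the far
   end remains. *)
have [iS|iS] := ltnP i.+1 t.
  have := eqF i it; case: i i0 it Fi iS => // i _ it Fi iS.
  have := mulr_gt0 mu0 (Fp _ it).
  by have := Fmin _ (ltnW it); have := Fmin _ iS; rewrite -Fi; lra.
have {iS} ti : t = i.+1 by apply/eqP; rewrite eqn_leq iS it.
case: i i0 it Fi ti => // n _ it Fi ti; subst t.
pose G j := if (j <= n.+1)%N then F (n.+1 - j)%N else 0.
have sG : supported n.+2 G by move=> j; rewrite /G ltnNge => /negbTE ->.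
have nG : sqnorm n.+2 G = sqnorm n.+2 F.
  rewrite /sqnorm (reindex_inj rev_ord_inj) /=; apply: eq_bigr => j _.
  by rewrite /G subSS leq_subr subKn // -ltnS.
have fG : path_form n.+2 y G = path_form n.+2 y F.
  rewrite /path_form [in LHS]big_ord_recr [in RHS]big_ord_recr /=.
  rewrite [G n.+2]sG // [F n.+2]sF // !subr0.
  have -> : G 0%N = F 0%N by rewrite /G subn0 Fi.
  have -> : G n.+1 = F n.+1 by rewrite /G leqnn subnn Fi.
  congr (_ + (_ + _)); rewrite (reindex_inj rev_ord_inj) /=; apply: eq_bigr => j _.
  have jn := ltn_ord j.
  rewrite /G subSS; have -> : (n - j <= n.+1)%N = true by lia.
  have -> : ((n - j).+1 <= n.+1)%N = true by lia.
  rewrite (_ : (n.+1 - (n - j) = j.+1)%N); last by lia.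
  rewrite (_ : (n.+1 - (n - j).+1 = j)%N); last by lia.
  by rewrite -[RHS]sqrrN opprB.
have eG := path_ground_eq gr sG (etrans fG (etrans eF (congr1 _ (esym nG)))).
have := eG 0%N isT; have := eqF n.+1 it.
have -> : G 0%N = F n.+1 by rewrite /G subn0.
have -> : G 1%N = F n by rewrite /G subn1.
rewrite [F n.+2]sF // => e1 e2.
have : (y - 2) * F n.+1 = 0 by rewrite mulrBl -[y * _](subrK (F n)) e2 -e1; ring.
apply/eqP; rewrite mulf_neq0 //; first by rewrite subr_eq0 gt_eqF.
by rewrite gt_eqF // Fp.
Qed.

(** Put a zero in front of the minimizer of the shorter path: the new edge supplies the missing unit
    of potential, and the inequality is strict because a minimizer of the longer path cannot vanish
    at vertex 0. *)
Lemma path_ground_shift t y mu mu' : (0 < t)%N -> path_ground t.+1 y mu ->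
  path_ground t 2 mu' -> mu < mu'.
Proof.
move=> t0 gr /path_ground_pos[F [sF Fp F0 _ eF]].
pose G i := if i is j.+1 then F j else 0.
have sG : supported t.+1 G by case=> // i; apply: sF.
have nG : sqnorm t.+1 G = sqnorm t F.
  by rewrite /sqnorm big_ord_recl /= expr0n add0r.
have fG : path_form t.+1 y G = path_form t 2 F.
  rewrite /path_form big_ord_recl /= expr0n mulr0 add0r sub0r sqrrN; congr (_ + _).
  by ring.
have F0p := Fp _ t0.
have n0 : 0 < sqnorm t F by apply: sqnorm_gt0 => //; exists 0%N; rewrite gt_eqF.
rewrite -(ltr_pM2r n0) -eF -fG lt_def -nG.
have [lb _] := gr; rewrite lb // andbT; apply/eqP => eG.
have : 0 < G 0%N; last by rewrite ltxx.
apply: (path_eq_pos (path_ground_eq gr sG eG) sG) => //; first by case.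
by exists 1%N; rewrite gt_eqF.
Qed.

End PathForm.

(** * Comparing a branch with a path *)

Section Chains.
Variable R : realType.

Fixpoint steps (x : R) (s : seq R) : R :=
  if s is y :: s' then (x - y) ^+ 2 + steps y s' else 0.

Lemma path_form_nth t y x s : (size s < t)%N ->
  path_form t y (nth 0 (x :: s)) = (y - 1) * x ^+ 2 + steps x s + last x s ^+ 2.
Proof.
move=> st; rewrite (@path_form_widen _ (size s).+1) //; last first.
  by move=> i si; rewrite nth_default.
rewrite /path_form -addrA; congr (_ + _).
elim: s x {st} => [|a s IH] x; first by rewrite big_ord1 /= subr0 add0r.
by rewrite big_ord_recl /= -addrA -IH.
Qed.

Lemma sqnorm_nth t s : (size s <= t)%N -> sqnorm t (nth 0 s) = \sum_(x <- s) x ^+ 2 :> R.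
Proof.
move=> st; rewrite (@sqnorm_widen _ (size s)) //; last first.
  by move=> i si; rewrite nth_default.
by rewrite /sqnorm (big_nth 0) big_mkord.
Qed.

Variables (T : eqType) (f : T -> R).

(** Between [z] and [x] some step of the chain passes the value [f o], and [o] is put there. Only
    the value at the end is kept, not the vertex: [o] may become the last one when its value
    agrees. *)
Lemma insert_step z s o x : f z <= f o -> x \in z :: s -> f o <= f x ->
  exists s', [/\ perm_eq s' (o :: s), f (last z s') = f (last z s) &
    steps (f z) (map f s') <= steps (f z) (map f s)].
Proof.
elim: s z => [|a s IH] z zo xs ox.
  move: xs; rewrite inE => /eqP xz; subst x.
  have oz : f o = f z by apply: le_anti; rewrite ox.
  by exists [:: o]; split=> //=; rewrite oz subrr expr0n add0r.
have [oa|ao] := leP (f o) (f a).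
  exists [:: o, a & s]; split=> //=; rewrite addrA lerD2r.
  have := mulr_ge0 (_ : 0 <= f o - f z) (_ : 0 <= f a - f o).
  by rewrite !subr_ge0 => /(_ zo oa); lra.
have [oz|zo'] := leP (f o) (f z).
  exists [:: o, a & s]; split=> //=.
  have -> : f o = f z by apply: le_anti; rewrite oz.
  by rewrite subrr expr0n add0r.
have xs' : x \in a :: s.
  move: xs; rewrite inE => /orP[/eqP xz|//].
  by move: ox; rewrite xz leNgt zo'.
have [s' [ps ls ss]] := IH a (ltW ao) xs' ox.
exists (a :: s'); split=> //=; last by rewrite lerD2l.
apply: (@perm_trans _ (a :: o :: s)); first by rewrite perm_cons.
by rewrite (perm_catCA [:: a] [:: o]).
Qed.

Lemma insert_steps z s os x : x \in z :: s ->
  (forall o, o \in os -> f z <= f o <= f x) ->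
  exists s', [/\ perm_eq s' (os ++ s), f (last z s') = f (last z s) &
    steps (f z) (map f s') <= steps (f z) (map f s)].
Proof.
move=> xs; elim: os => [|o os IH] hos; first by exists s.
have [|s1 [p1 l1 st1]] := IH; first by move=> a ao; apply: hos; rewrite inE ao orbT.
have /andP[zo ox] := hos o (mem_head _ _).
have xs1 : x \in z :: s1.
  move: xs; rewrite !inE => /orP[->//|xs]; rewrite (perm_mem p1) mem_cat xs.
  by rewrite !orbT.
have [s2 [p2 l2 st2]] := insert_step zo xs1 ox.
exists s2; split; [|by rewrite l2|exact: le_trans st2 st1].
by apply: perm_trans p2 _; rewrite perm_cons.
Qed.

End Chains.

Lemma sum_subset_le (R : realType) (T : finType) (A B : pred T) (g : T -> R) :
  (forall x, 0 <= g x) -> {subset A <= B} -> \sum_(x in A) g x <= \sum_(x in B) g x.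
Proof.
move=> g0 AB; rewrite big_mkcond [leRHS]big_mkcond; apply: ler_sum => x _.
by case: ifP => [/AB ->|_] //; case: ifP.
Qed.

(** * The energy inside one branch *)

Section BranchEnergy.
Variables (R : realType) (G : sgraph).
Implicit Types (x y u v w z : G) (f : G -> R).
Notation e := (@edge G).

Definition sqdiff f x y : R := (e x y)%:R * (f x - f y) ^+ 2.

(** The sum is over ordered pairs, so every edge counts twice; hence the factors 2 in the
    estimates. *)
Definition energy (X : {set G}) f : R := \sum_(x in X) \sum_(y in X) sqdiff f x y.

Lemma sqdiff_ge0 f x y : 0 <= sqdiff f x y.
Proof. by rewrite mulr_ge0 ?ler0n ?sqr_ge0. Qed.

Lemma sqdiffC f x y : sqdiff f x y = sqdiff f y x.
Proof. by rewrite /sqdiff edge_sym -[(f x - f y) ^+ 2]sqrrN opprB. Qed.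

Definition leaf_neighbor x := odflt x [pick y | e x y].

Lemma leaf_neighborP x : x \in leaves G -> e x (leaf_neighbor x).
Proof.
rewrite /leaf_neighbor => /leaf_neighbor_exists[y xy].
by case: pickP => //= /(_ y); rewrite xy.
Qed.

Lemma steps_le_energy f z s : path e z s ->
  2 * steps (f z) (map f s) <= \sum_(x <- z :: s) \sum_(y <- z :: s) sqdiff f x y.
Proof.
elim: s z => [|a s IH] z; first by rewrite /= mulr0 !big_seq1 sqdiff_ge0.
move=> /= /andP[za /IH h]; rewrite big_cons [in leRHS]big_cons.
rewrite mulrDr; under [X in _ <= _ + X]eq_bigr => x _ do rewrite big_cons.
rewrite big_split /= addrA lerD // mulr2n mulrDl !mul1r; apply: lerD.
  rewrite big_cons addrCA -[leLHS]addr0; apply: lerD.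
    by rewrite /sqdiff za mul1r.
  by rewrite addr_ge0 ?sqdiff_ge0 // sumr_ge0 // => i _; rewrite sqdiff_ge0.
rewrite big_cons sqdiffC /sqdiff za mul1r lerDl.
by rewrite sumr_ge0 // => i _; rewrite sqdiff_ge0.
Qed.

Section OneBranch.
Hypothesis tG : is_tree G.
Variables (u v : G).
Hypotheses (uv : e u v) (uI : u \in interior G).
Let X := branch u v.
Let I := X :&: interior G.
Let L := X :&: leaves G.

Lemma leaf_neighbor_interior x : x \in L -> leaf_neighbor x \in I.
Proof.
rewrite !in_setI => /andP[xX xL]; have xa := leaf_neighborP xL.
set a := leaf_neighbor x in xa *.
have xu : x != u by apply: contraTneq xL => ->; move: uI; rewrite /interior in_setC.
have aX : a \in X.
  apply: (branch_closed (edge_neq uv) xX xa).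
  apply: contra xu => /eqP av; apply/eqP.
  by apply: (branch_gate tG uv) => //; rewrite -av.
rewrite aX /interior in_setC; apply/negP => aL.
(* Two adjacent leaves would form a component of their own, which misses [u]. *)
have stay p z : z \in [:: x; a] -> path e z p -> last z p \in [:: x; a].
  elim: p z => //= b p IH z za /andP[zb bp]; apply: IH => //.
  move: za; rewrite !inE => /orP[/eqP zx|/eqP za]; apply/orP.
    by right; apply/eqP; apply: leaf_neighbor_unique xL _ xa; rewrite -zx.
  left; apply/eqP; apply: leaf_neighbor_unique aL _ _; first by rewrite -za.
  by rewrite edge_sym.
have [_ conn _] := tG; have /connectP[p xp lp] := conn x u.
have := stay p x (mem_head _ _) xp; rewrite -lp !inE eq_sym (negbTE xu) /=.
by move/eqP => ua; move: uI; rewrite /interior in_setC ua aL.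
Qed.

(** The pairs leaf-interior, interior-leaf and interior-interior are disjoint: the first two give
    each leaf edge once, the last gives the edges of the path twice. *)
Lemma branch_energy_ge f z s : (forall x, x \in leaves G -> f x = 0) ->
  path e z s -> uniq (z :: s) -> {subset z :: s <= I} ->
  2 * (steps (f z) (map f s) + \sum_(x in L) f (leaf_neighbor x) ^+ 2) <= energy X f.
Proof.
move=> f0 zs uzs sI.
have split g : \sum_(x in X) g x = \sum_(x in L) g x + \sum_(x in I) g x :> R.
  by rewrite (big_setID (leaves G)) /= setDE.
have nn x (A : {set G}) : 0 <= \sum_(y in A) sqdiff f x y.
  by rewrite sumr_ge0 // => y _; rewrite sqdiff_ge0.
have hL x : x \in L -> \sum_(y in X) sqdiff f x y >= f (leaf_neighbor x) ^+ 2.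
  move=> xL; have := leaf_neighbor_interior xL; rewrite in_setI => /andP[aX _].
  move: xL; rewrite in_setI => /andP[_ xL].
  rewrite (bigD1 _ aX) /= -[leLHS]addr0 lerD //.
    by rewrite /sqdiff leaf_neighborP // mul1r (f0 x) // sub0r sqrrN.
  by rewrite sumr_ge0 // => y _; rewrite sqdiff_ge0.
have hLX : \sum_(x in L) f (leaf_neighbor x) ^+ 2 <= \sum_(x in L) \sum_(y in X) sqdiff f x y.
  exact: ler_sum.
have hLI : \sum_(x in L) f (leaf_neighbor x) ^+ 2 <= \sum_(x in I) \sum_(y in L) sqdiff f x y.
  rewrite exchange_big /=; apply: ler_sum => x xL.
  have aI := leaf_neighbor_interior xL.
  move: xL; rewrite in_setI => /andP[_ xL].
  rewrite (bigD1 _ aI) /= -[leLHS]addr0 lerD //.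
    by rewrite sqdiffC /sqdiff leaf_neighborP // mul1r (f0 x) // sub0r sqrrN.
  by rewrite sumr_ge0 // => y _; rewrite sqdiff_ge0.
have hII : 2 * steps (f z) (map f s) <= \sum_(x in I) \sum_(y in I) sqdiff f x y.
  apply: le_trans (steps_le_energy f zs) _; rewrite big_uniq //=.
  apply: le_trans (sum_subset_le (B := mem I) _ _) _ => [x|x /sI //|].
    by rewrite sumr_ge0 // => y _; rewrite sqdiff_ge0.
  apply: ler_sum => x _; rewrite big_uniq //=; apply: sum_subset_le => [y|y /sI //].
  exact: sqdiff_ge0.
rewrite /energy split; under [X in _ <= _ + X]eq_bigr => x _ do rewrite split.
rewrite big_split /=; lra.
Qed.

End OneBranch.
End BranchEnergy.

Section BranchBound.
Variables (R : realType) (G : sgraph).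
Notation e := (@edge G).
Hypothesis tG : is_tree G.
Variables (u v : G).
Hypotheses (uv : e u v) (uI : u \in interior G).
Let X := branch u v.
Let I := X :&: interior G.
Let L := X :&: leaves G.

Lemma branch_root_interior : u \in I.
Proof. by rewrite in_setI branch_refl. Qed.

(** A path that leaves [u] within the branch cannot come to [v], whose only neighbour there is [u];
    so its extension stops at a leaf. *)
Lemma extend_to_leaf : exists s w, [/\ path e u s, uniq (u :: s),
  {subset u :: s <= I}, w \in L & e (last u s) w].
Proof.
have [z uz zv] := interior_other_neighbor v uI uv.
have zX : z \in X := branch_closed (edge_neq uv) (branch_refl u v) uz zv.
have [zL|zL] := boolP (z \in leaves G).
  exists [::], z; split=> //; last by rewrite in_setI zX.
  by move=> x; rewrite inE => /eqP->; apply: branch_root_interior.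
have zI : z \in I by rewrite in_setI zX /interior in_setC.
have zu : z != u by rewrite eq_sym edge_neq.
have [||| q [w [h1 h2 h3 h4 h5]]] := @extend_to_end G tG u v u [:: z] uv.
- by rewrite /= uz.
- by rewrite /= inE eq_sym zu.
- move=> x; rewrite in_cons mem_seq1 => /orP[] /eqP->; last exact: zI.
  exact: branch_root_interior.
exists (z :: q), w; split=> //.
case: h5 => // wv; have au : last z q != u.
  apply: contraTneq h2 => lu /=; rewrite negb_and negbK -lu mem_last.
  by [].
case/eqP: au; apply: (branch_gate tG uv); last by rewrite -wv.
by have := h3 _ (mem_last u (z :: q)); rewrite in_setI => /andP[].
Qed.

(** [s] is a genuine path of the tree and meets a minimum and a maximum of [f]. [c] is [s] with all
    other interior vertices inserted; its steps need not be edges, but it fills the whole interior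
    of the branch. *)
Lemma branch_route (f : G -> R) : exists z s w c,
  [/\ [/\ path e z s, uniq (z :: s), {subset z :: s <= I}, e (last z s) w &
          w = v \/ w \in L],
      forall x, x \in I -> f z <= f x,
      exists2 x, x \in z :: s & forall y, y \in I -> f y <= f x,
      perm_eq (z :: c) (enum I) &
      f (last z c) = f (last z s) /\ steps (f z) (map f c) <= steps (f z) (map f s)].
Proof.
have uI' := branch_root_interior.
have [z zI zmin] := arg_minP f uI'.
have [x xI xmax] := arg_maxP f uI'.
have {}zI : z \in I := zI; have {}xI : x \in I := xI.
move: (zI) (xI); rewrite !in_setI => /andP[zX zint] /andP[xX xint].
have [p [zp uzp lp pX]] := branch_connected (edge_neq uv) zX xX.
have pI : {subset z :: p <= I}.
  move=> a ap; rewrite in_setI pX //=; apply: (simple_path_interior zint _ zp uzp ap).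
  by rewrite lp.
have [q [w [h1 h2 h3 h4 h5]]] := extend_to_end tG uv zp uzp pI.
set s := p ++ q in h1 h2 h3 h4.
have xs : x \in z :: s by rewrite -cat_cons mem_cat -lp mem_last.
have := @insert_steps R G f z s [seq o <- enum I | o \notin z :: s] x xs.
case=> [o|c [pc lc sc]].
  rewrite mem_filter mem_enum => /andP[_ oI]; apply/andP; split; first exact: zmin.
  exact: xmax.
exists z, s, w, c; split=> //; first by exists x => // y; apply: xmax.
apply: uniq_perm; last 1 first.
- move=> a; rewrite in_cons (perm_mem pc) mem_cat mem_filter !mem_enum.
  have [as'|as'] := boolP (a \in z :: s).
    by rewrite (h3 _ as'); move: as'; rewrite in_cons => /orP[->//|->]; rewrite !orbT.
  by move: as'; rewrite in_cons negb_or => /andP[/negbTE-> /negbTE->]; rewrite orbF.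
- rewrite cons_uniq (perm_uniq pc) (perm_mem pc) cat_uniq filter_uniq ?enum_uniq //.
  rewrite mem_cat mem_filter mem_head /=; move: h2; rewrite cons_uniq.
  move=> /andP[/negbTE-> ->]; rewrite andbT /=; apply/hasPn => a as'.
  by rewrite mem_filter in_cons as' orbT.
exact: enum_uniq.
Qed.

Section Kill.
Variables (f : G -> R) (alpha : R) (z : G) (s : seq G) (w : G).
Hypotheses (f0 : forall x, 0 <= f x) (alpha1 : 1 <= alpha).
Hypothesis zmin : forall x, x \in I -> f z <= f x.
Hypotheses (sI : {subset z :: s <= I}) (lw : e (last z s) w).
Let p : R := #|L|%:R.
(** The total potential energy: a leaf, where [f] vanishes, acts as a unit potential on its
    neighbour. *)
Let kill := alpha * f u ^+ 2 + \sum_(x in L) f (leaf_neighbor x) ^+ 2.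

Lemma min_sq_le x : x \in I -> f z ^+ 2 <= f x ^+ 2.
Proof. by move=> xI; rewrite ler_pXn2r ?nnegrE ?f0 ?zmin. Qed.

Lemma leaf_kill_ge (A : {set G}) : A \subset L ->
  #|A|%:R * f z ^+ 2 <= \sum_(x in A) f (leaf_neighbor x) ^+ 2.
Proof.
move=> AL; rewrite mulr_natl -sumr_const; apply: ler_sum => x xA.
by apply: min_sq_le; apply: leaf_neighbor_interior => //; apply: (subsetP AL).
Qed.

Lemma leaf_kill_tight (A : {set G}) : A \subset L ->
  \sum_(x in A) f (leaf_neighbor x) ^+ 2 <= #|A|%:R * f z ^+ 2 ->
  forall x, x \in A -> f (leaf_neighbor x) = f z.
Proof.
move=> AL; rewrite mulr_natl -sumr_const -subr_ge0 -sumrB => h x xA.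
have nn y : y \in A -> 0 <= f (leaf_neighbor y) ^+ 2 - f z ^+ 2.
  move=> yA; rewrite subr_ge0 min_sq_le //; apply: leaf_neighbor_interior => //.
  exact: (subsetP AL).
have /eqP : \sum_(y in A) (f (leaf_neighbor y) ^+ 2 - f z ^+ 2) = 0.
  apply: le_anti; rewrite sumr_ge0 // andbT -oppr_ge0 -sumrN.
  by under eq_bigr => y _ do rewrite opprB.
rewrite psumr_eq0 // => /allP/(_ x); rewrite mem_index_enum xA subr_eq0 => /(_ isT).
by rewrite eqrXn2 ?f0 // => /eqP.
Qed.

Lemma kill_at_root : w = v -> last z s = u.
Proof.
move=> wv; apply: (branch_gate tG uv); last by rewrite -wv.
by have := sI (mem_last z s); rewrite in_setI => /andP[].
Qed.

Lemma kill_at_leaf : w \in L -> leaf_neighbor w = last z s.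
Proof.
rewrite in_setI => /andP[_ wL]; apply: leaf_neighbor_unique wL (leaf_neighborP wL) _.
by rewrite edge_sym.
Qed.

(** There are [alpha + p] units of potential. One stays at the end of the path, namely a unit at [u]
    if the path stops at [v], the leaf [w] otherwise; the others are estimated at the minimum
    [z]. *)
Lemma kill_ge : w = v \/ w \in L ->
  (alpha + p - 1) * f z ^+ 2 + f (last z s) ^+ 2 <= kill.
Proof.
have uz := min_sq_le branch_root_interior.
case=> [/kill_at_root->|wL].
  have := leaf_kill_ge (subxx L); rewrite -/p /kill.
  have : 0 <= (alpha - 1) * (f u ^+ 2 - f z ^+ 2) by rewrite mulr_ge0 ?subr_ge0.
  by lra.
rewrite /kill (big_setD1 w) //= kill_at_leaf //.
have := leaf_kill_ge (subD1set L w).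
have -> : p = #|L :\ w|%:R + 1 by rewrite /p (cardsD1 w L) wL natrD addrC.
have : 0 <= alpha * (f u ^+ 2 - f z ^+ 2).
  by rewrite mulr_ge0 ?subr_ge0 //; apply: le_trans alpha1.
by lra.
Qed.

(** After one unit is spent at the end of the path, a positive potential [alpha - 1] remains at [u],
    and it has no slack. *)
Lemma kill_tight_root : 1 < alpha -> w = v ->
  kill <= (alpha + p - 1) * f z ^+ 2 + f (last z s) ^+ 2 -> f u = f z.
Proof.
move=> a1 /kill_at_root->; have uz := min_sq_le branch_root_interior.
have := leaf_kill_ge (subxx L); rewrite -/p /kill => h1 h2.
have : (alpha - 1) * (f u ^+ 2 - f z ^+ 2) <= 0 by lra.
rewrite pmulr_rle0 ?subr_gt0 // subr_le0 => h3.
by apply/eqP; rewrite -(@eqrXn2 _ 2) ?f0 //; apply/eqP/le_anti; rewrite h3.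
Qed.

Lemma kill_tight_leaf : w \in L ->
  kill <= (alpha + p - 1) * f z ^+ 2 + f (last z s) ^+ 2 ->
  f u = f z /\ forall x, x \in L :\ w -> f (leaf_neighbor x) = f z.
Proof.
move=> wL; have uz := min_sq_le branch_root_interior.
rewrite /kill (big_setD1 w) //= kill_at_leaf //.
have h1 := leaf_kill_ge (subD1set L w).
have a0 : 0 < alpha by apply: lt_le_trans alpha1.
have -> : p = #|L :\ w|%:R + 1 by rewrite /p (cardsD1 w L) wL natrD addrC.
move=> h2; have h3 : alpha * (f u ^+ 2 - f z ^+ 2) <= 0 by lra.
have h4 : 0 <= alpha * (f u ^+ 2 - f z ^+ 2) by rewrite mulr_ge0 ?subr_ge0 // ltW.
split; last by apply: leaf_kill_tight (subD1set L w) _; lra.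
move: h3; rewrite pmulr_rle0 // subr_le0 => h3.
by apply/eqP; rewrite -(@eqrXn2 _ 2) ?f0 //; apply/eqP/le_anti; rewrite h3.
Qed.

End Kill.

Lemma energy_abs (f : G -> R) : energy X (fun x => `|f x|) <= energy X f.
Proof.
apply: ler_sum => x _; apply: ler_sum => y _; rewrite ler_wpM2l ?ler0n //.
rewrite -[leRHS]real_normK ?num_real // -[leLHS]real_normK ?num_real //.
by rewrite ler_pXn2r ?nnegrE // ler_dist_dist.
Qed.

Section Compare.
Variables (t : nat) (y mu alpha : R) (f : G -> R).
Let p : R := #|L|%:R.
Hypotheses (gr : path_ground t y mu) (alpha1 : 1 <= alpha) (yp : y <= alpha + p).
Hypothesis It : (#|I| <= t)%N.
Hypothesis fL : forall x, x \in leaves G -> f x = 0.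

(** The energy inequality before any loss in the potentials is discarded, so that it serves both the
    bound and its equality case. *)
Lemma branch_chain : exists z s w c,
  let g x : R := `|f x| in
  let F := nth 0 (map g (z :: c)) in
  let kill := alpha * g u ^+ 2 + \sum_(x in L) g (leaf_neighbor x) ^+ 2 in
  [/\ [/\ path e z s, uniq (z :: s), {subset z :: s <= I}, e (last z s) w &
          w = v \/ w \in L],
      (forall x, x \in I -> g z <= g x) /\
      exists2 x, x \in z :: s & forall y, y \in I -> g y <= g x,
      perm_eq (z :: c) (enum I),
      supported t F /\ sqnorm t F = \sum_(x in I) f x ^+ 2 &
      path_form t y F + (kill - ((y - 1) * g z ^+ 2 + g (last z s) ^+ 2))
        <= energy X f / 2 + alpha * f u ^+ 2].
Proof.
pose g x : R := `|f x|.
have [z [s [w [c [R1 R2 R3 R4 [R5 R6]]]]]] := branch_route g.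
exists z, s, w, c; split=> //.
- have szc : size (z :: c) = #|I| by rewrite (perm_size R4) -cardE.
  split=> [i ti|]; first by rewrite nth_default // size_map szc (leq_trans It).
  rewrite sqnorm_nth ?size_map ?szc // big_map (perm_big _ R4) big_enum /=.
  by apply: eq_bigr => x _; rewrite real_normK ?num_real.
- have szc : (size (map g c) < t)%N.
    by rewrite size_map (leq_trans _ It) // cardE -(perm_size R4).
  have [zs uzs sI lw w_or] := R1.
  rewrite [path_form _ _ _](_ : _ = path_form t y (nth 0 (g z :: map g c))) //.
  rewrite path_form_nth // last_map R5.
  have gL x : x \in leaves G -> g x = 0 by move=> xL; rewrite /g fL ?normr0.
  have := branch_energy_ge tG uv uI gL zs uzs sI; have := energy_abs f.
  rewrite -/g -/X -/L -/I.
  have : g u ^+ 2 = f u ^+ 2 by rewrite real_normK ?num_real.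
  move: R6; rewrite -/g; set a := steps _ _; set b := steps _ _.
  set K := \sum_(x in L) _; set E := energy _ g; set E' := energy _ f.
  rewrite -/(g u) -/(g z) -/(g (last z s)).
  by move=> h1 -> h2 h3; lra.
Qed.

Lemma branch_bound :
  2 * mu * \sum_(x in I) f x ^+ 2 <= energy X f + 2 * alpha * f u ^+ 2.
Proof.
have [z [s [w [c]]]] := branch_chain; cbv zeta.
set F := nth _ _; set g := fun x : G => `|f x| : R.
move=> [[zs uzs sI lw w_or] [zmin _] pc [sF <-] h].
have g0 x : 0 <= g x by rewrite /g.
have := kill_ge g0 alpha1 zmin sI lw w_or; have [lb _] := gr.
have := lb F sF; move: h; rewrite -/p /g.
have : 0 <= (alpha + p - y) * `|f z| ^+ 2 by rewrite mulr_ge0 ?sqr_ge0 // subr_ge0.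
by lra.
Qed.

Hypothesis fI : exists2 x, x \in I & f x != 0.
Hypothesis tight :
  energy X f + 2 * alpha * f u ^+ 2 <= 2 * mu * \sum_(x in I) f x ^+ 2.

Lemma branch_tight_chain : exists z s w c,
  let g x : R := `|f x| in
  let F := nth 0 (map g (z :: c)) in
  let kill := alpha * g u ^+ 2 + \sum_(x in L) g (leaf_neighbor x) ^+ 2 in
  [/\ [/\ path e z s, uniq (z :: s), {subset z :: s <= I}, e (last z s) w &
          w = v \/ w \in L],
      (forall x, x \in I -> g z <= g x) /\
      exists2 x, x \in z :: s & forall y, y \in I -> g y <= g x,
      perm_eq (z :: c) (enum I),
      [/\ supported t F, path_form t y F = mu * sqnorm t F & exists i, F i != 0] &
      kill <= (y - 1) * g z ^+ 2 + g (last z s) ^+ 2].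
Proof.
have [z [s [w [c]]]] := branch_chain; cbv zeta.
set F := nth _ _; set g := fun x : G => `|f x| : R.
move=> [[zs uzs sI lw w_or] [zmin xmax] pc [sF nF] h].
exists z, s, w, c; cbv zeta; rewrite -/g -/F.
have g0 x : 0 <= g x by rewrite /g.
have k1 := kill_ge g0 alpha1 zmin sI lw w_or; have [lb _] := gr.
have k2 := lb F sF.
have k3 : 0 <= (alpha + p - y) * g z ^+ 2 by rewrite mulr_ge0 ?sqr_ge0 // subr_ge0.
move: tight k2; rewrite -nF => k4 k2.
split=> //; last first.
  by move: k1 h k2 k3 k4; rewrite -/p /g; lra.
split=> //.
  by apply: le_anti; rewrite k2 andbT; move: k1 h k2 k3 k4; rewrite -/p /g; lra.
have [x xI fx] := fI; have : x \in z :: c by rewrite (perm_mem pc) mem_enum.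
move=> xc; exists (index x (z :: c)).
by rewrite /F (nth_map x) ?index_mem // nth_index // /g normr_eq0.
Qed.

(** The chain is a minimizer of the path, hence positive on all [t] vertices; a smaller interior
    would leave a zero. As [f z != 0], a gap between [y] and [alpha + p] would be visible too. *)
Lemma branch_tight : [/\ #|I| = t, y = alpha + p & forall x, x \in I -> f x != 0].
Proof.
have [z [s [w [c]]]] := branch_tight_chain; cbv zeta.
set F := nth _ _; set g := fun x : G => `|f x| : R.
move=> [[zs uzs sI lw w_or] [zmin xmax] pc [sF eF nF] h].
have g0 x : 0 <= g x by rewrite /g.
have F0 i : 0 <= F i.
  rewrite /F; have [ic|ci] := ltnP i (size (map g (z :: c))).
    by rewrite size_map in ic; rewrite (nth_map z) // /g.
  by rewrite nth_default.
have Fp := path_eq_pos (path_ground_eq gr sF eF) sF F0 nF.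
have szc : size (z :: c) = #|I| by rewrite (perm_size pc) -cardE.
have tI : #|I| = t.
  apply/eqP; rewrite eqn_leq It /= leqNgt; apply/negP => /Fp.
  by rewrite /F nth_default ?ltxx // size_map szc.
have fp x : x \in I -> f x != 0.
  move=> xI; have xc : x \in z :: c by rewrite (perm_mem pc) mem_enum.
  have := Fp (index x (z :: c)); rewrite -tI -szc index_mem xc => /(_ isT).
  by rewrite /F (nth_map x) ?index_mem // nth_index // /g normr_gt0.
split=> //; apply: le_anti; rewrite yp /=.
have zI : z \in I by apply: sI; rewrite mem_head.
have z0 : 0 < g z ^+ 2 by rewrite exprn_gt0 // /g normr_gt0 fp.
have := kill_ge g0 alpha1 zmin sI lw w_or; rewrite -/p => k1.
by rewrite -(ler_pM2r z0); move: k1 h; rewrite /g; lra.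
Qed.

(** The branch is a copy of C_{t,p} with [u] as v_1: the path [u :: s] exhausts its interior, [w]
    hangs at the far end, all other leaves at [u]. *)
Definition branch_shape s w := [/\ path e u s, uniq (u :: s), {subset u :: s <= I},
  {subset I <= u :: s} & [/\ w \in L, e (last u s) w &
  forall w', w' \in L -> w' != w -> e w' u]].

(** Without slack the relocated potentials sit where [f] is minimal in absolute value, and by
    strictness of the path minimizer this happens at [z] only. So [z = u], and the leaves other than
    [w] hang there. *)
Lemma branch_tight_shape : 1 < alpha -> 2 < y -> exists s w, branch_shape s w.
Proof.
move=> a1 y2; have [tI yE fp] := branch_tight.
have [z [s [w [c]]]] := branch_tight_chain; cbv zeta.
set F := nth _ _; set g := fun x : G => `|f x| : R.
move=> [[zs uzs sI lw w_or] [zmin [x xs xmax]] pc [sF eF nF] h].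
have g0 a : 0 <= g a by rewrite /g.
have szc : size (z :: c) = #|I| by rewrite (perm_size pc) -cardE.
have F0 i : 0 <= F i.
  rewrite /F; have [ic|ci] := ltnP i (size (map g (z :: c))).
    by rewrite size_map in ic; rewrite (nth_map z) // /g.
  by rewrite nth_default.
have FE i : (i < t)%N -> F i = g (nth z (z :: c) i).
  by move=> it; rewrite /F (nth_map z) // szc tI.
have cI i : (i < t)%N -> nth z (z :: c) i \in I.
  by move=> it; rewrite -mem_enum -(perm_mem pc) mem_nth // szc tI.
have Fmin i : (i < t)%N -> F 0%N <= F i by move=> it; rewrite (FE i) //; apply: zmin; apply: cI.
have Flt := path_ground_head_lt y2 gr sF eF F0 nF Fmin.
have only a : a \in I -> g a = g z -> a = z.
  move=> aI ga; have ac : a \in z :: c by rewrite (perm_mem pc) mem_enum.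
  have it : (index a (z :: c) < t)%N by rewrite -tI -szc index_mem.
  case: (posnP (index a (z :: c))) => [i0|ip].
    by rewrite -(nth_index z ac) i0.
  have := Flt (index a (z :: c)); rewrite ip it => /(_ isT).
  by rewrite (FE _ it) nth_index // ga ltxx.
have wor := w_or; have uI' := branch_root_interior.
rewrite yE in h.
case: w_or => [wv|wL].
  have gu := kill_tight_root g0 zmin sI lw a1 wv h.
  (* A path stopping at [v] ends at [u], where it also starts, so it is a single vertex; minimum and
     maximum then agree, and [u] is the only interior vertex. *)
  have uz := only _ uI' gu; subst z.
  have lu := kill_at_root sI lw wv.
  have s0 : s = [::].
    case/lastP: (s) uzs lu => // s' b; rewrite last_rcons => + bu.
    by rewrite bu /= mem_rcons mem_head.
  subst s; move: xs; rewrite mem_seq1 => /eqP xu; subst x.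
  have Iu a : a \in I -> a = u.
    by move=> aI; apply: only => //; apply: le_anti; rewrite zmin // xmax.
  have [s [w' [h1 h2 h3 h4 h5]]] := extend_to_leaf.
  have s0 : s = [::].
    case: (s) h2 h3 => // b s' h2 h3; have := h3 b.
    rewrite !in_cons eqxx orbT => /(_ isT)/Iu bu.
    by move: h2; rewrite bu /= mem_head.
  subst s; exists [::], w'; split=> //.
    by move=> a /Iu ->; rewrite mem_head.
  split=> // w2 w2L _; have := leaf_neighbor_interior tG uv uI w2L.
  move/Iu <-; apply: leaf_neighborP.
  by move: w2L; rewrite in_setI => /andP[].
have [gu hl] := kill_tight_leaf g0 alpha1 zmin lw wL h.
have uz := only _ uI' gu; subst z.
have oth w' : w' \in L -> w' != w -> e w' u.
  move=> w'L ww; have w'A : w' \in L :\ w by rewrite in_setD1 ww.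
  rewrite -(only _ (leaf_neighbor_interior tG uv uI w'L) (hl _ w'A)).
  by apply: leaf_neighborP; move: w'L; rewrite in_setI => /andP[].
exists s, w; split=> //.
exact: (path_covers_branch tG uv zs uzs sI wL lw oth).
Qed.

End Compare.

(** Any path to the only leaf covers the branch. This replaces the strictness argument when the end
    potential is exactly 2. *)
Lemma branch_shape_one_leaf : #|L| = 1%N -> exists s w, branch_shape s w.
Proof.
move=> L1; have [s [w [h1 h2 h3 h4 h5]]] := extend_to_leaf.
have oth w' : w' \in L -> w' != w -> e w' u.
  move/eqP: L1 => /cards1P[a La]; move: h4; rewrite La !in_set1 => /eqP-> /eqP->.
  by rewrite eqxx.
exists s, w; split=> //.
exact: (path_covers_branch tG uv h1 h2 h3 h4 h5 oth).
Qed.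

End BranchBound.

(** * Dirichlet eigenvalues and energy *)

Section DirichletForm.
Variables (R : realType) (G : sgraph).
Implicit Types (x y u v : G) (f g : G -> R).
Notation e := (@edge G).
Let M := dirichlet_mx R G.

Definition vanishing f := forall x, x \in leaves G -> f x = 0.

Definition lap f x : R := \sum_y (e x y)%:R * (f x - f y).

Definition total_energy f : R := \sum_x \sum_y sqdiff f x y.

Definition total_sq f : R := \sum_x f x ^+ 2.

Lemma total_energy_lap f : total_energy f = 2 * \sum_x f x * lap f x.
Proof.
have dist x : f x * lap f x = \sum_y (e x y)%:R * (f x * (f x - f y)).
  by rewrite /lap mulr_sumr; apply: eq_bigr => y _; ring.
rewrite mulr2n mulrDl mul1r {1}(eq_bigr _ (fun x _ => dist x)) exchange_big /=.
rewrite -big_split /=; apply: eq_bigr => x _; rewrite dist -big_split /=.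
by apply: eq_bigr => y _; rewrite /sqdiff (edge_sym y); ring.
Qed.

Let vec f : 'rV[R]_#|interior G| := \row_i f (enum_val i).

Lemma sum_interior f (h : G -> R) : vanishing f ->
  \sum_(i < #|interior G|) f (enum_val i) * h (enum_val i) = \sum_x f x * h x.
Proof.
move=> f0; rewrite -(big_enum_val (fun x => f x * h x)) /= [RHS](bigID (mem (interior G))) /=.
rewrite [X in _ = _ + X]big1 ?addr0 // => x.
by rewrite /interior in_setC negbK => /f0 ->; rewrite mul0r.
Qed.

Lemma vec_onto (x : 'rV[R]_#|interior G|) : exists2 f, vanishing f & vec f = x.
Proof.
pose f y := \sum_i x 0 i * (enum_val i == y)%:R : R.
exists f => [y yL|].
  rewrite /f big1 // => i _; case: eqP => [ey|]; last by rewrite mulr0.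
  by have := enum_valP i; rewrite ey /interior in_setC yL.
apply/rowP => j; rewrite mxE /f (bigD1 j) //= eqxx mulr1 big1 ?addr0 // => i ij.
by rewrite (inj_eq enum_val_inj) (negbTE ij) mulr0.
Qed.

Lemma dirichlet_mx_sym : M^T = M.
Proof.
apply/matrixP => i j; rewrite !mxE /laplacian edge_sym [_ == _]eq_sym.
by case: eqP => [->|_] //; rewrite !mulr0n.
Qed.

(** The diagonal holds full degrees, so the edges to leaves are counted, with the value 0 at the
    leaf. *)
Lemma vec_mul_dirichlet f j : vanishing f -> (vec f *m M) 0 j = lap f (enum_val j).
Proof.
move=> f0; rewrite mxE; under eq_bigr => i _ do rewrite !mxE.
rewrite (sum_interior (fun x => laplacian R x (enum_val j))) //.
set z := enum_val j; rewrite /lap; under [RHS]eq_bigr => y _ do rewrite mulrBr.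
rewrite sumrB /laplacian; under eq_bigr => x _ do rewrite mulrBr.
rewrite sumrB; congr (_ - _); last by apply: eq_bigr => x _; rewrite edge_sym mulrC.
rewrite (bigD1 z) //= eqxx big1 ?addr0 => [|x xz]; last by rewrite (negbTE xz) mulr0.
rewrite -mulr_suml mulrC mulr1n; congr (_ * _).
rewrite /degree -sum1dep_card natr_sum big_mkcond; apply: eq_bigr => y _.
by case: (e z y).
Qed.

Lemma vec_form f : vanishing f -> 2 * (vec f *m M *m (vec f)^T) 0 0 = total_energy f.
Proof.
move=> f0; rewrite total_energy_lap mulmx_trE -(sum_interior (lap f)) //.
by congr (2 * _); apply: eq_bigr => i _; rewrite vec_mul_dirichlet // mxE mulrC.
Qed.

Lemma vec_sqnorm f : vanishing f -> (vec f *m (vec f)^T) 0 0 = total_sq f.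
Proof.
move=> f0; rewrite mulmx_trE.
under eq_bigr => i _ do rewrite !mxE.
by rewrite (sum_interior f) //; apply: eq_bigr => x _; rewrite expr2.
Qed.

Hypothesis int2 : (1 < #|interior G|)%N.
Let l2 := dirichlet_eigenvalue R G 2.

(** The coefficients (1, 0) give the condition at a central vertex, (a, 1) the one at a central
    edge. *)
Lemma lambda2_ge (a c : R) u v : u \in interior G -> v \in interior G ->
  exists f, [/\ vanishing f, exists x, f x != 0, a * f u + c * f v = 0,
    total_energy f <= 2 * l2 * total_sq f &
    total_energy f = 2 * l2 * total_sq f -> forall x, x \in interior G -> lap f x = l2 * f x].
Proof.
move=> uI vI.
pose w : 'cV[R]_#|interior G| := \col_i (a * (enum_val i == u)%:R + c * (enum_val i == v)%:R).
have [x [x0 xw le_x eq_x]] := second_eigenvalue_ge w dirichlet_mx_sym int2.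
have [f f0 fx] := vec_onto x; exists f; subst x.
rewrite -/l2 vec_sqnorm // in le_x eq_x.
split=> //.
- have /rV0Pn[j] := x0; rewrite mxE => fj; by exists (enum_val j).
- have /matrixP/(_ 0 0) := xw; rewrite mxE [RHS]mxE => <-.
  under eq_bigr => i _ do rewrite !mxE.
  rewrite (sum_interior (fun x => a * (x == u)%:R + c * (x == v)%:R)) //.
  have del z : \sum_x f x * (x == z)%:R = f z.
    rewrite (bigD1 z) //= eqxx mulr1 big1 ?addr0 // => x /negbTE->.
    by rewrite mulr0.
  rewrite -(del u) -(del v) !mulr_sumr -big_split /=; apply: eq_bigr => x _; ring.
- by rewrite -vec_form // -mulrA ler_pM2l.
have two0 : (2 : R) != 0 by rewrite pnatr_eq0.
rewrite -vec_form // -mulrA => /(mulfI two0) h x xI.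
have /rowP/(_ (enum_rank_in xI x)) := eq_x h.
by rewrite vec_mul_dirichlet // !mxE enum_rankK_in.
Qed.

Lemma lambda2_le f g (c : R) : vanishing f -> vanishing g ->
  (forall a b, (forall x, a * f x + b * g x = 0) -> a = 0 /\ b = 0) ->
  (forall a b (h := fun x => a * f x + b * g x), total_energy h <= 2 * c * total_sq h) ->
  l2 <= c.
Proof.
move=> f0 g0 indep le_c.
have comb a b : a *: vec f + b *: vec g = vec (fun x => a * f x + b * g x).
  by apply/rowP => i; rewrite !mxE.
have h0 a b : vanishing (fun x => a * f x + b * g x).
  by move=> x xL; rewrite f0 // g0 // !mulr0 addr0.
apply: (second_eigenvalue_le dirichlet_mx_sym int2 (f := vec f) (g := vec g)).
  move=> a b; rewrite comb => hz; apply: indep => x.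
  have [xL|xI] := boolP (x \in leaves G); first by rewrite h0.
  have xI' : x \in interior G by rewrite /interior in_setC.
  have /rowP/(_ (enum_rank_in xI' x)) := hz.
  by rewrite !mxE enum_rankK_in.
move=> a b; cbv zeta; rewrite comb -(@ler_pM2l _ 2) // vec_form // vec_sqnorm //.
by rewrite mulrA; apply: le_c.
Qed.

End DirichletForm.

(** * Splitting the energy at an edge or at a vertex *)

Section EnergySplit.
Variables (R : realType) (G : sgraph).
Implicit Types (x y u v : G) (f g : G -> R).
Notation e := (@edge G).
Hypothesis tG : is_tree G.

Lemma branch_boundary f u v : e u v ->
  \sum_(x in branch u v) \sum_y sqdiff f x y = energy (branch u v) f + (f u - f v) ^+ 2.
Proof.
move=> uv; have nuv := edge_neq uv; set X := branch u v.
rewrite /energy; under eq_bigr => x _ do rewrite (bigID (mem X)) /=.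
rewrite big_split /=; congr (_ + _).
have vX : v \notin X by apply/negP => /(branch_neq nuv); rewrite eqxx.
have far x y : x \in X -> y \notin X -> e x y -> x = u /\ y = v.
  move=> xX yX xy; have yv : y = v.
    by apply/eqP; apply: contraNT yX => yv; apply: (branch_closed nuv xX xy yv).
  by split=> //; apply: (branch_gate tG uv xX); rewrite -yv.
rewrite (bigD1 u) ?branch_refl //= [X in _ + X]big1 ?addr0 => [|x /andP[xX xu]].
  rewrite (bigD1 v) //= big1 ?addr0 => [|y /andP[yX yv]].
    by rewrite /sqdiff uv mul1r.
  rewrite /sqdiff; case uy: (e u y); rewrite ?mul0r //.
  by have [] := far u y (branch_refl u v) yX uy => _ yv'; rewrite yv' eqxx in yv.
rewrite big1 // => y yX; rewrite /sqdiff; case xy: (e x y); rewrite ?mul0r //.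
by have [xu'] := far x y xX yX xy; rewrite xu' eqxx in xu.
Qed.

Lemma energy_edge_split f u v : e u v -> total_energy f =
  energy (branch u v) f + energy (branch v u) f + 2 * (f u - f v) ^+ 2.
Proof.
move=> uv; have vu : e v u by rewrite edge_sym.
rewrite /total_energy (bigID (mem (branch u v))) /= branch_boundary //.
rewrite (eq_bigl (mem (branch v u))) => [|x]; last first.
  by rewrite /= (branchC tG uv) in_setC.
by rewrite branch_boundary //; ring.
Qed.

Lemma sum_branches (h : G -> R) v :
  \sum_(u | e u v) \sum_(x in branch u v) h x = \sum_(x | x != v) h x.
Proof.
rewrite (exchange_big_dep (fun x => x != v)) /=; last first.
  by move=> u x uv; apply: branch_neq; apply: edge_neq.
apply: eq_bigr => x xv; have [u uv xu] := branch_cover tG xv.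
rewrite (bigD1 u) ?uv //= big1 ?addr0 // => u' /andP[/andP[u'v xu'] uu].
by rewrite (branch_disjoint tG u'v uv xu' xu) eqxx in uu.
Qed.

Lemma energy_vertex_split f v : f v = 0 -> total_energy f =
  \sum_(u | e u v) (energy (branch u v) f + 2 * f u ^+ 2).
Proof.
move=> fv; rewrite /total_energy (bigD1 v) //= -sum_branches.
have -> : \sum_y sqdiff f v y = \sum_(u | e u v) f u ^+ 2.
  rewrite [RHS]big_mkcond; apply: eq_bigr => u _; rewrite /sqdiff edge_sym fv sub0r sqrrN.
  by case: (e u v); rewrite ?mul1r ?mul0r.
rewrite -big_split /=; apply: eq_bigr => u uv.
by rewrite branch_boundary // fv subr0; ring.
Qed.

End EnergySplit.

(** * Lower bounds on the second eigenvalue *)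

Definition branch_interior (G : sgraph) (u v : G) := branch u v :&: interior G.
Definition branch_leaves (G : sgraph) (u v : G) := branch u v :&: leaves G.

Section Centroid.
Variable (G : sgraph).
Implicit Types (x y u v : G).
Notation e := (@edge G).
Hypothesis tG : is_tree G.

Lemma leaf_branch u v : e u v -> u \in leaves G -> branch u v = [set u].
Proof.
move=> uv uL; apply/setP => x; rewrite in_set1; apply/idP/eqP => [|->]; last first.
  exact: branch_refl.
rewrite inE => /connectP[[|y p] /= up ->] //.
case/andP: up => /and3P[uy _ yv] _; case/eqP: yv.
exact: leaf_neighbor_unique uL uy uv.
Qed.

Lemma leaf_branch_interior u v : e u v -> u \in leaves G -> branch_interior u v = set0.
Proof.
move=> uv uL; rewrite /branch_interior leaf_branch //; apply/setP => x.
rewrite in_setI in_set1 in_set0 /interior in_setC.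
by case: eqP => // ->; rewrite uL.
Qed.

(** Among the directed edges whose branch holds more than half of the interior, take one with fewest
    interior vertices; its root [u] is a centroid. Another heavy branch at [u] would either be
    smaller or be the complement of the first. *)
Lemma centroid : (0 < #|interior G|)%N ->
  exists2 v, v \in interior G &
    forall u, e u v -> (2 * #|branch_interior u v| <= #|interior G|)%N.
Proof.
move=> /card_gt0P[v0 v0I].
pose heavy (d : G * G) := e d.1 d.2 && (#|interior G| < 2 * #|branch_interior d.1 d.2|)%N.
have [d0 hd0|none] := pickP heavy; last first.
  exists v0 => // u uv; have := none (u, v0); rewrite /heavy /= uv /= => /negbT.
  by rewrite -leqNgt.
have [[u v] /andP[/= uv hv] dmin] := arg_minnP (fun d => #|branch_interior d.1 d.2|) hd0.
have uI : u \in interior G.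
  rewrite /interior in_setC; apply/negP => uL.
  by move: hv; rewrite leaf_branch_interior // cards0.
exists u => // n nu; rewrite leqNgt; apply/negP => hn.
have [nv|nv] := eqVneq n v.
  move: hn hv; rewrite nv /branch_interior (branchC tG uv).
  have := cardsID (branch u v) (interior G); rewrite setDE (setIC (interior G) (branch u v)).
  rewrite (setIC (interior G)).
  by set a := #|_|; set b := #|_|; set c := #|_|; lia.
have := dmin (n, u); rewrite /heavy /= nu hn => /(_ isT).
rewrite leqNgt => /negP; apply; apply: proper_card.
have := branch_proper tG nu uv nv => pr.
rewrite properE; apply/andP; split; first by apply/setSI/proper_sub.
apply/subsetPn; exists u; first by rewrite in_setI branch_refl.
rewrite in_setI negb_and; apply/orP; left.
by apply/negP => /(branch_neq (edge_neq nu)); rewrite eqxx.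
Qed.

End Centroid.

Section LowerBounds.
Variables (R : realType) (G : sgraph).
Implicit Types (x y u v : G) (f g : G -> R).
Notation e := (@edge G).
Hypothesis tG : is_tree G.
Hypothesis int2 : (1 < #|interior G|)%N.
Let l2 := dirichlet_eigenvalue R G 2.

Lemma total_sq_gt0 f : (exists x, f x != 0) -> 0 < total_sq f.
Proof.
move=> [x fx]; rewrite /total_sq (bigD1 x) //= ltr_wpDr ?exprn_even_gt0 //.
by rewrite sumr_ge0 // => y _; rewrite sqr_ge0.
Qed.

Lemma sum_sq_branch f u v : vanishing f ->
  \sum_(x in branch u v) f x ^+ 2 = \sum_(x in branch_interior u v) f x ^+ 2.
Proof.
move=> f0; rewrite (big_setID (leaves G)) /= setDE big1 ?add0r // => x.
by rewrite in_setI => /andP[_ /f0->]; rewrite expr0n.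
Qed.

Lemma branch_leaves_gt0 u v : e u v -> u \in interior G -> (0 < #|branch_leaves u v|)%N.
Proof.
move=> uv uI; have [s [w [_ _ _ wL _]]] := extend_to_leaf tG uv uI.
by apply/card_gt0P; exists w.
Qed.

(** Here [alpha = 1], and a branch with interior root contains a leaf, so [2 <= alpha + p]. *)
Lemma branch_bound2 s mu f u v : path_ground s 2 mu -> vanishing f -> e u v ->
  (#|branch_interior u v| <= s)%N ->
  2 * mu * \sum_(x in branch u v) f x ^+ 2 <= energy (branch u v) f + 2 * f u ^+ 2.
Proof.
move=> gr f0 uv Is; rewrite sum_sq_branch //.
have [uL|uI] := boolP (u \in leaves G).
  rewrite leaf_branch_interior // big_set0 mulr0 f0 // expr0n mulr0 addr0.
  by apply: sumr_ge0 => x _; apply: sumr_ge0 => y _; rewrite sqdiff_ge0.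
have uI' : u \in interior G by rewrite /interior in_setC.
have := @branch_bound R G tG u v uv uI' s 2 mu 1 f gr (lexx _) _ Is f0.
rewrite mulr1; apply; rewrite -[2]/(1 + 1) lerD2l ler1n.
exact: branch_leaves_gt0.
Qed.

Lemma center_bound v s mu : v \in interior G -> path_ground s 2 mu ->
  (forall u, e u v -> (#|branch_interior u v| <= s)%N) -> mu <= l2.
Proof.
move=> vI gr small; have [f [f0 fn0]] := lambda2_ge int2 (1 : R) 0 vI vI.
rewrite mul1r mul0r addr0 => fv le_e _.
have : 2 * mu * total_sq f <= total_energy f.
  rewrite (energy_vertex_split tG fv) /total_sq (bigD1 v) //= fv expr0n add0r.
  rewrite -(sum_branches tG) mulr_sumr; apply: ler_sum => u uv.
  by exact: (branch_bound2 gr f0 uv (small u uv)).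
move/le_trans/(_ le_e); rewrite -!mulrA ler_pM2l // ler_pM2r //.
exact: total_sq_gt0.
Qed.

(** Equality makes every branch tight, and a tight branch on which [f] is nonzero has [s] interior
    vertices and, from 2 = 1 + p, one leaf. *)
Lemma center_tight v s mu : v \in interior G -> path_ground s 2 mu ->
  (forall u, e u v -> (#|branch_interior u v| <= s)%N) -> l2 <= mu ->
  exists u1 u2, [/\ u1 != u2, e u1 v /\ e u2 v, u1 \in interior G /\ u2 \in interior G,
   #|branch_interior u1 v| = s /\ #|branch_interior u2 v| = s &
   #|branch_leaves u1 v| = 1%N /\ #|branch_leaves u2 v| = 1%N].
Proof.
move=> vI gr small le_l2.
have l2E : l2 = mu by apply: le_anti; rewrite le_l2 (center_bound vI gr small).
have [f [f0 fn0]] := lambda2_ge int2 (1 : R) 0 vI vI.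
rewrite mul1r mul0r addr0 -/l2 l2E => fv le_e eq_e.
have ge_e u : e u v -> 0 <= energy (branch u v) f + 2 * f u ^+ 2 -
    2 * mu * \sum_(x in branch u v) f x ^+ 2.
  by move=> uv; rewrite subr_ge0; exact: (branch_bound2 gr f0 uv (small u uv)).
have sumE : \sum_(u | e u v) (energy (branch u v) f + 2 * f u ^+ 2 -
    2 * mu * \sum_(x in branch u v) f x ^+ 2) = total_energy f - 2 * mu * total_sq f.
  rewrite sumrB -(energy_vertex_split tG fv) -mulr_sumr (sum_branches tG).
  by rewrite /total_sq [in RHS](bigD1 v) //= fv expr0n add0r.
have sum0 : \sum_(u | e u v) (energy (branch u v) f + 2 * f u ^+ 2 -
    2 * mu * \sum_(x in branch u v) f x ^+ 2) = 0.
  by apply: le_anti; rewrite sumr_ge0 // andbT sumE subr_le0.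
have tight u : e u v -> energy (branch u v) f + 2 * f u ^+ 2 <=
    2 * mu * \sum_(x in branch u v) f x ^+ 2.
  move=> uv; move/eqP: sum0; rewrite psumr_eq0 // => /allP/(_ u (mem_index_enum _)).
  by rewrite uv subr_eq0 => /eqP->.
have fu_int u : f u != 0 -> u \in interior G.
  by rewrite /interior in_setC; apply: contra => /f0->.
have btight u : e u v -> (exists2 x, x \in branch u v & f x != 0) ->
    [/\ u \in interior G, f u != 0, #|branch_interior u v| = s & #|branch_leaves u v| = 1%N].
  move=> uv [x xu fx]; have xI := fu_int x fx.
  have uI : u \in interior G.
    rewrite /interior in_setC; apply/negP => uL; move: xu; rewrite leaf_branch // in_set1.
    by move=> /eqP xu; rewrite xu f0 ?eqxx in fx.
  have p1 : 1 <= #|branch_leaves u v|%:R :> R by rewrite ler1n branch_leaves_gt0.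
  have [|||Is yE fI] := @branch_tight R G tG u v uv uI s 2 mu 1 f gr (lexx _) _ (small u uv) f0.
  - by rewrite -[2]/(1 + 1) lerD2l.
  - by exists x => //; rewrite in_setI xu.
  - by rewrite mulr1 -(sum_sq_branch _ _ f0) tight.
  split=> //; first by apply: fI; rewrite in_setI branch_refl.
  by apply/eqP; rewrite -(eqr_nat R); move/eqP: yE; rewrite -[2]/(1 + 1) (inj_eq (addrI _)) eq_sym.
have [x fx] := fn0.
have xv : x != v by apply: contraNneq fx => ->; rewrite fv.
have [u1 u1v xu1] := branch_cover tG xv.
have [u1I fu1 I1 L1] := btight u1 u1v (ex_intro2 _ _ x xu1 fx).
(* This is the eigenvalue equation at [v], where [f] vanishes. One nonzero summand requires another,
   hence a second such branch. *)
have lapv : \sum_(u | e u v) f u = 0.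
  have := eq_e _ v vI; rewrite fv mulr0 /lap => lv.
  have {lv} : \sum_y (e v y)%:R * (f v - f y) = 0.
    by apply: lv; apply/eqP; rewrite -subr_eq0 -sumE sum0.
  move/eqP; rewrite -oppr_eq0 -sumrN => /eqP; apply: etrans; rewrite big_mkcond.
  apply: eq_bigr => y _; rewrite fv sub0r edge_sym.
  by case: (e v y); rewrite ?mul1r ?opprK // mul0r oppr0.
have [u2 /andP[u2v u21] fu2] : exists2 u2, e u2 v && (u2 != u1) & f u2 != 0.
  have [/exists_inP[u2]|/exists_inPn h] := boolP [exists (u2 | e u2 v && (u2 != u1)), f u2 != 0].
    by exists u2.
  move: lapv; rewrite (bigD1 u1) //= big1 ?addr0 => [f10|u2 /h]; last first.
    by rewrite negbK => /eqP.
  by rewrite f10 eqxx in fu1.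
have [u2I _ I2 L2] := btight u2 u2v (ex_intro2 _ _ u2 (branch_refl u2 v) fu2).
by exists u1, u2; rewrite eq_sym.
Qed.

Section EdgeBound.
Variables (u v : G) (t : nat) (a y mu : R).
Hypotheses (uv : e u v) (uI : u \in interior G) (vI : v \in interior G).
Hypotheses (It : (#|branch_interior u v| <= t)%N) (Jt : (#|branch_interior v u| <= t)%N).
Hypotheses (a0 : 0 < a) (gr : path_ground t y mu).
Hypotheses (yu : y = 1 + a + #|branch_leaves u v|%:R).
Hypotheses (yv : y = 1 + a^-1 + #|branch_leaves v u|%:R).
Let vu : e v u. Proof. by rewrite edge_sym. Qed.

Lemma edge_split_weighted f : a * f u + f v = 0 ->
  total_energy f = (energy (branch u v) f + 2 * (1 + a) * f u ^+ 2) +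
                   (energy (branch v u) f + 2 * (1 + a^-1) * f v ^+ 2).
Proof.
move=> fuv; rewrite (energy_edge_split tG f uv).
have -> : f v = - (a * f u) by apply/eqP; rewrite -addr_eq0 addrC fuv.
by field; rewrite gt_eqF.
Qed.

Lemma sum_sq_two f : vanishing f -> total_sq f =
  \sum_(x in branch_interior u v) f x ^+ 2 + \sum_(x in branch_interior v u) f x ^+ 2.
Proof.
move=> f0; rewrite -!sum_sq_branch // /total_sq (bigID (mem (branch u v))) /=.
by congr (_ + _); apply: eq_bigl => x; rewrite (branchC tG uv) in_setC.
Qed.

Let bu f (f0 : vanishing f) :
  2 * mu * \sum_(x in branch_interior u v) f x ^+ 2 <=
  energy (branch u v) f + 2 * (1 + a) * f u ^+ 2.
Proof.
apply: (@branch_bound R G tG u v uv uI t y mu (1 + a) f gr) => //.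
  by rewrite lerDl ltW.
by rewrite yu.
Qed.

Let bv f (f0 : vanishing f) :
  2 * mu * \sum_(x in branch_interior v u) f x ^+ 2 <=
  energy (branch v u) f + 2 * (1 + a^-1) * f v ^+ 2.
Proof.
apply: (@branch_bound R G tG v u vu vI t y mu (1 + a^-1) f gr) => //.
  by rewrite lerDl ltW // invr_gt0.
by rewrite yv.
Qed.

Lemma edge_bound : mu <= l2.
Proof.
have [f [f0 fn0]] := lambda2_ge int2 a 1 uI vI; rewrite mul1r => fuv le_e _.
have : 2 * mu * total_sq f <= total_energy f.
  by rewrite edge_split_weighted // sum_sq_two // mulrDr lerD ?bu ?bv.
move/le_trans/(_ le_e); rewrite -!mulrA ler_pM2l // ler_pM2r //.
exact: total_sq_gt0.
Qed.

Lemma edge_tight : l2 <= mu ->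
  (#|branch_interior u v| = t /\ exists s w, branch_shape u v s w) /\
  (#|branch_interior v u| = t /\ exists s w, branch_shape v u s w).
Proof.
move=> le_l2; have l2E : l2 = mu by apply: le_anti; rewrite le_l2 edge_bound.
have [f [f0 fn0]] := lambda2_ge int2 a 1 uI vI; rewrite mul1r -/l2 l2E => fuv le_e _.
have b1 := bu f0; have b2 := bv f0.
rewrite edge_split_weighted // sum_sq_two // [leRHS]mulrDr in le_e.
have t1 : energy (branch u v) f + 2 * (1 + a) * f u ^+ 2 <=
  2 * mu * \sum_(x in branch_interior u v) f x ^+ 2.
  by rewrite -(lerD2r (energy (branch v u) f + 2 * (1 + a^-1) * f v ^+ 2)) (le_trans le_e) // lerD2l.
have t2 : energy (branch v u) f + 2 * (1 + a^-1) * f v ^+ 2 <=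
  2 * mu * \sum_(x in branch_interior v u) f x ^+ 2.
  by rewrite -(lerD2l (energy (branch u v) f + 2 * (1 + a) * f u ^+ 2)) (le_trans le_e) // lerD2r.
have ai0 : 0 < a^-1 by rewrite invr_gt0.
have a1 : 1 <= 1 + a by rewrite lerDl ltW.
have ai1 : 1 <= 1 + a^-1 by rewrite lerDl ltW.
have p1 : 1 <= #|branch_leaves u v|%:R :> R by rewrite ler1n branch_leaves_gt0.
have y2 : 2 < y by rewrite yu -[2]/(1 + 1) -addrA ltrD2l ltr_pwDl.
have yu' : y <= 1 + a + #|branch_leaves u v|%:R by rewrite yu.
have yv' : y <= 1 + a^-1 + #|branch_leaves v u|%:R by rewrite yv.
have uu : u \in branch_interior u v by rewrite in_setI branch_refl.
have vv : v \in branch_interior v u by rewrite in_setI branch_refl.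
have tu (h : exists2 x, x \in branch_interior u v & f x != 0) :=
  @branch_tight R G tG u v uv uI t y mu (1 + a) f gr a1 yu' It f0 h t1.
have tv (h : exists2 x, x \in branch_interior v u & f x != 0) :=
  @branch_tight R G tG v u vu vI t y mu (1 + a^-1) f gr ai1 yv' Jt f0 h t2.
have fvE : f v = - (a * f u) by apply/eqP; rewrite -addr_eq0 addrC fuv.
have fuv0 : (f v != 0) = (f u != 0) by rewrite fvE oppr_eq0 mulf_eq0 gt_eqF.
(* On a tight side a single nonzero value makes all interior values nonzero, in particular at the
   end of the edge; the linear condition carries this to the other side. *)
have fu0 : f u != 0.
  have [x fx] := fn0; have xI : x \in interior G.
    by rewrite /interior in_setC; apply: contra fx => /f0->.
  have /setP/(_ x) := branchC tG uv; rewrite in_setC.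
  have [xu _|xu xv] := boolP (x \in branch u v).
    have [|_ _ h] := tu; first by exists x; rewrite // in_setI xu.
    exact: h.
  rewrite -fuv0; have [|_ _ h] := tv; first by exists x; rewrite // in_setI xv.
  exact: h.
have hu : exists2 x, x \in branch_interior u v & f x != 0 by exists u.
have hv : exists2 x, x \in branch_interior v u & f x != 0 by exists v; rewrite ?fuv0.
split; split.
- by have [] := tu hu.
- apply: (@branch_tight_shape R G tG u v uv uI t y mu (1 + a) f gr a1 yu' It f0 hu t1) => //.
  by rewrite ltrDl.
- by have [] := tv hv.
apply: (@branch_tight_shape R G tG v u vu vI t y mu (1 + a^-1) f gr ai1 yv' Jt f0 hv t2) => //.
by rewrite ltrDl.
Qed.

End EdgeBound.
End LowerBounds.

(** * Recognizing the extremal trees *)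

Lemma isomorphic_sym G H : isomorphic G H -> isomorphic H G.
Proof.
case=> f [g fK gK] ef; exists g; first by exists f.
by move=> x y; rewrite -{2}(gK x) -{2}(gK y) ef.
Qed.

Lemma connect_hom (S T : finType) (e : rel S) (e' : rel T) (f : S -> T) x y :
  (forall a b, e a b -> e' (f a) (f b)) -> connect e x y -> connect e' (f x) (f y).
Proof.
move=> hf /connectP[p xp ->]; elim: p x xp => //= z p IH x /andP[xz zp].
by apply: connect_trans (connect1 (hf _ _ xz)) (IH z zp).
Qed.

(* A non-edge of [G] mapped to an edge of [H] would close the image of a path
   of [G] into a cycle. *)
Lemma hom_isomorphic (G H : sgraph) (f : G -> H) : connected G -> acyclic H ->
  injective f -> #|G| = #|H| -> (forall x y, edge x y -> edge (f x) (f y)) ->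
  isomorphic G H.
Proof.
move=> cG aH fI cGH hf; exists f; first by apply: inj_card_bij; rewrite ?cGH.
move=> x y; apply/idP/idP => [fxy|]; last exact: hf.
have /connectP[p xp ly] := cG x y; move: ly; case/shortenP: xp => q xq uq _ ly.
case: q xq uq ly => [|z [|a q]] xq uq ly.
- by rewrite ly edge_irrefl in fxy.
- by rewrite ly; case/andP: xq.
case: (@acyclic_no_chord H (f x) (map f [:: z, a & q])) => //.
- by rewrite (path_map (e' := @edge H)); apply: sub_path xq => b c; apply: hf.
- by rewrite -map_cons map_inj_uniq.
by rewrite last_map -ly edge_sym.
Qed.

Lemma path_rel_nth (T : eqType) (e : rel T) x0 (s : seq T) n (i j : 'I_n) :
  symmetric e -> size s = n -> sorted e s -> path_rel i j -> e (nth x0 s i) (nth x0 s j).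
Proof.
move=> se sn /(sortedP x0) ss /orP[] /eqP ij; last rewrite se.
  by rewrite -ij ss // ij sn.
by rewrite -ij ss // ij sn.
Qed.

Section ShapeHom.
Variables (G : sgraph) (u v : G) (s : seq G) (w : G).
Notation e := (@edge G).
Hypotheses (sh : branch_shape u v s w).
Let t := #|branch_interior u v|.
Let p := #|branch_leaves u v|.

Lemma shape_size : size (u :: s) = t.
Proof.
have [_ us sI Is _] := sh; rewrite -(card_uniqP us); apply: eq_card => x.
by apply/idP/idP => [/sI|/Is].
Qed.

(** Edges need to be preserved in one direction only; counting vertices in a tree does the rest. *)
Lemma shape_hom : exists h : C_graph t p -> G,
  [/\ injective h, forall x y, edge x y -> edge (h x) (h y),
      forall x, h x \in branch u v & h (C_v1 t p) = u].
Proof.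
have st := shape_size; have [us uus sI Is [wL lw oth]] := sh.
have t0 : t.-1.+1 = t by rewrite -st.
pose D := enum (branch_leaves u v :\ w).
have sD : size D = p.-1.
  by rewrite -cardE /p (cardsD1 w (branch_leaves u v)) wL.
have DL x : x \in D -> [/\ x \in branch_leaves u v, x != w & e x u].
  by rewrite mem_enum in_setD1 => /andP[xw xL]; split=> //; apply: oth.
pose h (x : C_graph t p) : G := match x with
  | inl (inl i) => nth u (u :: s) i
  | inl (inr j) => nth u D j
  | inr _ => w end.
have hl (i : 'I_t.-1.+1) : (i < size (u :: s))%N by rewrite st -[X in (_ < X)%N]t0.
have hd (j : 'I_p.-1) : (j < size D)%N by rewrite sD.
have hi (i : 'I_t.-1.+1) : nth u (u :: s) i \in branch_interior u v.
  by apply: sI; rewrite mem_nth.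
have hj (j : 'I_p.-1) : nth u D j \in D by rewrite mem_nth.
have notI x : x \in branch_leaves u v -> x \notin branch_interior u v.
  by rewrite !in_setI /interior in_setC => /andP[_ ->]; rewrite andbF.
have h1 (i : 'I_t.-1.+1) (j : 'I_p.-1) : nth u D j <> nth u (u :: s) i :> G.
  move=> E; have [L _ _] := DL _ (hj j); have := notI _ L.
  by rewrite E hi.
have h2 (i : 'I_t.-1.+1) : w <> nth u (u :: s) i.
  by move=> E; have := notI _ wL; rewrite E hi.
have h3 (j : 'I_p.-1) : w <> nth u D j.
  by move=> E; have [_ /eqP] := DL _ (hj j); case.
exists h; split.
- move=> [[i|j]|k] [[i'|j']|k'] /= E.
  + do 2!congr inl; apply: val_inj.
    by move/eqP: E; rewrite (nth_uniq u (hl i) (hl i') uus) => /eqP.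
  + by case: (h1 i j').
  + by case: (h2 i).
  + by case: (h1 i' j).
  + congr (inl (inr _)); apply: val_inj.
    by move/eqP: E; rewrite (nth_uniq u (hd j) (hd j') (enum_uniq _)) => /eqP.
  + by case: (h3 j).
  + by case: (h2 i').
  + by case: (h3 j').
  + by rewrite !ord1.
- have adj (i : 'I_t.-1.+1) (j : 'I_p.-1) : i == C_first t -> e (nth u (u :: s) i) (nth u D j).
    move=> /eqP->; have [_ _] := DL _ (hj j).
    by rewrite edge_sym.
  have adjw (x : attach_leaves (C_first t) p.-1) : x == inl (C_last t) -> e (h (inl x)) w.
    move=> /eqP-> /=; suff -> : nth u (u :: s) t.-1 = last u s by [].
    by rewrite (last_nth u) -st.
  move=> [[i|j]|k] [[i'|j']|k'] //=.
  + by apply: path_rel_nth => //; [exact: edge_sym | rewrite st].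
  + exact: adj.
  + exact: adjw.
  + by rewrite edge_sym; apply: adj.
  + by rewrite edge_sym; apply: adjw.
- move=> [[i|j]|k] /=.
  + by have := hi i; rewrite in_setI => /andP[].
  + by have [L _ _] := DL _ (hj j); move: L; rewrite in_setI => /andP[].
  + by move: wL; rewrite in_setI => /andP[].
by [].
Qed.

End ShapeHom.

Lemma card_attach (G : sgraph) (v : G) m : #|attach_leaves v m| = (#|G| + m)%N.
Proof. by rewrite card_sum card_ord. Qed.

Lemma card_C s q : (0 < s)%N -> (0 < q)%N -> #|C_graph s q| = (s + q)%N.
Proof. by move=> s0 q0; rewrite !card_attach card_ord; lia. Qed.

Lemma card_join_C s q s' q' : (0 < s)%N -> (0 < q)%N -> (0 < s')%N -> (0 < q')%N ->
  #|join_C s q s' q'| = (s + q + (s' + q'))%N.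
Proof. by move=> *; rewrite card_sum !card_C. Qed.

Lemma cards_leaves_interior (G : sgraph) : (#|interior G| + #|leaves G| = #|G|)%N.
Proof. by rewrite addnC cardsC. Qed.

Lemma shapes_join_C (G : sgraph) (u v : G) s w s' w' : is_tree G -> edge u v ->
  branch_shape u v s w -> branch_shape v u s' w' ->
  connected (join_C #|branch_interior u v| #|branch_leaves u v|
                    #|branch_interior v u| #|branch_leaves v u|) ->
  isomorphic G (join_C #|branch_interior u v| #|branch_leaves u v|
                       #|branch_interior v u| #|branch_leaves v u|).
Proof.
move=> tG uv sh sh' conn; apply: isomorphic_sym.
have [h [hI he hX hu]] := shape_hom sh; have [h' [hI' he' hX' hu']] := shape_hom sh'.
have BC := branchC tG uv.
have sep x y : h x <> h' y.
  by move=> E; have := hX' y; rewrite -E BC in_setC hX.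
pose k (x : join_C #|branch_interior u v| #|branch_leaves u v|
    #|branch_interior v u| #|branch_leaves v u|) : G := match x with inl a => h a | inr b => h' b end.
apply: (hom_isomorphic (f := k)) => //.
- by case: tG.
- move=> [a|a] [b|b] /= E; rewrite ?(hI _ _ E) ?(hI' _ _ E) //.
    by case: (sep a b).
  by case: (sep b a).
- have pos (x y : G) z r : branch_shape x y z r -> (0 < #|branch_interior x y|)%N /\ (0 < #|branch_leaves x y|)%N.
    by move=> [_ _ sI _ [rL _ _]]; split; apply/card_gt0P; [exists x; apply: sI; rewrite mem_head | exists r].
  have [p1 p2] := pos _ _ _ _ sh; have [p3 p4] := pos _ _ _ _ sh'.
  rewrite card_join_C // -(cards_leaves_interior G).
  rewrite -(cardsID (branch u v) (interior G)) -(cardsID (branch u v) (leaves G)).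
  rewrite /branch_interior /branch_leaves BC !setDE.
  rewrite ![_ :&: interior G]setIC ![_ :&: leaves G]setIC.
  by set a := #|_|; set b := #|_|; set c := #|_|; set d := #|_|; lia.
move=> [a|a] [b|b] /=; [exact: he| | |exact: he'].
  by move=> /andP[/eqP-> /eqP->]; rewrite hu hu'.
by move=> /andP[/eqP-> /eqP->]; rewrite hu hu' edge_sym.
Qed.

Lemma sorted_two_arms (T : Type) (e : rel T) v p q : symmetric e ->
  path e v p -> path e v q -> sorted e (rev p ++ v :: q).
Proof.
move=> se; elim: p v q => [|a p IH] v q //= /andP[va ap] vq.
by rewrite rev_cons cat_rcons; apply: IH => //=; rewrite se va.
Qed.

Section CenterIso.
Variables (G : sgraph) (v u1 u2 : G) (s1 s2 : seq G) (w1 w2 : G) (t : nat).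
Notation e := (@edge G).
Hypothesis tG : is_tree G.
Hypotheses (vI : v \in interior G) (u12 : u1 != u2) (u1v : e u1 v) (u2v : e u2 v).
Hypotheses (sh1 : branch_shape u1 v s1 w1) (sh2 : branch_shape u2 v s2 w2).
Hypotheses (I1 : #|branch_interior u1 v| = t) (I2 : #|branch_interior u2 v| = t).
Hypotheses (L1 : #|branch_leaves u1 v| = 1%N) (L2 : #|branch_leaves u2 v| = 1%N).
Hypothesis kG : #|interior G| = (2 * t + 1)%N.

Lemma two_branches_disjoint x : x \in branch u1 v -> x \in branch u2 v -> False.
Proof. by move=> x1 x2; move: u12; rewrite (branch_disjoint tG u1v u2v x1 x2) eqxx. Qed.

(** The vertex [v] and the two branches already account for 1 + t + t interior vertices. *)
Lemma center_interior_cover x : x \in interior G -> x != v ->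
  (x \in branch u1 v) || (x \in branch u2 v).
Proof.
move=> xI xv; pose A := v |: branch_interior u1 v :|: branch_interior u2 v.
have AI : A \subset interior G.
  apply/subsetP => z; rewrite !in_setU in_set1 !in_setI => /orP[/orP[/eqP->//|]|] /andP[] //.
have vB u : e u v -> v \notin branch u v.
  by move=> uv; apply/negP => /(branch_neq (edge_neq uv)); rewrite eqxx.
have cA : #|A| = #|interior G|.
  rewrite kG /A cardsU cardsU1 I1 I2 in_setI (negbTE (vB _ u1v)) /=.
  rewrite (_ : _ :&: _ = set0) ?cards0; first by clear; lia.
  apply/setP => z; rewrite in_set0 in_setI in_setU in_set1 !in_setI.
  apply/negP => /andP[/orP[/eqP->|/andP[z1 _]] /andP[z2 _]].
    by have := vB _ u2v; rewrite z2.
  exact: two_branches_disjoint z1 z2.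
have : x \in A by have /eqP -> : A == interior G by rewrite eqEcard AI cA leqnn.
rewrite !in_setU in_set1 (negbTE xv) /= !in_setI.
by move=> /orP[] /andP[-> _]; rewrite ?orbT.
Qed.

(** The root of the branch containing [x] is either [x] itself or an interior neighbour of [v], thus
    [u1] or [u2], whose branches have no further leaf. *)
Lemma center_other_leaf x : x \in leaves G -> x != w1 -> x != w2 -> e x v.
Proof.
move=> xL xw1 xw2; have xv : x != v.
  by apply: contraTneq xL => ->; move: vI; rewrite /interior in_setC.
have only u s w : branch_shape u v s w -> #|branch_leaves u v| = 1%N ->
    x \in branch u v -> x = w.
  move=> [_ _ _ _ [wL _ _]] /eqP /cards1P[a La] xu.
  have : x \in branch_leaves u v by rewrite in_setI xu.
  by move: (wL : w \in branch_leaves u v); rewrite La !in_set1 => /eqP-> /eqP->.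
have [u uv xu] := branch_cover tG xv.
have [uL|uI] := boolP (u \in leaves G).
  by move: xu; rewrite (leaf_branch uv uL) in_set1 => /eqP->.
have uI' : u \in interior G by rewrite /interior in_setC.
have /orP[ub|ub] := center_interior_cover uI' (edge_neq uv).
  have uu1 := branch_disjoint tG uv u1v (branch_refl u v) ub; subst u.
  by rewrite (only _ _ _ sh1 L1 xu) eqxx in xw1.
have uu2 := branch_disjoint tG uv u2v (branch_refl u v) ub; subst u.
by rewrite (only _ _ _ sh2 L2 xu) eqxx in xw2.
Qed.

Let m := (#|leaves G| - 2)%N.

Lemma center_iso : connected (path_with_center_leaves t m) ->
  isomorphic G (path_with_center_leaves t m).
Proof.
move=> conn; apply: isomorphic_sym.
have [us1 uus1 sI1 Is1 [wL1 lw1 _]] := sh1.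
have [us2 uus2 sI2 Is2 [wL2 lw2 _]] := sh2.
have sz1 := shape_size sh1; have sz2 := shape_size sh2.
rewrite -/(branch_interior u1 v) I1 in sz1; rewrite -/(branch_interior u2 v) I2 in sz2.
have lI x : x \in leaves G -> x \notin interior G.
  by rewrite /interior in_setC negbK.
have w1L : w1 \in leaves G by move: wL1; rewrite in_setI => /andP[].
have w2L : w2 \in leaves G by move: wL2; rewrite in_setI => /andP[].
pose Q1 := u1 :: rcons s1 w1; pose Q2 := u2 :: rcons s2 w2.
pose P := rev Q1 ++ v :: Q2.
have arm u s w : e u v -> branch_shape u v s w ->
    {subset u :: rcons s w <= branch u v} /\ uniq (u :: rcons s w).
  move=> uv [_ us sI _ [wL _ _]]; split.
    move=> x; rewrite -rcons_cons mem_rcons inE => /orP[/eqP->|/sI].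
      by move: wL; rewrite in_setI => /andP[].
    by rewrite in_setI => /andP[].
  rewrite -rcons_cons rcons_uniq us andbT; apply/negP => /sI; rewrite in_setI.
  by move: wL; rewrite in_setI => /andP[_ wL]; rewrite (negbTE (lI _ wL)) andbF.
have [QB1 uQ1] := arm _ _ _ u1v sh1; have [QB2 uQ2] := arm _ _ _ u2v sh2.
have vB u : e u v -> v \notin branch u v.
  by move=> uv; apply/negP => /(branch_neq (edge_neq uv)); rewrite eqxx.
have sP : sorted e P.
  apply: sorted_two_arms; first exact: edge_sym.
    by rewrite /Q1 /= edge_sym u1v rcons_path us1.
  by rewrite /Q2 /= edge_sym u2v rcons_path us2.
have uP : uniq P.
  rewrite /P cat_uniq rev_uniq uQ1 andTb; apply/andP; split; last first.
    by rewrite cons_uniq uQ2 andbT; apply/negP => /QB2; rewrite (negbTE (vB _ u2v)).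
  apply/hasPn => x; rewrite inE mem_rev => /orP[/eqP->|xQ2].
    by apply/negP => /QB1; rewrite (negbTE (vB _ u1v)).
  by apply/negP => /QB1 x1; exact: two_branches_disjoint x1 (QB2 _ xQ2).
have szP : size P = ((2 * t + 2).+1)%N.
  have arith a b c : a.+1 = c -> b.+1 = c -> (a.+2 + b.+3 = (2 * c + 2).+1)%N.
    by clear; lia.
  rewrite size_cat size_rev [size Q1]/= [size (v :: Q2)]/= !size_rcons.
  exact: arith sz1 sz2.
have Pc : nth v P t.+1 = v.
  rewrite nth_cat size_rev /Q1 /= size_rcons; move: sz1 => /= ->.
  by rewrite ltnn subnn.
pose D := enum (leaves G :\ w1 :\ w2).
have w12 : w2 != w1.
  apply: contraTneq wL2 => ->; rewrite in_setI negb_and; apply/orP; left.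
  by move: wL1; rewrite in_setI => /andP[x1 _]; apply/negP => /(two_branches_disjoint x1).
have sD : size D = m.
  rewrite -cardE /m (cardsD1 w1 (leaves G)) w1L (cardsD1 w2 (leaves G :\ w1)).
  by rewrite in_setD1 w2L w12 addnA addKn.
have DP x : x \in D -> x \in leaves G /\ x \notin P.
  rewrite mem_enum !in_setD1 => /and3P[xw2 xw1 xL]; split=> //.
  have notin u s w : branch_shape u v s w -> x != w -> x \notin u :: rcons s w.
    move=> [_ _ sI _ _] xw; rewrite -rcons_cons mem_rcons inE negb_or xw /=.
    by apply/negP => /sI; rewrite in_setI (negbTE (lI _ xL)) andbF.
  have n1 : x \notin Q1 := notin _ _ _ sh1 xw1.
  have n2 : x \notin Q2 := notin _ _ _ sh2 xw2.
  rewrite mem_cat mem_rev negb_or n1 andTb in_cons negb_or n2 andbT.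
  by apply: contraTneq xL => ->; move: vI; rewrite /interior in_setC.
have De x : x \in D -> e x v.
  rewrite mem_enum !in_setD1 => /and3P[xw2 xw1 xL]; exact: center_other_leaf.
pose h (x : path_with_center_leaves t m) : G := match x with
  | inl i => nth v P i
  | inr j => nth v D j end.
have hP (i : 'I_(2 * t + 2).+1) : (i < size P)%N by rewrite szP.
have hD (j : 'I_m) : (j < size D)%N by rewrite sD.
have sep (i : 'I_(2 * t + 2).+1) (j : 'I_m) : nth v P i <> nth v D j.
  move=> E; have [_] := DP _ (mem_nth v (hD j)).
  by rewrite -E mem_nth.
apply: (hom_isomorphic (f := h)) => //.
- by case: tG.
- move=> [i|j] [i'|j'] /= E.
  + by congr inl; apply: val_inj; move/eqP: E; rewrite nth_uniq // => /eqP.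
  + by case: (sep i j').
  + by case: (sep i' j).
  + congr inr; apply: val_inj; move/eqP: E.
    by rewrite (nth_uniq v (hD j) (hD j') (enum_uniq _)) => /eqP.
- rewrite card_attach card_ord -(cards_leaves_interior G) kG /m.
  have : (1 < #|leaves G|)%N.
    by rewrite (cardsD1 w1 (leaves G)) w1L (cardsD1 w2 (leaves G :\ w1)) in_setD1 w2L w12.
  by clear; lia.
have adj (i : 'I_(2 * t + 2).+1) (j : 'I_m) : i == path_center t -> e (nth v P i) (nth v D j).
  move=> /eqP->; rewrite inordK; last by clear; lia.
  by rewrite Pc edge_sym De // mem_nth.
move=> [i|j] [i'|j'] //=.
- by apply: path_rel_nth => //; exact: edge_sym.
- exact: adj.
by rewrite edge_sym; apply: adj.
Qed.

End CenterIso.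

(** * The extremal trees belong to the class *)

Section Ranked.

(* Ranks that increase away from a root. *)
Definition ranked (G : sgraph) (r : G -> nat) := forall x y z : G,
  edge x y -> edge x z -> (r y <= r x)%N -> (r z <= r x)%N -> y = z.

(** A vertex of largest rank on a cycle would have two distinct neighbours of no larger rank. *)
Lemma ranked_acyclic (G : sgraph) (r : G -> nat) : ranked r -> acyclic G.
Proof.
move=> rk c sc uc; have [x0 xc0] : exists x, x \in c.
  by case: c sc uc => // x c _ _; exists x; rewrite mem_head.
have [x xc xmax] := arg_maxnP r xc0.
have [i c' ec] := rot_to (xc : x \in c).
have {}xmax y : y \in x :: c' -> (r y <= r x)%N.
  by rewrite -ec mem_rot => yc; apply: xmax.
have {uc} : ucycle (@edge G) (x :: c') by rewrite -ec rot_ucycle.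
have {sc} : (2 < size (x :: c'))%N by rewrite -ec size_rot.
case: c' {ec} xmax => [|a c'] xmax //; case/lastP: c' xmax => // m b xmax _.
rewrite /ucycle /= !rcons_path !last_rcons => /andP[/and3P[xa _ bx] /and3P[_ + _]].
rewrite edge_sym in bx.
suff -> : a = b by rewrite mem_rcons mem_head.
by apply: rk xa bx _ _; apply: xmax; rewrite !inE ?mem_rcons ?mem_head ?eqxx ?orbT.
Qed.

Lemma path_graph_ranked n : ranked (fun i : path_graph n => val i).
Proof.
move=> i j k /orP[] /eqP ij /orP[] /eqP ik; rewrite -1?ij -1?ik /= => h1 h2; apply: val_inj => /=; move: ij ik h1 h2; clear; lia.
Qed.

Lemma attach_ranked (G : sgraph) (v : G) m r : ranked r ->
  ranked (fun x : attach_leaves v m => match x with inl a => r a | inr _ => (r v).+1 end).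
Proof.
move=> rk [x|i] [y|j] [z|k] //=.
- by move=> xy xz h1 h2; congr inl; apply: rk xy xz h1 h2.
- by move=> _ /eqP-> _; rewrite ltnn.
- by move=> /eqP-> _; rewrite ltnn.
- by move=> /eqP-> _; rewrite ltnn.
- by move=> /eqP-> /eqP->.
Qed.

(** The ranks of [H] are lifted above [r u]. As [v] is strictly below its neighbours in [H], the
    only neighbour of [v] not above it in the join is [u]. *)
Lemma join_ranked (G H : sgraph) (u : G) (v : H) r r' : ranked r -> ranked r' ->
  (forall y, edge v y -> (r' v < r' y)%N) ->
  ranked (fun x : join_by_edge u v =>
    match x with inl a => r a | inr b => (r u + r' b).+1 end).
Proof.
move=> rk rk' rv [x|x] [y|y] [z|z] //=.
- by move=> xy xz h1 h2; congr inl; apply: rk xy xz h1 h2.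
- by move=> _ /andP[/eqP-> _] _; rewrite ltnNge leq_addr.
- by move=> /andP[/eqP-> _] _; rewrite ltnNge leq_addr.
- by move=> /andP[/eqP-> /eqP->] /andP[_ /eqP->].
- by move=> /andP[/eqP-> _] /andP[/eqP-> _].
- by move=> /andP[/eqP-> /eqP->] /rv vz _; rewrite ltnS leq_add2l leqNgt vz.
- by move=> xy /andP[_ /eqP xv]; move: xy; rewrite xv => /rv vy; rewrite ltnS leq_add2l leqNgt vy.
by move=> xy xz; rewrite !ltnS !leq_add2l => h1 h2; congr inr; apply: rk' xy xz h1 h2.
Qed.

End Ranked.

Lemma hub_connected (G : sgraph) (x0 : G) :
  (forall x, connect (@edge G) x0 x) -> connected G.
Proof.
move=> h x y; apply: connect_trans (h y).
by rewrite (sym_connect_sym (@edge_sym G)).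
Qed.

Lemma path_graph_connected n : connected (path_graph n.+1).
Proof.
apply: (@hub_connected _ (ord0 : path_graph n.+1)) => -[i hi].
elim: i hi => [|i IH] hi; first by rewrite (_ : Ordinal hi = ord0) ?connect0 //; apply: val_inj.
apply: connect_trans (IH (ltnW hi)) (connect1 _).
by rewrite /= /path_rel /= eqxx.
Qed.

Lemma attach_connected (G : sgraph) (v : G) m : connected G -> connected (attach_leaves v m).
Proof.
move=> cG; apply: (@hub_connected _ (inl v : attach_leaves v m)) => -[x|i].
  by apply: (connect_hom (f := inl)) (cG v x).
by apply: connect1; rewrite /= eqxx.
Qed.

Lemma join_connected (G H : sgraph) (u : G) (v : H) :
  connected G -> connected H -> connected (join_by_edge u v).
Proof.
move=> cG cH; apply: (@hub_connected _ (inl u : join_by_edge u v)) => -[x|x].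
  by apply: (connect_hom (f := inl)) (cG u x).
apply: (@connect_trans _ _ (inr v)); first by apply: connect1; rewrite /= !eqxx.
by apply: (connect_hom (f := inr)) (cH v x).
Qed.

Lemma C_connected s q : connected (C_graph s q).
Proof. by do 2!apply: attach_connected; apply: path_graph_connected. Qed.

Lemma join_C_connected s q s' q' : connected (join_C s q s' q').
Proof. by apply: join_connected; apply: C_connected. Qed.

(** The distance from v_1. *)
Definition C_rank s q (x : C_graph s q) : nat := match x with
  | inl (inl i) => val i
  | inl (inr _) => 1%N
  | inr _ => s.-1.+1 end.

Lemma C_ranked s q : ranked (@C_rank s q).
Proof.
have := attach_ranked (v := inl (C_last s) : attach_leaves (C_first s) q.-1) (m := 1) (attach_ranked (v := C_first s) (m := q.-1) (@path_graph_ranked s.-1.+1)).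
move=> rk x y z xy xz h1 h2; apply: (rk x y z xy xz).
  by case: x y {xy xz h2} h1 => [[?|?]|?] [[?|?]|?].
by case: x z {xy xz h1} h2 => [[?|?]|?] [[?|?]|?].
Qed.

Lemma C_rank_root s q y : edge (C_v1 s q) y -> (C_rank (C_v1 s q) < C_rank y)%N.
Proof. by case: y => [[y|y]|y] //= /orP[] /eqP // <-. Qed.

Lemma join_C_tree s q s' q' : is_tree (join_C s q s' q').
Proof.
split; last 1 first.
- exact: ranked_acyclic (join_ranked (@C_ranked s q) (@C_ranked s' q') (@C_rank_root s' q')).
- by apply/card_gt0P; exists (inl (C_v1 s q)).
exact: join_C_connected.
Qed.

Lemma path_with_center_leaves_tree t m : is_tree (path_with_center_leaves t m).
Proof.
split; last 1 first.
- exact: ranked_acyclic (attach_ranked (v := path_center t) (m := m) (@path_graph_ranked (2 * t + 2).+1)).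
- by apply/card_gt0P; exists (inl (path_center t)).
by apply: attach_connected; apply: path_graph_connected.
Qed.

Lemma leaf_of_unique_neighbor (G : sgraph) (x y : G) : edge x y ->
  (forall z, edge x z -> z = y) -> x \in leaves G.
Proof.
move=> xy h; rewrite inE; apply/cards1P; exists y; apply/setP => z; rewrite !inE.
by apply/idP/eqP => [/h|->].
Qed.

Lemma card_sum_pred (S T : finType) (P : pred (S + T)) :
  #|P| = (#|[pred x | P (inl x)]| + #|[pred y | P (inr y)]|)%N.
Proof. by rewrite -!sum1_card big_sumType. Qed.

Definition C_on_path s q (x : C_graph s q) : bool :=
  if x is inl (inl _) then true else false.

Lemma C_up_neighbor s q (i : C_path s) (x := inl (inl i) : C_graph s q) :
  exists2 y, edge x y & (C_rank x < C_rank y)%N.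
Proof.
have := ltn_ord i; rewrite leq_eqVlt => /orP[/eqP it|iS]; last first.
  by exists (inl (inl (Ordinal iS))); rewrite //= /path_rel /= eqxx.
have -> : x = inl (inl (C_last s)) by do 2!congr inl; apply: val_inj; case: it.
by exists (inr ord0); rewrite //= eqxx.
Qed.

Lemma C_down_neighbor s q (i : C_path s) (x := inl (inl i) : C_graph s q) :
  i != C_first s -> exists2 y, edge x y & (C_rank y < C_rank x)%N.
Proof.
case: i @x => -[|i] hi x i0; first by case/eqP: i0; apply: val_inj.
by exists (inl (inl (Ordinal (ltnW hi)))); rewrite //= /path_rel /= eqxx orbT.
Qed.

Lemma C_off_path_neighbor s q (x : C_graph s q) : ~~ C_on_path x ->
  exists2 y, edge x y & forall z, edge x z -> z = y.
Proof.
case: x => [[i|j]|k] //= _.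
  exists (inl (inl (C_first s))); first by rewrite /= eqxx.
  by move=> [[i|j']|k] //= /eqP->.
exists (inl (inl (C_last s))); first by rewrite /= eqxx.
by move=> [z|k'] //= /eqP->.
Qed.

Definition join_C_on_path s q s' q' (x : join_C s q s' q') : bool :=
  match x with inl y => C_on_path y | inr y => C_on_path y end.

(** A path vertex has a neighbour of larger rank, possibly the end leaf, and another one of smaller
    rank or, for v_1, in the other copy. *)
Lemma join_C_interior s q s' q' (x : join_C s q s' q') :
  (x \in interior (join_C s q s' q')) = join_C_on_path x.
Proof.
apply/idP/idP => [|]; last first.
  case: x => [[[i|i]|i]|[[i|i]|i]] //= _.
  - have [y xy ry] := C_up_neighbor q i; have [i0|i0] := eqVneq i (C_first s).
      rewrite i0 in xy *; apply: (@interior_two_neighbors (join_C s q s' q') _ (inl y) (inr (C_v1 s' q'))) => //=.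
    have [z xz rz] := C_down_neighbor q i0.
    apply: (@interior_two_neighbors (join_C s q s' q') _ (inl y) (inl z)) => //=.
    by apply/eqP => -[yz]; move: ry rz; rewrite yz => /ltnW; rewrite leqNgt => /negbTE->.
  have [y xy ry] := C_up_neighbor q' i; have [i0|i0] := eqVneq i (C_first s').
    rewrite i0 in xy *; apply: (@interior_two_neighbors (join_C s q s' q') _ (inr y) (inl (C_v1 s q))) => //=.

  have [z xz rz] := C_down_neighbor q' i0.
  apply: (@interior_two_neighbors (join_C s q s' q') _ (inr y) (inr z)) => //=.
  by apply/eqP => -[yz]; move: ry rz; rewrite yz => /ltnW; rewrite leqNgt => /negbTE->.
apply: contraTT => off; rewrite /interior in_setC negbK.
case: x off => x off; have [y xy uy] := C_off_path_neighbor off.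
  apply: (@leaf_of_unique_neighbor (join_C s q s' q') _ (inl y)) => // -[z|z] /=.
    by move/uy->.
  by move=> /andP[/eqP xE _]; rewrite xE in off.
apply: (@leaf_of_unique_neighbor (join_C s q s' q') _ (inr y)) => // -[z|z] /=.
  by move=> /andP[_ /eqP xE]; rewrite xE in off.
by move/uy->.
Qed.

Lemma card_C_on_path s q : #|[pred x | @C_on_path s q x]| = s.-1.+1.
Proof.
rewrite !card_sum_pred (eq_card (B := predT)) // card_ord.
by rewrite !eq_card0 ?addn0.
Qed.

Lemma join_C_class s q s' q' : (0 < s)%N -> (0 < q)%N -> (0 < s')%N -> (0 < q')%N ->
  tree_class (s + s') (q + q') (join_C s q s' q').
Proof.
move=> s0 q0 s0' q0'; have cI : #|interior (join_C s q s' q')| = (s + s')%N.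
  rewrite (eq_card (@join_C_interior s q s' q')) card_sum_pred.
  congr (_ + _)%N; first exact: etrans (card_C_on_path s q) (prednK s0).
  exact: etrans (card_C_on_path s' q') (prednK s0').
split=> //; first exact: join_C_tree.
have := cards_leaves_interior (join_C s q s' q'); rewrite cI card_join_C //.
by set a := #|_|; move: a => a; clear; lia.
Qed.

Section PathWithCenterLeaves.
Variables t m : nat.
Hypothesis t0 : (0 < t)%N.
Notation T := (path_with_center_leaves t m).

Definition center_interior (x : T) : bool :=
  if x is inl i then (0 < i < 2 * t + 2)%N else false.

Lemma path_with_center_leaves_interior x : (x \in interior T) = center_interior x.
Proof.
apply/idP/idP => [|]; last first.
  case: x => [[i hi]|i] //= /andP[i0 i2].
  have h1 : (i.-1 < (2 * t + 2).+1)%N by move: hi; clear; lia.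
  have h2 : (i.+1 < (2 * t + 2).+1)%N by [].
  apply: (@interior_two_neighbors T _ (inl (Ordinal h1)) (inl (Ordinal h2))) => /=.
  - by rewrite /path_rel /= prednK // eqxx orbT.
  - by rewrite /path_rel /= eqxx.
  by apply/eqP => -[]; move: i0; clear; lia.
apply: contraTT; rewrite /interior in_setC negbK.
have cE : val (path_center t) = t.+1 by rewrite /= inordK //; clear; lia.
case: x => [[i hi]|j] /= off.
  have notc : Ordinal hi != path_center t.
    apply/eqP => /(congr1 val); rewrite cE /= => iE; move: off t0; rewrite iE; clear; lia.
  have [i0|i0] := posnP i.
    have h1 : (1 < (2 * t + 2).+1)%N by clear; lia.
    apply: (@leaf_of_unique_neighbor T _ (inl (Ordinal h1))) => /=.
      by rewrite /path_rel /= i0.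
    move=> [[k hk]|k] /=; last by rewrite (negbTE notc).
    rewrite /path_rel /= i0 => /orP[] /eqP // kE; congr inl; exact: val_inj.
  have h1 : (2 * t + 1 < (2 * t + 2).+1)%N by clear; lia.
  apply: (@leaf_of_unique_neighbor T _ (inl (Ordinal h1))) => /=.
    by rewrite /path_rel /=; apply/orP; right; apply/eqP; move: (hi) i0 off; clear; lia.
  move=> [[k hk]|k] /=; last by rewrite (negbTE notc).
  rewrite /path_rel /= => h; congr inl; apply: val_inj => /=.
  by move: h (hi) (hk) i0 off; clear; lia.
apply: (@leaf_of_unique_neighbor T _ (inl (path_center t))) => /=; first by rewrite eqxx.
by move=> [k|k] //= /eqP->.
Qed.

Lemma path_with_center_leaves_class : tree_class (2 * t + 1) (m + 2) T.
Proof.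
have cI : #|interior T| = (2 * t + 1)%N.
  rewrite (eq_card path_with_center_leaves_interior) card_sum_pred.
  rewrite [X in (_ + X)%N]eq_card0 // addn0.
  pose f (i : 'I_(2 * t + 1)) : 'I_(2 * t + 2).+1 := inord i.+1.
  have fE i : f i = i.+1 :> nat.
    by rewrite inordK //; have := ltn_ord i; move: (val i) => a; clear; lia.
  have fI : injective f.
    by move=> i j /(congr1 (@nat_of_ord _)); rewrite !fE => -[]; apply: val_inj.
  rewrite -[RHS](card_ord (2 * t + 1)) -cardsT -(card_imset setT fI).
  apply: eq_card => i; apply/idP/imsetP => [|[k _ ->]].
    rewrite inE /= => /andP[i0 i2]; have h : (i.-1 < 2 * t + 1)%N by move: i0 i2; clear; lia.
    by exists (Ordinal h) => //; apply: ord_inj; rewrite fE /= prednK.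
  rewrite inE /= fE; have := ltn_ord k; move: (val k) => a; clear; lia.
split=> //; first exact: path_with_center_leaves_tree.
have := cards_leaves_interior T; rewrite cI card_attach card_ord.
by set a := #|_|; move: a => a; clear; lia.
Qed.

End PathWithCenterLeaves.

(** * Bounds over the class of trees *)

Section IsoTransport.
Variables (G H : sgraph) (h : G -> H).
Hypotheses (bij : bijective h) (he : forall x y, edge (h x) (h y) = edge x y).

Lemma iso_degree x : degree (h x) = degree x.
Proof.
rewrite /degree -(card_imset _ (bij_inj bij)); apply: eq_card => y.
case: (bij) => g hg gh; apply/idP/imsetP => [|[z]]; rewrite inE.
  by rewrite -{1}(gh y) he => xy; exists (g y); rewrite ?inE.
by move=> xz ->; rewrite inE he.
Qed.

Lemma iso_leaf x : (h x \in leaves H) = (x \in leaves G).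
Proof. by rewrite !inE iso_degree. Qed.

Lemma iso_acyclic : acyclic H -> acyclic G.
Proof.
move=> ac c sc /andP[cc uc]; apply: (ac (map h c)); first by rewrite size_map.
rewrite /ucycle map_inj_uniq ?uc ?andbT; last exact: bij_inj.
by apply: homo_cycle cc => a b ab; rewrite he.
Qed.

Lemma iso_connected : connected H -> connected G.
Proof.
case: (bij) => g hg gh cH x y; rewrite -(hg x) -(hg y).
by apply: connect_hom (cH (h x) (h y)) => a b; rewrite -{1}(gh a) -{1}(gh b) he.
Qed.

Lemma iso_card_leaves : #|leaves G| = #|leaves H|.
Proof.
rewrite -(card_imset _ (bij_inj bij)); apply: eq_card => y.
case: (bij) => g hg gh; apply/imsetP/idP => [[x xL ->]|yL]; first by rewrite iso_leaf.
by exists (g y); rewrite ?gh // -iso_leaf gh.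
Qed.

End IsoTransport.

Lemma isomorphic_tree_class (G H : sgraph) k b :
  isomorphic G H -> tree_class k b H -> tree_class k b G.
Proof.
case=> h bij he [[H0 cH aH] kH bH].
have cG : #|G| = #|H| := bij_eq_card bij.
have lG := iso_card_leaves bij he.
split; last by rewrite lG.
  split; [by rewrite cG | exact: iso_connected bij he cH | exact: iso_acyclic bij he aH].
have := cards_leaves_interior G.
by rewrite lG cG -(cards_leaves_interior H) => /addIn ->.
Qed.

(** A plane of test functions with quotients at most [c]. Stated on vertices, it passes along
    isomorphisms without any comparison of matrices. *)
Definition low_pair (R : realType) (G : sgraph) (c : R) := exists f g : G -> R,
  [/\ vanishing f, vanishing g,
     (forall a b, (forall x, a * f x + b * g x = 0) -> a = 0 /\ b = 0) &
     (forall a b (h := fun x => a * f x + b * g x), total_energy h <= 2 * c * total_sq h)].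

Lemma isomorphic_low_pair (R : realType) (G H : sgraph) (c : R) :
  isomorphic G H -> low_pair H c -> low_pair G c.
Proof.
case=> h bij he [f [g [f0 g0 ind le_c]]]; exists (f \o h), (g \o h); split.
- by move=> x xL; rewrite /= f0 // (iso_leaf bij he).
- by move=> x xL; rewrite /= g0 // (iso_leaf bij he).
- move=> a b hz; apply: ind => y; case: (bij) => h' hh' h'h.
  by rewrite -(h'h y); apply: hz.
move=> a b /=; set F := fun x => a * f x + b * g x.
have := le_c a b; cbv zeta; rewrite -/F.
rewrite /total_energy /total_sq (reindex h) /=; last exact: onW_bij.
rewrite [X in _ <= _ * X -> _](reindex h) /=; last exact: onW_bij.
rewrite (eq_bigr (fun x => \sum_y sqdiff (fun x => a * f (h x) + b * g (h x)) x y)) //.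
move=> x _; rewrite (reindex h) /=; last exact: onW_bij.
by apply: eq_bigr => y _; rewrite /sqdiff he.
Qed.

(** The truncated differences add up to the distance |x - y|, which has the parity of x + y. *)
Lemma odd_leq_dist x y : (odd (x + y) <= (y - x) + (x - y))%N.
Proof.
have := odd_double_half (x + y); rewrite -addnn; have := leq_b1 (odd (x + y)).
by move: (nat_of_bool _) _./2 => o h; lia.
Qed.

Lemma balanced_half x y (b := (x + y)%N) : ((y - x) + (x - y) = odd b)%N ->
  (x = b./2 /\ y = b - b./2)%N \/ (x = b - b./2 /\ y = b./2)%N.
Proof.
have := odd_double_half b; rewrite -addnn; have := leq_b1 (odd b).
by rewrite /b; move: (nat_of_bool _) _./2 => o h; lia.
Qed.

Section FinalBounds.
Variables (R : realType) (G : sgraph) (t b : nat).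
Hypothesis t0 : (0 < t)%N.
Let l2 := dirichlet_eigenvalue R G 2.

Lemma odd_bound (mu : R) : tree_class (2 * t + 1) b G -> path_ground t 2 mu ->
  mu <= l2 /\ (l2 <= mu -> isomorphic G (path_with_center_leaves t (b - 2))).
Proof.
move=> [tG kG bG] gr; have int2 : (1 < #|interior G|)%N by rewrite kG; move: t0; clear; lia.
have [v vI vc] := centroid tG (ltnW int2).
have small u : edge u v -> (#|branch_interior u v| <= t)%N.
  by move=> uv; have := vc u uv; rewrite kG; set a := #|_|; move: a => a; clear; lia.
split; first exact: (center_bound tG int2 vI gr small).
move=> le_l2; have [u1 [u2 [u12 [u1v u2v] [u1I u2I] [I1 I2] [L1 L2]]]] :=
  center_tight tG int2 vI gr small le_l2.
have [s1 [w1 sh1]] := branch_shape_one_leaf tG u1v u1I L1.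
have [s2 [w2 sh2]] := branch_shape_one_leaf tG u2v u2I L2.
rewrite -bG; apply: (center_iso tG vI u12 u1v u2v sh1 sh2 I1 I2 L1 L2 kG).
by have [_ ? _] := path_with_center_leaves_tree t (#|leaves G| - 2).
Qed.

Definition even_end (d : nat) : R := ((b + 2)%:R + Num.sqrt (d%:R ^+ 2 + 4)) / 2.

Lemma even_end_mono d d' : (d < d')%N -> even_end d < even_end d'.
Proof.
move=> dd; rewrite /even_end ltr_pM2r ?invr_gt0 // ltrD2l ltr_sqrt; last first.
  by rewrite ltr_wpDl ?sqr_ge0.
by rewrite ltrD2r ltrXn2r ?ltr_nat.
Qed.

(* The conductance [a] splits an edge so that both ends see the same boundary value. *)
Lemma even_end_split p q : (p + q = b)%N -> exists a : R,
  [/\ 0 < a, even_end ((q - p) + (p - q)) = 1 + a + p%:R &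
      even_end ((q - p) + (p - q)) = 1 + a^-1 + q%:R].
Proof.
move=> pq; pose d : R := q%:R - p%:R; pose S := Num.sqrt (d ^+ 2 + 4).
have nd : ((q - p) + (p - q))%:R ^+ 2 = d ^+ 2.
  have [pq'|pq'] := leqP p q.
    by rewrite (eqP pq') addn0 natrB.
  by rewrite (eqP (ltnW pq')) add0n natrB 1?ltnW // -sqrrN opprB.
have S2 : S ^+ 2 = d ^+ 2 + 4 by rewrite sqr_sqrtr // addr_ge0 ?sqr_ge0.
have S0 : 0 < S by rewrite sqrtr_gt0 ltr_wpDl ?sqr_ge0.
have dS : `|d| < S.
  by rewrite -(@ltr_pXn2r _ 2) ?nnegrE ?normr_ge0 ?ltW // real_normK ?num_real // S2 ltrDl.
have [dS1 dS2] : d < S /\ - d < S by move: dS; rewrite ltr_norml => /andP[]; lra.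
have a0 : 0 < (d + S) / 2 by lra.
have ai : ((d + S) / 2)^-1 = (S - d) / 2.
  apply: (@mulfI _ ((d + S) / 2)); first by rewrite gt_eqF.
  rewrite divff ?gt_eqF //; move: S2; lra.
(* The positive root of a^2 - d a - 1 = 0, that is, of a - 1/a = q - p. *)
exists ((d + S) / 2); rewrite ai /even_end nd -/S -pq !natrD /d; split=> //; lra.
Qed.

Lemma even_bound (mu : R) (p := b./2) (q := (b - b./2)%N) :
  tree_class (2 * t) b G -> path_ground t (even_end (odd b)) mu ->
  mu <= l2 /\ (l2 <= mu -> isomorphic G (join_C t p t q)).
Proof.
move=> [tG kG bG] gr; have int2 : (1 < #|interior G|)%N by rewrite kG; move: t0; clear; lia.
have [v vI vc] := centroid tG (ltnW int2).
have small u : edge u v -> (#|branch_interior u v| <= t)%N.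
  by move=> uv; have := vc u uv; rewrite kG; set a := #|_|; move: a => a; clear; lia.
have [/existsP[u /andP[uv /eqP Iu]]|/existsPn none] :=
  boolP [exists u, edge u v && (#|branch_interior u v| == t)]; last first.
  have smaller u : edge u v -> (#|branch_interior u v| <= t.-1)%N.
    move=> uv; have := small u uv; have := none u; rewrite uv /=.
    by set a := #|_|; move: a => a; move: t0; clear; lia.
  (* For [t = 1] all branches at [v] would have empty interior, but there is a second interior
     vertex. *)
  have t1 : (0 < t.-1)%N.
    rewrite lt0n; apply/eqP => t1.
    have [x] : exists x, x \in interior G :\ v.
      by apply/card_gt0P; move: int2; rewrite (cardsD1 v) vI.
    rewrite in_setD1 => /andP[xv xI]; have [u uv xu] := branch_cover tG xv.
    have : (0 < #|branch_interior u v|)%N by apply/card_gt0P; exists x; rewrite in_setI xu.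
    by rewrite ltnNge -t1 smaller.
  (* Branches with fewer than [t] interior vertices allow the bound at a vertex for a path shorter
     by one, which beats [mu] for every end potential. *)
  have [mu' gr'] := path_ground_exists (2 : R) t1.
  have lt_mu : mu < l2.
    apply: lt_le_trans (center_bound tG int2 vI gr' smaller).
    by apply: (@path_ground_shift _ t.-1 (even_end (odd b)) _ _ t1 _ gr'); rewrite prednK.
  by split; [exact: ltW | rewrite leNgt lt_mu].
have vu : edge v u by rewrite edge_sym.
have uI : u \in interior G.
  rewrite /interior in_setC; apply/negP => uL.
  by move: t0; rewrite -Iu leaf_branch_interior // cards0.
have BC := branchC tG uv.
have Iv : #|branch_interior v u| = t.
  have := cardsID (branch u v) (interior G); rewrite kG setDE -BC.
  rewrite (setIC _ (branch u v)) (setIC _ (branch v u)) -/(branch_interior u v).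
  by rewrite -/(branch_interior v u) Iu; set a := #|_|; move: a => a; clear; lia.
pose pu := #|branch_leaves u v|; pose pv := #|branch_leaves v u|.
have pq : (pu + pv = b)%N.
  have := cardsID (branch u v) (leaves G); rewrite bG setDE -BC.
  by rewrite (setIC _ (branch u v)) (setIC _ (branch v u)).
pose n := ((pv - pu) + (pu - pv))%N.
have nb : (odd b <= n)%N by rewrite -pq odd_leq_dist.
have [a [a0 yu yv]] := even_end_split pq.
have [mu' gr'] := path_ground_exists (even_end n) t0.
have Iu' : (#|branch_interior u v| <= t)%N by rewrite Iu.
have Iv' : (#|branch_interior v u| <= t)%N by rewrite Iv.
have bound := edge_bound tG int2 uv uI vI Iu' Iv' a0 gr' yu yv.
(* [n] is the difference of the leaf numbers on the two sides; if they are not balanced, the end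
   potential is larger and the bound strict. *)
have [n_eq|n_lt] : (n = odd b :> nat) \/ (odd b < n)%N.
  by move: nb; rewrite leq_eqVlt => /orP[/eqP->|]; [left|right].
  have mu_eq : mu' = mu by apply: (path_ground_unique t0 gr'); rewrite n_eq.
  rewrite mu_eq in bound gr'; split=> // le_l2.
  have [[_ [s [w sh]]] [_ [s' [w' sh']]]] :=
    edge_tight tG int2 uv uI vI Iu' Iv' a0 gr' yu yv le_l2.
  have half : (pu = p /\ pv = q) \/ (pu = q /\ pv = p).
    by rewrite /p /q -pq; apply: balanced_half; rewrite pq.
  have := shapes_join_C tG uv sh sh'; have := shapes_join_C tG vu sh' sh.
  rewrite Iu Iv -/pu -/pv.
  by case: half => -[-> ->] h1 h2; [apply: h2|apply: h1]; apply: join_C_connected.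
have lt_mu : mu < l2 by apply: lt_le_trans bound; apply: path_ground_mono t0 gr gr' (even_end_mono n_lt).
by split; [exact: ltW | rewrite leNgt lt_mu].
Qed.

End FinalBounds.

(** * Upper bounds for the extremal trees *)

Section UpperBounds.
Variable R : realType.

Lemma path_graph_lap n (F : nat -> R) (i : 'I_n.+1) :
  lap (G := path_graph n.+1) (fun j => F (val j)) i =
  (if nat_of_ord i is k.+1 then F i - F k else 0) +
  (if (i.+1 < n.+1)%N then F i - F i.+1 else 0).
Proof.
rewrite /lap.
have dist (j : 'I_n.+1) : (edge (i : path_graph n.+1) j)%:R * (F i - F j) =
    (F i - F j) * (j == i.-1 :> nat)%:R *+ (0 < i)%N + (F i - F j) * (j == i.+1 :> nat)%:R.
  rewrite [edge _ _]/= /path_rel; case: (nat_of_ord i) => [|k].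
    by rewrite mulr0n add0r orbF eq_sym mulrC.
  rewrite mulr1n /= eqSS -mulrDr mulrC; congr (_ * _).
  rewrite [_ == val j]eq_sym; case: eqP => [->|_]; case: eqP => // E; rewrite ?addr0 ?add0r //.
  by move: E; clear; lia.
rewrite (eq_bigr _ (fun j _ => dist j)) big_split /=; congr (_ + _).
  case: i {dist} => [[|k] hi] /=; first by rewrite big1 // => j _; rewrite mulr0n.
  under eq_bigr => j _ do rewrite mulr1n.
  exact: (sum_delta_lt (fun j => F k.+1 - F j) (ltnW hi)).
case: ifP => hi; first exact: (sum_delta_lt (fun j => F i - F j) hi).
rewrite big1 // => j _; case: eqP => [E|]; rewrite ?mulr0 //.
by have := ltn_ord j; rewrite E hi.
Qed.

Section Even.
Variables (t : nat) (y mu a : R) (phi : nat -> R).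
Hypotheses (t0 : (0 < t)%N) (sphi : supported t phi) (eqphi : path_eq t y mu phi).
Hypotheses (phi0 : phi 0%N != 0).

Definition C_fun s q (c : R) (x : C_graph s q) : R :=
  if x is inl (inl i) then c * phi (val i) else 0.

(** In [C_graph t q] the vertex v_1 has degree [q], whereas the path equation has [y] on its
    diagonal there; elsewhere the equations agree. *)
Lemma C_lap q c (i : C_path t) : (0 < q)%N ->
  lap (C_fun (q := q) c) (inl (inl i)) =
  mu * (c * phi (val i)) - (val i == 0%N)%:R * (y - q%:R) * (c * phi 0%N).
Proof.
move=> q0; rewrite /lap !big_sumType /= big_ord1 /=.
have -> : \sum_(j < t.-1.+1) (path_rel i j)%:R * (c * phi i - c * phi j) =
    lap (G := path_graph t.-1.+1) (fun j => c * phi (val j)) i by [].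
rewrite (path_graph_lap (fun j => c * phi j)) sumr_const card_ord.
have it : (i < t)%N by apply: leq_trans (ltn_ord i) _; rewrite prednK.
have lastE : (inl i == inl (C_last t) :> C_path t + 'I_q.-1) = (i.+1 == t).
  apply/eqP/eqP => [[->]|E]; first by rewrite /= prednK.
  by congr inl; apply: val_inj; apply: succn_inj; exact: etrans E (esym (prednK t0)).
have succ : (if (i.+1 < t.-1.+1)%N then c * phi i - c * phi i.+1 else 0) +
    (inl i == inl (C_last t) :> C_path t + 'I_q.-1)%:R * (c * phi i - 0) = c * (phi i - phi i.+1).
  have -> : (i.+1 < t.-1.+1)%N = (i.+1 < t)%N by apply/idP/idP => h; apply: (leq_trans h); rewrite prednK.
  rewrite lastE; have [h|h|h] := ltngtP i.+1 t.
  - by rewrite mul0r addr0 mulrBr.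
  - by move: it; rewrite ltnNge -ltnS h.
  have z : phi i.+1 = 0 by apply: sphi; rewrite h.
  by rewrite mul1r add0r z !subr0.
rewrite addrAC -[X in X + _ = _]addrA succ.
have firstE : (i == C_first t) = (val i == 0%N) by apply/eqP/eqP => [->//|E]; apply: val_inj.
rewrite firstE -[val i]/(nat_of_ord i); have := eqphi it.
case: (nat_of_ord i) => [|k] /= eqi.
  rewrite mul1r -[q in RHS]prednK // -natr1 -mulr_natl -[mu * _]mulrCA -eqi; ring.
by rewrite !mul0r mul0rn !subr0 addr0 -[mu * _]mulrCA -eqi; ring.
Qed.

Variables (p q : nat).
Hypotheses (p0 : (0 < p)%N) (q0 : (0 < q)%N) (a0 : 0 < a).
Hypotheses (yp : y = 1 + a + p%:R) (yq : y = 1 + a^-1 + q%:R).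
Notation T := (join_C t p t q).

Definition join_C_fun (c d : R) (x : T) : R :=
  match x with inl z => C_fun c z | inr z => C_fun d z end.

Lemma join_C_fun_vanishing c d : vanishing (join_C_fun c d).
Proof.
move=> x xL; have : x \notin interior T by rewrite /interior in_setC negbK.
by rewrite join_C_interior; case: x {xL} => [[[i|j]|k]|[[i|j]|k]].
Qed.

Lemma sum_C_fun s n c (h : C_graph s n -> R) :
  \sum_x C_fun c x * h x = \sum_(i < s.-1.+1) c * phi i * h (inl (inl i)).
Proof.
rewrite !big_sumType /= [X in _ + X]big1 ?addr0 => [|i _]; last by rewrite mul0r.
by rewrite [X in _ + X]big1 ?addr0 // => i _; rewrite mul0r.
Qed.

(** The eigenvalue equation fails at the two joined vertices only, and the total defect is a ((c +
    d/a) phi(0))^2 >= 0. It vanishes when a c + d = 0, which is the condition imposed in the lower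
    bound. *)
Lemma join_C_energy c d :
  total_energy (join_C_fun c d) <= 2 * mu * total_sq (join_C_fun c d).
Proof.
have cross s n (b0 : bool) (k : R) : \sum_(x : C_graph s n)
    (b0 && (x == C_v1 s n))%:R * (k - C_fun d x) = b0%:R * (k - d * phi 0%N).
  rewrite (bigD1 (C_v1 s n)) //= andbT big1 ?addr0 // => x /negbTE->.
  by rewrite andbF mul0r.
have cross' s n (b0 : bool) (k : R) : \sum_(x : C_graph s n)
    ((x == C_v1 s n) && b0)%:R * (k - C_fun c x) = b0%:R * (k - c * phi 0%N).
  rewrite (bigD1 (C_v1 s n)) //= big1 ?addr0 // => x /negbTE->.
  by rewrite mul0r.
have first n (i : C_path t) : (inl (inl i) == C_v1 t n) = (val i == 0%N).
  by apply/eqP/eqP => [[->]//|E]; do 2!congr inl; apply: val_inj.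
have lapl (i : C_path t) : lap (join_C_fun c d) (inl (inl (inl i))) =
    mu * (c * phi i) - (val i == 0%N)%:R * ((a * c + d) * phi 0%N).
  rewrite /lap big_sumType /= cross.
  have -> : \sum_(x : C_graph t p) (edge (inl (inl i) : C_graph t p) x)%:R *
    (c * phi i - C_fun c x) = lap (C_fun (q := p) c) (inl (inl i)) by [].
  rewrite C_lap // first yp -[val i]/(nat_of_ord i).
  by case: (nat_of_ord i) => [|k] /=; ring.
have lapr (i : C_path t) : lap (join_C_fun c d) (inr (inl (inl i))) =
    mu * (d * phi i) - (val i == 0%N)%:R * ((a^-1 * d + c) * phi 0%N).
  rewrite /lap big_sumType /= cross'.
  have -> : \sum_(x : C_graph t q) (edge (inl (inl i) : C_graph t q) x)%:R *
    (d * phi i - C_fun d x) = lap (C_fun (q := q) d) (inl (inl i)) by [].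
  rewrite C_lap // first yq -[val i]/(nat_of_ord i).
  by case: (nat_of_ord i) => [|k] /=; ring.
rewrite total_energy_lap -mulrA ler_pM2l // big_sumType /= !sum_C_fun.
under eq_bigr => i _ do rewrite lapl.
under [X in _ + X]eq_bigr => i _ do rewrite lapr.
have sq x : join_C_fun c d x ^+ 2 = join_C_fun c d x * join_C_fun c d x by rewrite expr2.
rewrite /total_sq (eq_bigr _ (fun x _ => sq x)) big_sumType /= !sum_C_fun /=.
have corr z k : \sum_(i < t.-1.+1) z * phi i * (mu * (z * phi i) - (val i == 0%N)%:R * k) =
    mu * (\sum_(i < t.-1.+1) z * phi i * (z * phi i)) - z * phi 0%N * k.
  rewrite mulr_sumr (bigD1 ord0) // [in RHS](bigD1 ord0) //= -[RHS]addrA.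
  rewrite [X in _ + X = _](eq_bigr (fun i : 'I_t.-1.+1 => mu * (z * phi i * (z * phi i)))); first by ring.
  by move=> i; rewrite -val_eqE /= => /negbTE->; rewrite mul0r subr0; ring.
rewrite !corr mulrDr -subr_ge0.
have -> : forall A B C D : R, A + B - (A - C + (B - D)) = C + D by move=> *; ring.
have -> : c * phi 0%N * ((a * c + d) * phi 0%N) + d * phi 0%N * ((a^-1 * d + c) * phi 0%N) =
    a * ((c + a^-1 * d) * phi 0%N) ^+ 2 by field; rewrite gt_eqF.
by rewrite mulr_ge0 ?sqr_ge0 // ltW.
Qed.

Lemma join_C_low_pair : low_pair T mu.
Proof.
exists (join_C_fun 1 0), (join_C_fun 0 1).
have comb c d x : c * join_C_fun 1 0 x + d * join_C_fun 0 1 x = join_C_fun c d x.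
  by case: x => [[[i|j]|k]|[[i|j]|k]] /=; ring.
split; [exact: join_C_fun_vanishing|exact: join_C_fun_vanishing| |].
  move=> c d h0; have z : (0 < t.-1.+1)%N by [].
  have := h0 (inl (C_v1 t p)); have := h0 (inr (C_v1 t q)); rewrite !comb /=.
  by move=> /eqP; rewrite mulf_eq0 (negbTE phi0) orbF => /eqP -> /eqP; rewrite mulf_eq0 (negbTE phi0) orbF => /eqP->.
move=> c d; cbv zeta.
rewrite /total_energy /total_sq (eq_bigr (fun x => \sum_y sqdiff (join_C_fun c d) x y)); last first.
  by move=> x _; apply: eq_bigr => z _; rewrite /sqdiff !comb.
rewrite [X in _ <= _ * X](eq_bigr (fun x => join_C_fun c d x ^+ 2)); last by move=> x _; rewrite comb.
exact: join_C_energy.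
Qed.

End Even.

Section Odd.
Variables (t m : nat) (mu : R) (phi : nat -> R).
Hypotheses (t0 : (0 < t)%N) (sphi : supported t phi) (eqphi : path_eq t 2 mu phi).
Hypotheses (phi0 : phi 0%N != 0).
Notation T := (path_with_center_leaves t m).

(** Index t + 1 is the centre, where the value is 0. Both copies of [phi] start next to it, and
    [phi t = 0] falls on the end leaves 0 and 2t + 2. *)
Definition two_arms (c d : R) (j : nat) : R :=
  if (j <= t)%N then c * phi (t - j)%N else
  if j == t.+1 then 0 else d * phi (j - t.+2)%N.

Lemma two_arms_left c d k : (k <= t)%N -> two_arms c d (t - k)%N = c * phi k.
Proof. by move=> kt; rewrite /two_arms leq_subr subKn. Qed.

Lemma two_arms_mid c d : two_arms c d t.+1 = 0.
Proof. by rewrite /two_arms ltnn eqxx. Qed.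

Lemma two_arms_right c d k : two_arms c d (k + t.+2)%N = d * phi k.
Proof.
rewrite /two_arms addnK !ifF //; first by apply/negbTE; rewrite neq_ltn; apply/orP; right; clear; lia.
by apply/negbTE; rewrite -ltnNge; clear; lia.
Qed.

(** The zero at the centre acts as the missing neighbour of [phi 0], in agreement with end potential
    2. *)
Lemma two_arms_eq c d i : (0 < i < 2 * t + 2)%N -> i != t.+1 ->
  2 * two_arms c d i - two_arms c d i.-1 - two_arms c d i.+1 = mu * two_arms c d i.
Proof.
move=> /andP[i0 i2] it; have [le_it|lt_ti] := leqP i t.
  have kt : (t - i < t)%N by move: t0 i0; clear; lia.
  have -> : i.-1 = (t - (t - i).+1)%N by move: le_it i0; clear; lia.
  rewrite (two_arms_left c d kt).
  have iE : i = (t - (t - i))%N by rewrite subKn.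
  rewrite {1 4}iE two_arms_left ?leq_subr //.
  have := eqphi kt; case E: (t - i)%N => [|k] eqk.
    have -> : i = t by move: E le_it; clear; lia.
    by rewrite two_arms_mid [mu * _]mulrCA -eqk; ring.
  have -> : i.+1 = (t - k)%N by move: E le_it; clear; lia.
  rewrite two_arms_left; last by move: E; clear; lia.
  by rewrite [mu * _]mulrCA -eqk; ring.
have [k kE] : exists k, i = (k + t.+2)%N.
  by exists (i - t.+2)%N; rewrite subnK //; move: it lt_ti; clear; lia.
have kt : (k < t)%N by move: i2; rewrite kE; clear; lia.
rewrite kE two_arms_right -addSn two_arms_right.
have := eqphi kt; case: k {kE kt} => [|k] eqk.
  by rewrite add0n two_arms_mid; rewrite [mu * _]mulrCA -eqk; ring.
by rewrite addSn two_arms_right [mu * _]mulrCA -eqk; ring.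
Qed.

Definition center_fun (c d : R) (x : T) : R :=
  if x is inl i then two_arms c d (val i) else 0.

Lemma two_arms_zero c d : two_arms c d 0 = 0.
Proof. by have := two_arms_left c d (leqnn t); rewrite subnn sphi // mulr0. Qed.

Lemma two_arms_last c d : two_arms c d (2 * t + 2) = 0.
Proof.
have -> : (2 * t + 2 = t + t.+2)%N by clear; lia.
by rewrite two_arms_right sphi // mulr0.
Qed.

Lemma center_fun_vanishing c d : vanishing (center_fun c d).
Proof.
move=> x xL; have : x \notin interior T by rewrite /interior in_setC negbK.
rewrite (path_with_center_leaves_interior t0); case: x {xL} => [[i hi]|j] //=.
rewrite negb_and -!leqNgt leqn0 => /orP[/eqP->|le_i]; first exact: two_arms_zero.
have -> : i = (2 * t + 2)%N by apply/eqP; rewrite eqn_leq le_i andbT -ltnS.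
exact: two_arms_last.
Qed.

(** The eigenvalue equation may fail at the centre, but it is multiplied there by the value 0. *)
Lemma center_energy c d :
  total_energy (center_fun c d) = 2 * mu * total_sq (center_fun c d).
Proof.
rewrite total_energy_lap -mulrA /total_sq; congr (2 * _); rewrite mulr_sumr.
apply: eq_bigr => x _; case: x => [i|j]; last by rewrite mul0r expr0n mulr0.
have [i0|i0] := eqVneq (center_fun c d (inl i)) 0; first by rewrite i0 mul0r expr0n mulr0.
have in0 : (0 < i)%N.
  by rewrite lt0n; apply: contra i0 => /eqP i0; rewrite /= i0 two_arms_zero.
have i2 : (i < 2 * t + 2)%N.
  rewrite ltn_neqAle -ltnS ltn_ord andbT.
  by apply: contra i0 => /eqP i0; rewrite /= i0 two_arms_last.
have it : val i != t.+1.
  by apply: contra i0 => /eqP i0; rewrite /= i0 two_arms_mid.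
have cE : val (path_center t) = t.+1 by rewrite /= inordK //; clear; lia.
have notc : (i == path_center t) = false.
  by apply/negbTE; apply: contra it => /eqP ->; rewrite cE.
rewrite /lap big_sumType /= [X in _ + X]big1 ?addr0 => [|j _]; last by rewrite notc mul0r.
have -> : \sum_(j < (2 * t + 2).+1) (path_rel i j)%:R * (two_arms c d i - two_arms c d j) =
  lap (G := path_graph (2 * t + 2).+1) (fun j => two_arms c d (val j)) i by [].
rewrite (path_graph_lap (two_arms c d)) ltnS i2 -[val i]/(nat_of_ord i).
have := two_arms_eq c d (i := nat_of_ord i); rewrite in0 i2 => /(_ isT it).
case: (nat_of_ord i) in0 => // k _ /= h.
by rewrite expr2 mulrCA -h; ring.
Qed.

Lemma center_low_pair : low_pair T mu.
Proof.
exists (center_fun 1 0), (center_fun 0 1).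
have comb c d x : c * center_fun 1 0 x + d * center_fun 0 1 x = center_fun c d x.
  by case: x => [i|j] /=; [rewrite /two_arms; case: ifP => _; [|case: ifP => _]|]; ring.
split; [exact: center_fun_vanishing|exact: center_fun_vanishing| |].
  move=> c d h0.
  (* The two neighbours of the centre, t and t + 2, carry [c * phi 0] and [d * phi 0]. *)
  have h1 : (t < (2 * t + 2).+1)%N by clear; lia.
  have h2 : (t.+2 < (2 * t + 2).+1)%N by move: t0; clear; lia.
  have := h0 (inl (Ordinal h1)); have := h0 (inl (Ordinal h2)); rewrite !comb /=.
  have := two_arms_right c d 0; rewrite add0n => -> /eqP; rewrite mulf_eq0 (negbTE phi0) orbF => /eqP dz.
  have := two_arms_left c d (leq0n t); rewrite subn0 => -> /eqP; rewrite mulf_eq0 (negbTE phi0) orbF => /eqP.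
  by [].
move=> c d; cbv zeta.
rewrite /total_energy /total_sq (eq_bigr (fun x => \sum_y sqdiff (center_fun c d) x y)); last first.
  by move=> x _; apply: eq_bigr => z _; rewrite /sqdiff !comb.
rewrite [X in _ <= _ * X](eq_bigr (fun x => center_fun c d x ^+ 2)); last by move=> x _; rewrite comb.
by rewrite -/(total_energy _) center_energy.
Qed.

End Odd.
End UpperBounds.

(** * Conclusion *)

Lemma path_ground_vector (R : realType) t (y mu : R) : (0 < t)%N -> path_ground t y mu ->
  exists phi, [/\ supported t phi, path_eq t y mu phi & phi 0%N != 0].
Proof.
move=> t0 /path_ground_pos[phi [sphi pphi _ eqphi _]].
by exists phi; split=> //; rewrite gt_eqF ?pphi.
Qed.

Lemma low_pair_lambda2_le (R : realType) (G : sgraph) (c : R) :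
  (1 < #|interior G|)%N -> low_pair G c -> dirichlet_eigenvalue R G 2 <= c.
Proof. by move=> int2 [f [g [f0 g0 ind le_c]]]; apply: lambda2_le f0 g0 ind le_c. Qed.

(** Test functions on [H] show that [mu] is reached within the class, so a minimizer has eigenvalue
    at most [mu] and falls under the equality case of the bound. *)
Lemma minimizer_characterization (R : realType) k b (H : sgraph) (mu : R) : (1 < k)%N ->
  tree_class k b H -> low_pair H mu ->
  (forall G, tree_class k b G -> mu <= dirichlet_eigenvalue R G 2 /\
     (dirichlet_eigenvalue R G 2 <= mu -> isomorphic G H)) ->
  forall T, attains_min_lambda2 R k b T <-> isomorphic T H.
Proof.
move=> k1 cH lH bound T; have upper G : tree_class k b G -> low_pair G mu ->
    dirichlet_eigenvalue R G 2 <= mu.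
  by move=> [_ kG _] lG; apply: low_pair_lambda2_le => //; rewrite kG.
split=> [[cT minT]|iso].
  have [_] := bound T cT; apply; apply: le_trans (minT H cH) _; exact: upper.
have cT := isomorphic_tree_class iso cH; split=> // G cG.
apply: le_trans (upper T cT (isomorphic_low_pair iso lH)) _.
by have [] := bound G cG.
Qed.

(** Both parities of [b] are handled together: q - p is [odd b]. *)
Lemma even_minimizer (R : realType) t b (p := b./2) (q := (b - b./2)%N) :
  (0 < t)%N -> (1 < b)%N ->
  forall T, attains_min_lambda2 R (2 * t) b T <-> isomorphic T (join_C t p t q).
Proof.
move=> t0 b1.
have p0 : (0 < p)%N by rewrite half_gt0.
have [pq d q0] : [/\ (p + q = b)%N, (q - p + (p - q) = odd b)%N & (0 < q)%N].
  have := odd_double_half b; rewrite -/p -addnn /q -/p; have := leq_b1 (odd b).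
  by move: (nat_of_bool _) p p0 => o p' p0'; split; lia.
have [mu gr] := path_ground_exists (even_end R b (odd b)) t0.
have [phi [sphi eqphi phi0]] := path_ground_vector t0 gr.
have [a [a0 yp yq]] := even_end_split R pq; rewrite d in yp yq.
apply: (@minimizer_characterization R _ _ _ mu).
- by move: t0; clear; lia.
- by rewrite mul2n -addnn -pq; apply: join_C_class.
- exact: (join_C_low_pair t0 sphi eqphi phi0 p0 q0 a0 yp yq).
by move=> G cG; apply: even_bound.
Qed.

Local Close Scope ring_scope.

Theorem theorem1p3 (R : realType) (k b : nat) (hk : (2 <= k)%N) (hb : (2 <= b)%N) :
  [/\ (forall t : nat, k = (2 * t + 1)%N ->
        forall T : sgraph,
          attains_min_lambda2 R k b T <->
          isomorphic T (path_with_center_leaves t (b - 2))),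
      (forall t r : nat, k = (2 * t)%N -> b = (2 * r)%N ->
        forall T : sgraph,
          attains_min_lambda2 R k b T <->
          isomorphic T (join_C t r t r))
    & (forall t r : nat, k = (2 * t)%N -> b = (2 * r + 1)%N ->
        forall T : sgraph,
          attains_min_lambda2 R k b T <->
          isomorphic T (join_C t r t r.+1))].
Proof.
split.
- move=> t kt; have t0 : (0 < t)%N by move: hk; rewrite kt; clear; lia.
  have [mu gr] := path_ground_exists (2 : R) t0.
  have [phi [sphi eqphi phi0]] := path_ground_vector t0 gr.
  apply: (@minimizer_characterization R _ _ _ mu) => //.
  + by rewrite kt -[b in tree_class _ b](subnK hb); apply: path_with_center_leaves_class.
  + exact: (center_low_pair (b - 2) t0 sphi eqphi phi0).
  by rewrite kt => G cG; apply: odd_bound.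
- move=> t r kt br T; have t0 : (0 < t)%N by move: hk; rewrite kt; clear; lia.
  have r1 : b./2 = r by rewrite br mul2n doubleK.
  have r2 : (b - b./2)%N = r by rewrite r1 br; clear; lia.
  by have := even_minimizer R t0 hb T; rewrite r2 r1 -kt.
move=> t r kt br T; have t0 : (0 < t)%N by move: hk; rewrite kt; clear; lia.
have r1 : b./2 = r by rewrite br addn1 mul2n -uphalfE uphalf_double.
have r2 : (b - b./2)%N = r.+1 by rewrite r1 br; clear; lia.
by have := even_minimizer R t0 hb T; rewrite r2 r1 -kt.
Qed.
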